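(* There is an algorithm with the following guarantee. Given symmetric matrices $C, A_1,\dots,A_m\in\mathbb{R}^{n\times n}$ and a vector $b\in\mathbb{R}^m$, consider the semidefinite program $$\max_{X\in\mathbb{R}^{n\times n}}\ \langle C,X\rangle\quad\text{s.t.}\quad \langle A_i,X\rangle=b_i\ \ \forall i\in[m],\quad X\succeq 0 .$$ Assume that the program has no redundant constraints and that every feasible solution $X$ satisfies $\|X\|_2\le R$, and let $X^*$ be an optimal solution. Then for every $0<\epsilon\le0.01$ the algorithm runs in time $$O^*\Big((mn)^{1/4}\cdot\big(m^2n^{\omega}+m^4\big)\cdot\log(1/\epsilon)\Big)$$ and outputs a positive semidefinite matrix $X\in\mathbb{R}^{n\times n}$ such that $$\langle C,X\rangle\ \ge\ \langle C,X^*\rangle-\epsilon\cdot\|C\|_2\cdot R\qquad\text{and}\qquad \sum_{i=1}^m\big|\langle A_i,X\rangle-b_i\big|\ \le\ 4n\epsilon\cdot\Big(R\sum_{i=1}^m\|A_i\|_1+\|b\|_1\Big).$$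
   Context: $\langle A,B\rangle=\sum_{i,j}A_{ij}B_{ij}$ is the matrix inner product; $\|\cdot\|_2$ of a matrix is the spectral norm; $\|A_i\|_1$ is the Schatten 1-norm of $A_i$; $\|b\|_1$ is the $\ell_1$ norm. ''No redundant constraints'' means $A_1,\dots,A_m$ are linearly independent (so $m\le n^2$). $\omega$ is the exponent of matrix multiplication (two $k\times k$ matrices can be multiplied in $k^{\omega+o(1)}$ time), taken at its current value $\omega\approx 2.373$. $O^*(\cdot)$ hides $n^{o(1)}$ and $\log^{O(1)}(mn/\epsilon)$ factors. Running time counts real arithmetic operations; inverses, square roots and spectral decompositions of $k\times k$ symmetric matrices are taken to cost $O^*(k^{\omega})$. The paper's algorithm is an interior point method using the hybrid barrier $\phi(y)=225\sqrt{n/m}\,\big(\phi_{\mathrm{vol}}(y)+\frac{m-1}{n-1}\phi_{\log}(y)\big)$ on the dual feasible region, where $S(y)=\sum_iy_iA_i-C$, $\phi_{\log}(y)=-\log\det S(y)$ and $\phi_{\mathrm{vol}}(y)=\frac12\log\det(\nabla^2\phi_{\log}(y))$. *)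

(* Defs.v *)
From HB Require Import structures.
From mathcomp Require Import all_boot all_order all_algebra.
From mathcomp Require Import all_classical all_reals all_analysis.

Set Implicit Arguments.
Unset Strict Implicit.
Unset Printing Implicit Defensive.

Import Order.TTheory GRing.Theory Num.Theory.
Import numFieldNormedType.Exports.

Local Open Scope classical_set_scope.
Local Open Scope ring_scope.

Section Matrices.
Context {R : realType}.

Definition mxdot n (A B : 'M[R]_n) : R := \sum_(i < n) \sum_(j < n) A i j * B i j.

Definition psdmx n (X : 'M[R]_n) : Prop :=
  X \is symmetricmx /\ forall v : 'cV[R]_n, 0 <= (v^T *m X *m v) 0 0.

Definition euclidean_norm n (v : 'cV[R]_n) : R :=
  Num.sqrt (\sum_(i < n) v i 0 ^+ 2).

Definition spectral_norm n (A : 'M[R]_n) : R :=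
  sup [set euclidean_norm (A *m v) | v in [set v | euclidean_norm v <= 1]].

(* The s_i are the nonnegative numbers such that the s_i^2 are the eigenvalues
   of A^T A with multiplicity; they exist for every real A and are unique up to
   order, so the default of xget is never used. *)
Definition singular_values n (A : 'M[R]_n) : 'rV[R]_n :=
  xget 0 [set s : 'rV[R]_n | (forall i, 0 <= s 0 i) /\
    char_poly (A^T *m A) = \prod_(i < n) ('X - (s 0 i ^+ 2)%:P)].

Definition schatten1_norm n (A : 'M[R]_n) : R :=
  \sum_(i < n) singular_values A 0 i.

Definition l1_norm m (b : 'cV[R]_m) : R := \sum_(i < m) `|b i 0|.

End Matrices.

Section SDP.
Context {R : realType} {m n : nat}.

Definition sdp_feasible (A : 'I_m -> 'M[R]_n) (b : 'cV[R]_m) (X : 'M[R]_n) :=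
  psdmx X /\ forall i, mxdot (A i) X = b i 0.

Definition sdp_optimal (C : 'M[R]_n) (A : 'I_m -> 'M[R]_n) (b : 'cV[R]_m)
    (X : 'M[R]_n) :=
  sdp_feasible A b X /\
  forall Y, sdp_feasible A b Y -> mxdot C Y <= mxdot C X.

Definition no_redundant_constraints (A : 'I_m -> 'M[R]_n) : Prop :=
  free (codom A).

End SDP.

(* Programs of a real random access machine. Its memory has an array of natural
   numbers, used for indexing and control, and an array of real matrices, each
   unbounded in both directions. All addresses may be computed. Real numbers
   influence addresses and control only through comparisons, and the only
   constants are natural numbers. *)

Inductive iexp : Type :=
| INat of nat
| ILoad of iexp
| IAdd of iexp & iexp
| ISub of iexp & iexp
| IMul of iexp & iexp.

Inductive rexp : Type :=
| RNat of iexp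
| RLoad of iexp & iexp & iexp
| RAdd of rexp & rexp
| RSub of rexp & rexp
| RMul of rexp & rexp
| RDiv of rexp & rexp.

Inductive test : Type :=
| TILe of iexp & iexp
| TRLe of rexp & rexp
| TNot of test.

(* The last four instructions act on the leading k x k blocks of the matrices
   addressed by their arguments, where k is the last argument. Destinations
   come first; MSpec has two, for the eigenvectors and for the diagonal matrix
   of eigenvalues. *)
Inductive cmd : Type :=
| Skip
| ISet of iexp & iexp
| RSet of iexp & iexp & iexp & rexp
| Seq of cmd & cmd
| If of test & cmd & cmd
| While of test & cmd
| MMul of iexp & iexp & iexp & iexp
| MInv of iexp & iexp & iexp
| MSqrt of iexp & iexp & iexp
| MSpec of iexp & iexp & iexp & iexp.

Fixpoint icost (e : iexp) : nat :=
  match e with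
  | INat _ => 1
  | ILoad e1 => (icost e1).+1
  | IAdd e1 e2 | ISub e1 e2 | IMul e1 e2 => (icost e1 + icost e2)%N.+1
  end.

Fixpoint rcost (e : rexp) : nat :=
  match e with
  | RNat e1 => (icost e1).+1
  | RLoad q i j => (icost q + icost i + icost j)%N.+1
  | RAdd e1 e2 | RSub e1 e2 | RMul e1 e2 | RDiv e1 e2 => (rcost e1 + rcost e2)%N.+1
  end.

Fixpoint tcost (b : test) : nat :=
  match b with
  | TILe e1 e2 => (icost e1 + icost e2)%N.+1
  | TRLe e1 e2 => (rcost e1 + rcost e2)%N.+1
  | TNot b1 => (tcost b1).+1
  end.

Fixpoint arithmetic (c : cmd) : bool :=
  match c with
  | Skip | ISet _ _ | RSet _ _ _ _ => true
  | Seq c1 c2 | If _ c1 c2 => arithmetic c1 && arithmetic c2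
  | While _ c1 => arithmetic c1
  | MMul _ _ _ _ | MInv _ _ _ | MSqrt _ _ _ | MSpec _ _ _ _ => false
  end.

Section Semantics.
Context {R : realType}.

Record store := Store { ints : nat -> nat; mats : nat -> nat -> nat -> R }.

Definition upd (T : Type) (f : nat -> T) (a : nat) (x : T) : nat -> T :=
  fun a' => if a' == a then x else f a'.

Definition block (k : nat) (M : nat -> nat -> R) : 'M[R]_k :=
  \matrix_(i < k, j < k) M i j.

Definition put (k l : nat) (B : 'M[R]_(k, l)) (M : nat -> nat -> R) :
    nat -> nat -> R :=
  fun i j => match (insub i : option 'I_k), (insub j : option 'I_l) with
             | Some i', Some j' => B i' j'
             | _, _ => M i j
             end.

Definition set_int (s : store) (a x : nat) : store :=
  Store (upd (ints s) a x) (mats s).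

Definition set_mat (s : store) (q : nat) (M : nat -> nat -> R) : store :=
  Store (ints s) (upd (mats s) q M).

Definition set_block (s : store) (q k : nat) (B : 'M[R]_k) : store :=
  set_mat s q (put B (mats s q)).

Fixpoint ieval (s : store) (e : iexp) : nat :=
  match e with
  | INat c => c
  | ILoad e1 => ints s (ieval s e1)
  | IAdd e1 e2 => (ieval s e1 + ieval s e2)%N
  | ISub e1 e2 => (ieval s e1 - ieval s e2)%N
  | IMul e1 e2 => (ieval s e1 * ieval s e2)%N
  end.

Fixpoint reval (s : store) (e : rexp) : R :=
  match e with
  | RNat e1 => (ieval s e1)%:R
  | RLoad q i j => mats s (ieval s q) (ieval s i) (ieval s j)
  | RAdd e1 e2 => reval s e1 + reval s e2
  | RSub e1 e2 => reval s e1 - reval s e2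
  | RMul e1 e2 => reval s e1 * reval s e2
  | RDiv e1 e2 => reval s e1 / reval s e2
  end.

Fixpoint teval (s : store) (b : test) : bool :=
  match b with
  | TILe e1 e2 => (ieval s e1 <= ieval s e2)%N
  | TRLe e1 e2 => reval s e1 <= reval s e2
  | TNot b1 => ~~ teval s b1
  end.

(* The choice, among the spectral decompositions of a symmetric matrix, of the
   one returned by the machine. *)
Definition spectral_oracle := forall k : nat, 'M[R]_k -> 'M[R]_k * 'rV[R]_k.

Definition spectral_oracle_spec (eig : spectral_oracle) : Prop :=
  forall (k : nat) (M : 'M[R]_k), M \is symmetricmx ->
    let: (U, d) := eig k M in
    U *m U^T = 1%:M /\ M = U *m diag_mx d *m U^T.

(* exec kappa eig c s t s' : started in s, the program c halts in s' after time
   t. Evaluating a node of an expression or test takes unit time, and a k x k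
   matrix instruction takes additional time kappa k. An instruction applied
   outside the domain of its operation has no execution. *)
Inductive exec (kappa : nat -> R) (eig : spectral_oracle) :
    cmd -> store -> R -> store -> Prop :=
| ExecSkip s : exec kappa eig Skip s 1 s
| ExecISet s a e :
    exec kappa eig (ISet a e) s (icost a + icost e)%N.+1%:R
      (set_int s (ieval s a) (ieval s e))
| ExecRSet s q i j e :
    exec kappa eig (RSet q i j e) s
      (icost q + icost i + icost j + rcost e)%N.+1%:R
      (set_mat s (ieval s q)
         (upd (mats s (ieval s q)) (ieval s i)
            (upd (mats s (ieval s q) (ieval s i)) (ieval s j) (reval s e))))
| ExecSeq c1 c2 s1 s2 s3 t1 t2 :
    exec kappa eig c1 s1 t1 s2 -> exec kappa eig c2 s2 t2 s3 ->
    exec kappa eig (Seq c1 c2) s1 (t1 + t2) s3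
| ExecIf b c1 c2 s s' t :
    exec kappa eig (if teval s b then c1 else c2) s t s' ->
    exec kappa eig (If b c1 c2) s ((tcost b)%:R + t) s'
| ExecWhileF b c s :
    ~~ teval s b -> exec kappa eig (While b c) s (tcost b)%:R s
| ExecWhileT b c s1 s2 s3 t1 t2 :
    teval s1 b -> exec kappa eig c s1 t1 s2 ->
    exec kappa eig (While b c) s2 t2 s3 ->
    exec kappa eig (While b c) s1 ((tcost b)%:R + t1 + t2) s3
| ExecMMul s r p q e (k := ieval s e)
    (M := block k (mats s (ieval s p))) (N := block k (mats s (ieval s q))) :
    exec kappa eig (MMul r p q e) s
      ((icost r + icost p + icost q + icost e)%N.+1%:R + kappa k)
      (set_block s (ieval s r) (M *m N))
| ExecMInv s r p e (k := ieval s e) (M := block k (mats s (ieval s p))) :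
    M \is symmetricmx -> M \in unitmx ->
    exec kappa eig (MInv r p e) s
      ((icost r + icost p + icost e)%N.+1%:R + kappa k)
      (set_block s (ieval s r) (invmx M))
| ExecMSqrt s r p e (k := ieval s e) (M := block k (mats s (ieval s p)))
    (N : 'M[R]_k) :
    psdmx N -> N *m N = M ->
    exec kappa eig (MSqrt r p e) s
      ((icost r + icost p + icost e)%N.+1%:R + kappa k)
      (set_block s (ieval s r) N)
| ExecMSpec s r1 r2 p e (k := ieval s e) (M := block k (mats s (ieval s p))) :
    M \is symmetricmx ->
    exec kappa eig (MSpec r1 r2 p e) s
      ((icost r1 + icost r2 + icost p + icost e)%N.+1%:R + kappa k)
      (set_block (set_block s (ieval s r1) (eig k M).1)
         (ieval s r2) (diag_mx (eig k M).2)).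

Definition mm_input (k : nat) (A B : 'M[R]_k) : store :=
  Store (fun a => if a == 0%N then k else 0%N)
        (fun q => match q with
                  | 0 => put A (fun _ _ => 0)
                  | 1 => put B (fun _ _ => 0)
                  | _ => fun _ _ => 0
                  end).

(* Arithmetic programs multiply k x k matrices in time k^(omega + o(1)). *)
Definition matmul_exponent (omega : R) : Prop :=
  forall delta : R, 0 < delta -> exists (c : cmd) (K : R), arithmetic c /\
    forall (kappa : nat -> R) (eig : spectral_oracle) (k : nat) (A B : 'M[R]_k),
      (0 < k)%N -> exists (t : R) (s : store),
      [/\ exec kappa eig c (mm_input A B) t s,
          t <= K * k%:R `^ (omega + delta) &
          block k (mats s 2) = A *m B].

(* The factor hidden by O^*, with o(1) given by e and O(1) by K and p. *)
Definition Ostar_factor (K : R) (p : nat) (e : nat -> R) (m n : nat) (eps : R) : R :=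
  K * n%:R `^ e n * ln ((m * n)%:R / eps) ^+ p.

(* kappa m n eps k is the cost of a k x k matrix instruction in a computation
   on an instance of size (m, n) with accuracy eps: it is k^omega, up to factors
   hidden by O^* and up to k^o(1). *)
Definition matrix_op_cost (omega : R) (kappa : nat -> nat -> R -> nat -> R) : Prop :=
  exists (K : R) (p : nat) (e : nat -> R), e @ \oo --> (0 : R) /\
    forall (m n : nat) (eps : R) (k : nat),
      (0 < m)%N -> (0 < n)%N -> 0 < eps <= 1 / 100 -> (0 < k)%N ->
      0 <= kappa m n eps k <= Ostar_factor K p e m n eps * k%:R `^ (omega + e k).

Definition sdp_input (m n : nat) (C : 'M[R]_n) (A : 'I_m -> 'M[R]_n)
    (b : 'cV[R]_m) (rho eps : R) : store :=
  Store (fun a => match a with 0 => n | 1 => m | _ => 0%N end)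
        (fun q => match q with
                  | 0 => put C (fun _ _ => 0)
                  | 1 => put b (fun _ _ => 0)
                  | 2 => fun i j => match i, j with
                                    | 0, 0 => eps
                                    | 0, 1 => rho
                                    | _, _ => 0
                                    end
                  | q'.+3 => if (insub q' : option 'I_m) is Some i
                             then put (A i) (fun _ _ => 0) else fun _ _ => 0
                  end).

Definition sdp_output (n : nat) (s : store) : 'M[R]_n := block n (mats s 0%N).

End Semantics.

(* Main.v *)
(* A cutting plane method on a regularized dual. Scale the instance so that the
   entries of C, of the A_i and of the optimal X are at most 1 in absolute value, let
   h = 2^s >= 100 m n / eps, mu = h^-4 and tau = h^-13. The dual of maximizing
   <C,X> - mu/2 |X|^2 - |b - A(X)|^2 / (2 tau) over X >= 0 is an unconstrained smooth
   convex problem in y. To y corresponds X = (C - sum_i y_i A_i)_+ / mu, and X has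
   the required accuracy as soon as the dual gradient at y has norm at most h^-13.
   While the gradient is larger, the halfspace that it cuts off misses a small ball
   around a near minimizer, so the ellipsoid method stops after O(m^2 log h) steps.
   A step takes two n x n matrix operations and O((n^2 + m^2) log h) arithmetic
   operations: real arithmetic being exact, the entries of A_i are stored as digits of
   one real number, so that sum_i y_i A_i, for y rounded to a multiple of h^-60,
   takes m multiplications and the extraction of n^2 digits, and likewise, with the
   roles of the indices exchanged, for the vector of the <A_i,X>. Finally
   n^2 <= n^omega, since writing a k x k product takes time k^2. *)

Require Import Defs.
From HB Require Import structures.
From mathcomp Require Import all_boot all_order all_algebra.
From mathcomp Require Import all_classical all_reals all_analysis.
From mathcomp Require Import ring lra zify.

Set Implicit Arguments.
Unset Strict Implicit.
Unset Printing Implicit Defensive.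

Import Order.TTheory GRing.Theory Num.Theory.
Import numFieldNormedType.Exports.

Local Open Scope classical_set_scope.
Local Open Scope ring_scope.

(** * Inner products and spectral decompositions *)

Section RealMatrices.
Context {R : realType}.

(** With about [m^2] steps, a step may cost little more than [n^omega + m^2]. Forming
    [sum_i y_i A_i] or all [<A_i, X>] entry by entry costs [m n^2], which for [omega < 5/2] is too
    much already at [m = n]; this is the obstacle that packing removes. Strict feasibility is
    assumed on neither side, so the plain dual may have no minimizer, or only huge ones. The term in
    [tau] keeps near minimizers within radius [h^10], and the term in [mu] makes the gradient
    Lipschitz, so that a whole ball around a near minimizer is nearly minimal. Only near minimizers
    are used: they exist by boundedness from below, without compactness. Volumes are replaced by
    determinants: a ball inside [c + B(unit ball)] bounds [det B] from below. Every error is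
    measured in powers of the single number [h]: since [h] is at least 100, [m] and [n], one power
    absorbs a numerical constant or a sum over [m] terms, and two absorb a sum over [n^2] entries.
    The exponents are chosen with room for such losses. *)

Lemma CauchySchwarz_sum (I : finType) (f g : I -> R) :
  (\sum_i f i * g i) ^+ 2 <= (\sum_i f i ^+ 2) * (\sum_i g i ^+ 2).
Proof.
set a := \sum_i f i ^+ 2; set b := \sum_i f i * g i; set c := \sum_i g i ^+ 2.
have a0 : 0 <= a by apply: sumr_ge0 => i _; exact: sqr_ge0.
have H x y : 0 <= x ^+ 2 * a + 2 * x * y * b + y ^+ 2 * c.
  have -> : x ^+ 2 * a + 2 * x * y * b + y ^+ 2 * c = \sum_i (x * f i + y * g i) ^+ 2.
    rewrite !mulr_sumr -!big_split /=; apply: eq_bigr => i _; ring.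
  by apply: sumr_ge0 => i _; exact: sqr_ge0.
have [a_eq0|an0] := eqVneq a 0.
  have f0 i : f i = 0.
    apply/eqP; rewrite -sqrf_eq0; apply/eqP.
    by move/eqP: a_eq0; rewrite psumr_eq0 => [/allP/(_ i)/(_ (mem_index_enum _))/eqP|j _]; rewrite ?sqr_ge0.
  rewrite /b big1 ?expr0n /= ?a_eq0 ?mul0r // => i _; by rewrite f0 mul0r.
have := H (- b) a; have ap : 0 < a by rewrite lt_def an0.
have -> : (- b) ^+ 2 * a + 2 * - b * a * b + a ^+ 2 * c = a * (a * c - b ^+ 2) by ring.
by rewrite pmulr_rge0 // subr_ge0.
Qed.

Definition dot n (u v : 'cV[R]_n) : R := \sum_i u i 0 * v i 0.

Lemma dotC n (u v : 'cV[R]_n) : dot u v = dot v u.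
Proof. by apply: eq_bigr => i _; rewrite mulrC. Qed.

Lemma dotDl n (u v w : 'cV[R]_n) : dot (u + v) w = dot u w + dot v w.
Proof. by rewrite -big_split; apply: eq_bigr => i _; rewrite mxE mulrDl. Qed.

Lemma dotZl n a (u w : 'cV[R]_n) : dot (a *: u) w = a * dot u w.
Proof. by rewrite mulr_sumr; apply: eq_bigr => i _; rewrite mxE mulrA. Qed.

Lemma dotNl n (u w : 'cV[R]_n) : dot (- u) w = - dot u w.
Proof. by rewrite -scaleN1r dotZl mulN1r. Qed.

Lemma dotBl n (u v w : 'cV[R]_n) : dot (u - v) w = dot u w - dot v w.
Proof. by rewrite dotDl dotNl. Qed.

Lemma dotDr n (u v w : 'cV[R]_n) : dot u (v + w) = dot u v + dot u w.
Proof. by rewrite dotC dotDl !(dotC u). Qed.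

Lemma dotZr n a (u w : 'cV[R]_n) : dot u (a *: w) = a * dot u w.
Proof. by rewrite dotC dotZl dotC. Qed.

Lemma dotNr n (u w : 'cV[R]_n) : dot u (- w) = - dot u w.
Proof. by rewrite dotC dotNl dotC. Qed.

Lemma dotBr n (u v w : 'cV[R]_n) : dot u (v - w) = dot u v - dot u w.
Proof. by rewrite dotDr dotNr. Qed.

Lemma dot_sqrBZ n a (u v : 'cV[R]_n) : dot (u - a *: v) (u - a *: v) =
  dot u u - 2 * a * dot u v + a ^+ 2 * dot v v.
Proof. by rewrite dotBl !(dotBr, dotZl, dotZr) (dotC v u); ring. Qed.

Lemma dot_ge0 n (u : 'cV[R]_n) : 0 <= dot u u.
Proof. by apply: sumr_ge0 => i _; rewrite -expr2 sqr_ge0. Qed.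

Lemma dot_eq0 n (u : 'cV[R]_n) : dot u u = 0 -> u = 0.
Proof.
move/eqP; rewrite psumr_eq0 => [/allP u0|i _]; last by rewrite -expr2 sqr_ge0.
apply/matrixP => i j; rewrite mxE (ord1 j); apply/eqP; rewrite -sqrf_eq0 expr2.
exact: (u0 i (mem_index_enum _)).
Qed.

Lemma dot_CS n (u v : 'cV[R]_n) : dot u v ^+ 2 <= dot u u * dot v v.
Proof.
apply: le_trans (CauchySchwarz_sum (u^~ 0) (v^~ 0)) _.
by rewrite /dot; under [X in _ <= X * _]eq_bigr do rewrite -expr2;
  under [X in _ <= _ * X]eq_bigr do rewrite -expr2.
Qed.

Lemma dot_trmul n (u v : 'cV[R]_n) : (u^T *m v) 0 0 = dot u v.
Proof. by rewrite mxE; apply: eq_bigr => i _; rewrite mxE. Qed.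

Lemma dot_mulmx m n (B : 'M[R]_(m, n)) u v : dot u (B *m v) = dot (B^T *m u) v.
Proof. by rewrite -!dot_trmul trmx_mul trmxK mulmxA. Qed.

Lemma dot_entry n (u : 'cV[R]_n) i : u i 0 ^+ 2 <= dot u u.
Proof.
rewrite /dot (bigD1 i) //= -expr2 lerDl.
by apply: sumr_ge0 => j _; rewrite -expr2 sqr_ge0.
Qed.

Lemma symmxP n (M : 'M[R]_n) : reflect (forall i j, M i j = M j i) (M \is symmetricmx).
Proof.
rewrite qualifE /=; apply: (iffP eqP) => [E i j|E].
  by rewrite {1}E scale1r !mxE.
by apply/matrixP => i j; rewrite scale1r !mxE.
Qed.

Lemma symmx_tr n (M : 'M[R]_n) : M \is symmetricmx -> M^T = M.
Proof. by move/symmxP => sM; apply/matrixP => i j; rewrite mxE sM. Qed.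

Section MatrixDot.
Context {n : nat}.
Implicit Types A B M : 'M[R]_n.

Lemma mxdotC A B : mxdot A B = mxdot B A.
Proof. by apply: eq_bigr => i _; apply: eq_bigr => j _; rewrite mulrC. Qed.

Lemma mxdotDl A B M : mxdot (A + B) M = mxdot A M + mxdot B M.
Proof.
rewrite -big_split; apply: eq_bigr => i _; rewrite -big_split.
by apply: eq_bigr => j _; rewrite mxE mulrDl.
Qed.

Lemma mxdotZl a A M : mxdot (a *: A) M = a * mxdot A M.
Proof.
rewrite mulr_sumr; apply: eq_bigr => i _; rewrite mulr_sumr.
by apply: eq_bigr => j _; rewrite mxE mulrA.
Qed.

Lemma mxdotNl A M : mxdot (- A) M = - mxdot A M.
Proof. by rewrite -scaleN1r mxdotZl mulN1r. Qed.

Lemma mxdotBl A B M : mxdot (A - B) M = mxdot A M - mxdot B M.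
Proof. by rewrite mxdotDl mxdotNl. Qed.

Lemma mxdotDr A B M : mxdot A (B + M) = mxdot A B + mxdot A M.
Proof. by rewrite mxdotC mxdotDl !(mxdotC A). Qed.

Lemma mxdotZr a A M : mxdot A (a *: M) = a * mxdot A M.
Proof. by rewrite mxdotC mxdotZl mxdotC. Qed.

Lemma mxdotNr A M : mxdot A (- M) = - mxdot A M.
Proof. by rewrite mxdotC mxdotNl mxdotC. Qed.

Lemma mxdotBr A B M : mxdot A (B - M) = mxdot A B - mxdot A M.
Proof. by rewrite mxdotDr mxdotNr. Qed.

Lemma mxdot_suml (I : finType) (F : I -> 'M[R]_n) M :
  mxdot (\sum_i F i) M = \sum_i mxdot (F i) M.
Proof.
elim/big_rec2: _ => [|i y x _ <-]; last by rewrite mxdotDl.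
by apply: big1 => i _; apply: big1 => j _; rewrite mxE mul0r.
Qed.

Lemma mxdot_sqrD A B :
  mxdot (A + B) (A + B) = mxdot A A + 2 * mxdot A B + mxdot B B.
Proof. by rewrite mxdotDl !mxdotDr (mxdotC B A); ring. Qed.

Lemma mxdot_sqrBZ a A B : mxdot (A - a *: B) (A - a *: B) =
  mxdot A A - 2 * a * mxdot A B + a ^+ 2 * mxdot B B.
Proof.
by rewrite mxdot_sqrD mxdotNr mxdotNl mxdotNr opprK !mxdotZr mxdotZl; ring.
Qed.

Lemma mxdot_tr A B : mxdot A B = \tr (A^T *m B).
Proof.
rewrite /mxdot exchange_big; apply: eq_bigr => i _; rewrite mxE.
by apply: eq_bigr => j _; rewrite mxE.
Qed.

Lemma mxdot_ge0 A : 0 <= mxdot A A.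
Proof. by apply: sumr_ge0 => i _; apply: sumr_ge0 => j _; rewrite -expr2 sqr_ge0. Qed.

Lemma mxdot_entry A i j : A i j ^+ 2 <= mxdot A A.
Proof.
rewrite /mxdot (bigD1 i) //= (bigD1 j) //= -expr2 -addrA lerDl.
apply: addr_ge0; first by apply: sumr_ge0 => k _; rewrite -expr2 sqr_ge0.
by apply: sumr_ge0 => k _; apply: sumr_ge0 => l _; rewrite -expr2 sqr_ge0.
Qed.

Lemma ler_mxdot A B a b : (forall i j, `|A i j| <= a) -> (forall i j, `|B i j| <= b) ->
  `|mxdot A B| <= n%:R ^+ 2 * (a * b).
Proof.
move=> Aa Bb; have -> : n%:R ^+ 2 * (a * b) = \sum_(i < n) \sum_(j < n) (a * b).
  by rewrite !sumr_const !card_ord -mulrnA -[in RHS]mulr_natl natrM expr2.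
apply: le_trans (ler_norm_sum _ _ _) _; apply: ler_sum => i _.
apply: le_trans (ler_norm_sum _ _ _) _; apply: ler_sum => j _.
by rewrite normrM ler_pM.
Qed.

Lemma quad_formE A (u : 'cV[R]_n) : (u^T *m A *m u) 0 0 = dot u (A *m u).
Proof. by rewrite -mulmxA dot_trmul. Qed.

End MatrixDot.

Lemma psdmxZ n a (X : 'M[R]_n) : 0 <= a -> psdmx X -> psdmx (a *: X).
Proof.
move=> a0 [/symmxP sX pX]; split; first by apply/symmxP => i j; rewrite !mxE sX.
by move=> v; rewrite quad_formE -scalemxAl dotZr -quad_formE mulr_ge0.
Qed.

End RealMatrices.

Section Spectral.
Context {R : realType} (eig : @spectral_oracle R) (eigP : spectral_oracle_spec eig).

(** The specification of the oracle serves as the spectral theorem: it asserts a decomposition of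
    every symmetric matrix. *)
Lemma spectral_decomposition n (M : 'M[R]_n) : M \is symmetricmx ->
  exists (U : 'M[R]_n) (d : 'rV[R]_n),
    [/\ U *m U^T = 1%:M, U^T *m U = 1%:M & M = U *m diag_mx d *m U^T].
Proof.
move=> sM; have := eigP sM; case: (eig M) => U d [UU ->].
by exists U, d; split=> //; exact: mulmx1C.
Qed.

Lemma conj_diag_entry n (U Q : 'M[R]_n) i :
  (U^T *m Q *m U) i i = ((col i U)^T *m Q *m col i U) 0 0.
Proof.
rewrite !mxE; apply: eq_bigr => k _; rewrite !mxE; congr (_ * _).
by apply: eq_bigr => j _; rewrite !mxE.
Qed.

Lemma trace_diag_mul n (d : 'rV[R]_n) (Q : 'M[R]_n) :
  \tr (diag_mx d *m Q) = \sum_i d 0 i * Q i i.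
Proof. by apply: eq_bigr => i _; rewrite mul_diag_mx mxE. Qed.

Lemma mxdot_spectral n (U : 'M[R]_n) (d : 'rV[R]_n) (Q : 'M[R]_n) :
  mxdot (U *m diag_mx d *m U^T) Q = \sum_i d 0 i * ((col i U)^T *m Q *m col i U) 0 0.
Proof.
rewrite mxdot_tr !trmx_mul trmxK tr_diag_mx -mulmxA -mulmxA mxtrace_mulC -mulmxA trace_diag_mul.
by apply: eq_bigr => i _; rewrite conj_diag_entry.
Qed.

Lemma psd_spectral n (U : 'M[R]_n) (d : 'rV[R]_n) :
  (forall i, 0 <= d 0 i) -> psdmx (U *m diag_mx d *m U^T).
Proof.
move=> d0; split.
  apply/symmxP => i j; set D := diag_mx d.
  have E : (U *m D *m U^T)^T = U *m D *m U^T by rewrite !trmx_mul trmxK tr_diag_mx mulmxA.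
  by rewrite -{1}E mxE.
move=> v; have -> : v^T *m (U *m diag_mx d *m U^T) *m v =
  (U^T *m v)^T *m (diag_mx d *m (U^T *m v)) by rewrite trmx_mul trmxK !mulmxA.
rewrite mxE; apply: sumr_ge0 => i _; rewrite mul_diag_mx !mxE mulrCA -expr2.
by rewrite mulr_ge0 ?sqr_ge0.
Qed.

Lemma spectral_eigenvalue n (U M : 'M[R]_n) (d : 'rV[R]_n) i : U^T *m U = 1%:M ->
  M = U *m diag_mx d *m U^T -> d 0 i = ((col i U)^T *m M *m col i U) 0 0.
Proof.
move=> UU ->; rewrite -conj_diag_entry !mulmxA UU mul1mx -mulmxA UU mulmx1.
by rewrite mxE eqxx.
Qed.

(** In an eigenbasis of [P], the product is the sum of the eigenvalues of [P] times the values of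
    the form [Q] at the eigenvectors. *)
Lemma mxdot_psd_ge0 n (P Q : 'M[R]_n) : psdmx P -> psdmx Q -> 0 <= mxdot P Q.
Proof.
move=> [sP pP] [sQ pQ]; have [U [d [UU UU' defP]]] := spectral_decomposition sP.
rewrite defP mxdot_spectral; apply: sumr_ge0 => i _; rewrite mulr_ge0 //.
by rewrite (spectral_eigenvalue i UU' defP).
Qed.

(** The matrix absolute value. Positive parts are expressed through it because [|M|] is the square
    root of [M M], which the machine obtains with one product and one square root. *)
Definition mxabs n (M : 'M[R]_n) : 'M[R]_n :=
  let: (U, d) := eig M in U *m diag_mx (map_mx Num.norm d) *m U^T.

Definition pospart n (M : 'M[R]_n) : 'M[R]_n := 2^-1 *: (M + mxabs M).
Definition negpart n (M : 'M[R]_n) : 'M[R]_n := 2^-1 *: (mxabs M - M).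

Lemma pos_neg_part n (M : 'M[R]_n) : M = pospart M - negpart M.
Proof. by apply/matrixP => i j; rewrite !mxE; lra. Qed.

Section Parts.
Context {n : nat} (M : 'M[R]_n) (sM : M \is symmetricmx).

Lemma mxabs_psd : psdmx (mxabs M).
Proof.
rewrite /mxabs; case: (eig M) => U d; apply: psd_spectral => i.
by rewrite mxE.
Qed.

Lemma spectral_mul (U : 'M[R]_n) (d e : 'rV[R]_n) : U^T *m U = 1%:M ->
  (U *m diag_mx d *m U^T) *m (U *m diag_mx e *m U^T) =
  U *m diag_mx (\row_i (d 0 i * e 0 i)) *m U^T.
Proof.
move=> UU; rewrite !mulmxA -(mulmxA (U *m diag_mx d)) UU mulmx1.
by rewrite -(mulmxA U) mulmx_diag.
Qed.

Lemma mxabs_sqr : mxabs M *m mxabs M = M *m M.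
Proof.
have := eigP sM; rewrite /mxabs; case: (eig M) => U d [/mulmx1C UU defM].
rewrite [in RHS]defM !spectral_mul //; congr (_ *m diag_mx _ *m _).
by apply/rowP => i; rewrite !mxE -expr2 real_normK ?num_real // expr2.
Qed.

Lemma pospart_psd : psdmx (pospart M).
Proof.
have := eigP sM; rewrite /pospart /mxabs; case: (eig M) => U d [/mulmx1C UU defM].
rewrite [X in X + _]defM -mulmxDl -mulmxDr -linearD /=.
apply: psdmxZ; rewrite ?invr_ge0 ?ler0n //; apply: psd_spectral => i.
by rewrite !mxE -lerBlDl sub0r ler_normr lexx orbT.
Qed.

Lemma negpart_psd : psdmx (negpart M).
Proof.
have := eigP sM; rewrite /negpart /mxabs; case: (eig M) => U d [/mulmx1C UU defM].
rewrite [X in _ - X]defM -mulmxBl -mulmxBr -linearB /=.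
apply: psdmxZ; rewrite ?invr_ge0 ?ler0n //; apply: psd_spectral => i.
by rewrite !mxE subr_ge0 ler_norm.
Qed.

(** Up to the factor 1/4 this is [<|M|,|M|> - <M,M>], and [|M|] and [M] have the same square. *)
Lemma pos_neg_orthogonal : mxdot (pospart M) (negpart M) = 0.
Proof.
rewrite mxdotZl mxdotZr mxdotDl !mxdotBr (mxdotC (mxabs M) M).
have -> : mxdot (mxabs M) (mxabs M) = mxdot M M.
  by rewrite !mxdot_tr (symmx_tr sM) (symmx_tr mxabs_psd.1) mxabs_sqr.
by rewrite (_ : _ + _ = 0) ?mulr0 //; ring.
Qed.

End Parts.

Lemma mxdot_pospart n (M : 'M[R]_n) : M \is symmetricmx ->
  mxdot (pospart M) M = mxdot (pospart M) (pospart M).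
Proof.
by move=> sM; rewrite {2}[M](pos_neg_part M) mxdotBr pos_neg_orthogonal // subr0.
Qed.

Lemma mxdot_pospart_le n (M Z : 'M[R]_n) : M \is symmetricmx -> psdmx Z ->
  mxdot M Z <= mxdot (pospart M) Z.
Proof.
move=> sM pZ; rewrite {1}[M]pos_neg_part mxdotBl gerBl.
by apply: mxdot_psd_ge0 => //; exact: negpart_psd.
Qed.

(* The norm of the positive part is the distance to the cone of negative semidefinite matrices. *)
Lemma pospart_min n (M Q : 'M[R]_n) : M \is symmetricmx -> psdmx Q ->
  mxdot (pospart M) (pospart M) <= mxdot (M + Q) (M + Q).
Proof.
move=> sM pQ; have -> : M + Q = pospart M + (Q - negpart M).
  by rewrite {1}[M]pos_neg_part addrAC addrA.
set P := pospart M; set Q' := negpart M.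
rewrite mxdotDl !(mxdotDr _ P) (mxdotC _ P) (mxdotBr P) pos_neg_orthogonal // subr0.
have := mxdot_psd_ge0 (pospart_psd sM) pQ; have := mxdot_ge0 (Q - Q').
by rewrite -/P; lra.
Qed.

End Spectral.

(** * The regularized dual *)

(* Dual of [max <C,X> - mu/2 |X|^2 - |b - A(X)|^2/(2 tau)] over [X >= 0]. *)
Section RegularizedDual.
Context {R : realType} (eig : @spectral_oracle R) (eigP : spectral_oracle_spec eig).
Context {m n : nat} (C : 'M[R]_n) (A : 'I_m -> 'M[R]_n) (b : 'cV[R]_m) (mu tau : R).
Hypotheses (sC : C \is symmetricmx) (sA : forall i, A i \is symmetricmx).
Hypotheses (mu0 : 0 < mu) (tau0 : 0 < tau).
Hypotheses (C1 : forall i j, `|C i j| <= 1) (A1 : forall k i j, `|A k i j| <= 1).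
Implicit Types y z : 'cV[R]_m.

Definition slack y : 'M[R]_n := C - \sum_i y i 0 *: A i.
Definition primal y : 'M[R]_n := mu^-1 *: pospart eig (slack y).
Definition dualf y : R := dot b y + tau / 2 * dot y y +
  (2 * mu)^-1 * mxdot (pospart eig (slack y)) (pospart eig (slack y)).
Definition dualg y : 'cV[R]_m := \col_i (b i 0 - mxdot (A i) (primal y) + tau * y i 0).
(** A Lipschitz constant of the dual gradient: as the entries of the [A_i] are at most 1,
    [|sum_i y_i A_i|^2 <= m n^2 |y|^2], and the positive part is divided by [mu]. *)
Definition smoothness : R := tau + m%:R * n%:R ^+ 2 / mu.

Lemma slack_sym y : slack y \is symmetricmx.
Proof.
apply/symmxP => i j; rewrite !mxE !summxE (symmxP _ sC); congr (_ - _).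
by apply: eq_bigr => k _; rewrite !mxE (symmxP _ (sA k)).
Qed.

Lemma primal_psd y : psdmx (primal y).
Proof. by apply: psdmxZ; [rewrite invr_ge0 ltW|apply: pospart_psd => //; exact: slack_sym]. Qed.

Lemma slackB y z : slack z - slack y = - \sum_i (z - y) i 0 *: A i.
Proof.
rewrite /slack opprD opprK addrACA subrr add0r -sumrN -big_split -sumrN /=.
by apply: eq_bigr => i _; rewrite !mxE scalerBl opprB addrC.
Qed.

Lemma mxdot_slackB y z X :
  mxdot X (slack z - slack y) = - \sum_i (z - y) i 0 * mxdot (A i) X.
Proof.
rewrite slackB mxdotNr mxdotC mxdot_suml; congr (- _).
by apply: eq_bigr => i _; rewrite mxdotZl.
Qed.

Lemma slackB_norm y z :
  mxdot (slack z - slack y) (slack z - slack y) <= m%:R * n%:R ^+ 2 * dot (z - y) (z - y).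
Proof.
rewrite slackB mxdotNl mxdotNr opprK.
have -> : m%:R * n%:R ^+ 2 * dot (z - y) (z - y) =
    \sum_(i < n) \sum_(j < n) (dot (z - y) (z - y) * m%:R).
  by rewrite !sumr_const !card_ord -mulrnA -[RHS]mulr_natl natrM expr2; ring.
apply: ler_sum => i _; apply: ler_sum => j _; rewrite !summxE -expr2.
under eq_bigr do rewrite mxE.
apply: le_trans (CauchySchwarz_sum (fun k => (z - y) k 0) (fun k => A k i j)) _.
apply: ler_pM => //; [exact: dot_ge0|by apply: sumr_ge0 => ? _; exact: sqr_ge0|].
have -> : m%:R = \sum_(k < m) (1 : R) by rewrite sumr_const card_ord.
by apply: ler_sum => k _; rewrite -real_normK ?num_real // exprn_ile1.
Qed.

Lemma dot_dualg y z : dot (dualg y) (z - y) =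
  dot b (z - y) + tau * dot y (z - y) + mxdot (primal y) (slack z - slack y).
Proof.
rewrite mxdot_slackB -sumrN /dot mulr_sumr -!big_split /=; apply: eq_bigr => i _.
by rewrite !mxE; ring.
Qed.

(** For the positive parts [P], [P'] of the slacks at [y], [z], it suffices that
    [<P, slack z> <= <P, P'>] and [|P' - P|^2 >= 0]. No derivative is taken: [dualg] is known as a
    gradient only through this inequality and the next one. *)
Lemma dual_convex y z : dualf y + dot (dualg y) (z - y) <= dualf z.
Proof.
rewrite dot_dualg /dualf /primal (mxdotZl mu^-1) mxdotBr (mxdot_pospart eigP (slack_sym y)).
set P := pospart _ (slack y); set P' := pospart _ (slack z).
have H1 : mxdot P (slack z) <= mxdot P P'.
  rewrite mxdotC [X in _ <= X]mxdotC; apply: mxdot_pospart_le => //; first exact: slack_sym.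
  exact/pospart_psd/slack_sym.
have H2 : 0 <= mxdot (P' - 1 *: P) (P' - 1 *: P) by exact: mxdot_ge0.
have H3 : 0 <= tau / 2 * dot (z - y) (z - y).
  by rewrite mulr_ge0 ?dot_ge0 // divr_ge0 // ltW.
have H4 : mu^-1 * mxdot P (slack z) <= mu^-1 * mxdot P P'.
  by rewrite ler_pM2l ?invr_gt0.
have H5 : 0 <= (2 * mu)^-1 * mxdot (P' - 1 *: P) (P' - 1 *: P).
  by rewrite mulr_ge0 // invr_ge0 mulr_ge0 // ltW.
move: H3 H4 H5; rewrite !invfM mxdot_sqrBZ !(dotBl, dotBr) (mxdotC P' P) (dotC z y).
move: (mu^-1) => u; lra.
Qed.

(** The norm of the positive part of [slack z] is at most that of [slack z + Q] for any positive
    semidefinite [Q]. With [Q] the negative part of [slack y], the sum is the difference of the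
    slacks plus [P]. *)
Lemma dual_smooth y z :
  dualf z <= dualf y + dot (dualg y) (z - y) + smoothness / 2 * dot (z - y) (z - y).
Proof.
have H1 := pospart_min eigP (slack_sym z) (negpart_psd eigP (slack_sym y)).
have H2 := slackB_norm y z.
rewrite dot_dualg /dualf /primal (mxdotZl mu^-1).
move: H1; have -> : slack z + negpart eig (slack y) = (slack z - slack y) + pospart eig (slack y).
  by rewrite {2}[slack y](pos_neg_part eig) opprB addrA addrNK.
set P := pospart _ (slack y); set P' := pospart _ (slack z) in H2 *.
set W := slack z - slack y in H2 *.
rewrite mxdot_sqrD (mxdotC W P) => H1.
have := ler_pM2l (x := (2 * mu)^-1); rewrite invr_gt0 mulr_gt0 // => /(_ isT) K.
rewrite -K in H1; rewrite -K in H2; move: H1 H2; rewrite /smoothness.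
have E : dot z z = dot y y + 2 * dot y (z - y) + dot (z - y) (z - y).
  by rewrite !(dotBl, dotBr) (dotC z y); ring.
have E' : dot b z = dot b y + dot b (z - y) by rewrite dotBr; ring.
rewrite E E' !invfM; lra.
Qed.

Lemma smoothness_gt0 : 0 < smoothness.
Proof. by rewrite ltr_wpDr // divr_ge0 ?mulr_ge0 ?exprn_ge0 // ltW. Qed.

(** Weak duality: what separates the two sides is bounded below by the square of [P - mu Z]. *)
Lemma dual_lower y Z : psdmx Z ->
  mxdot C Z - \sum_i y i 0 * (mxdot (A i) Z - b i 0) - mu / 2 * mxdot Z Z
    + tau / 2 * dot y y <= dualf y.
Proof.
move=> pZ; have H1 := mxdot_pospart_le eigP (slack_sym y) pZ.
have E : mxdot (slack y) Z = mxdot C Z - \sum_i y i 0 * mxdot (A i) Z.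
  rewrite /slack mxdotBl mxdot_suml; congr (_ - _).
  by apply: eq_bigr => i _; rewrite mxdotZl.
have -> : \sum_i y i 0 * (mxdot (A i) Z - b i 0) = \sum_i y i 0 * mxdot (A i) Z - dot b y.
  by rewrite -sumrB; apply: eq_bigr => i _; ring.
rewrite E in H1; rewrite /dualf; set P := pospart _ _ in H1 *.
have H2 := mxdot_ge0 (P - mu *: Z).
have : 0 <= (2 * mu)^-1 * mxdot (P - mu *: Z) (P - mu *: Z).
  by rewrite mulr_ge0 // invr_ge0 mulr_ge0 // ltW.
rewrite mxdot_sqrBZ.
have -> : forall p q w, (2 * mu)^-1 * (p - 2 * mu * q + mu ^+ 2 * w) =
   (2 * mu)^-1 * p - q + mu / 2 * w by move=> *; field; rewrite gt_eqF.
by lra.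
Qed.

(** As [<slack, X> = mu <X, X>] and [<slack, Z> <= mu <X, Z>], completing the square in [X - Z/2]
    leaves the bias [mu/4 |Z|^2]. *)
Lemma dual_primal_gap y Z : psdmx Z ->
  mxdot C Z - mxdot C (primal y) <=
  \sum_i y i 0 * (dualg y i 0 + (mxdot (A i) Z - b i 0)) - tau * dot y y
    + mu / 4 * mxdot Z Z.
Proof.
move=> pZ; set X := primal y.
have H1 := mxdot_pospart_le eigP (slack_sym y) pZ.
have H2 : mxdot (slack y) X = mu * mxdot X X.
  rewrite /X /primal (mxdotZr mu^-1) mxdotC (mxdot_pospart eigP (slack_sym y)) (mxdotZl mu^-1) (mxdotZr mu^-1).
  by field; rewrite gt_eqF.
have H3 : mxdot (pospart eig (slack y)) Z = mu * mxdot X Z.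
  by rewrite /X /primal (mxdotZl mu^-1); field; rewrite gt_eqF.
have E W : mxdot (slack y) W = mxdot C W - \sum_i y i 0 * mxdot (A i) W.
  rewrite /slack mxdotBl mxdot_suml; congr (_ - _).
  by apply: eq_bigr => i _; rewrite mxdotZl.
have -> : \sum_i y i 0 * (dualg y i 0 + (mxdot (A i) Z - b i 0)) =
  \sum_i y i 0 * mxdot (A i) Z - \sum_i y i 0 * mxdot (A i) X + tau * dot y y.
  by rewrite mulr_sumr -sumrB -big_split; apply: eq_bigr => i _; rewrite !mxE -/X /=; ring.
rewrite H3 in H1; rewrite !E in H1 H2.
have : 0 <= mu * mxdot (X - 2^-1 *: Z) (X - 2^-1 *: Z) by rewrite mulr_ge0 ?mxdot_ge0 // ltW.
by rewrite mxdot_sqrBZ; move: H1 H2; lra.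
Qed.

Lemma mxdot_pospart_self y : mxdot (pospart eig (slack y)) (pospart eig (slack y)) <=
  mxdot (slack y) (slack y).
Proof.
have p0 : psdmx (0 : 'M[R]_n).
  split; first by apply/symmxP => i j; rewrite !mxE.
  by move=> v; rewrite mulmx0 mul0mx mxE.
by have := pospart_min eigP (slack_sym y) p0; rewrite addr0.
Qed.

Lemma dualf0 : dualf 0 <= n%:R ^+ 2 / (2 * mu).
Proof.
have dot0 (u : 'cV[R]_m) : dot u 0 = 0 by apply: big1 => i _; rewrite mxE mulr0.
rewrite /dualf !dot0 mulr0 !add0r mulrC ler_pM2r ?invr_gt0 ?mulr_gt0 //.
apply: le_trans (mxdot_pospart_self 0) _.
have -> : slack 0 = C by rewrite /slack big1 ?subr0 // => i _; rewrite mxE scale0r.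
have := ler_mxdot C1 C1; rewrite ger0_norm ?mxdot_ge0 //; by rewrite !mulr1.
Qed.

(** For fixed [Z] the weak duality bound is a quadratic in [y] with leading coefficient [tau/2];
    completing the square bounds [dualf] from below, so its infimum is approached within [D]. *)
Lemma near_minimizer (D : R) (Z : 'M[R]_n) : 0 < D -> psdmx Z -> exists yh, forall y, dualf yh <= dualf y + D.
Proof.
move=> D0 pZ.
have lb y : mxdot C Z - mu / 2 * mxdot Z Z
    - (2 * tau)^-1 * \sum_i (mxdot (A i) Z - b i 0) ^+ 2 <= dualf y.
  apply: le_trans (dual_lower y pZ); rewrite -!addrA lerD2l.
  suff : 0 <= \sum_i ((2 * tau)^-1 * (mxdot (A i) Z - b i 0 - tau * y i 0) ^+ 2).
    rewrite (eq_bigr (fun i => ((2 * tau)^-1 * (mxdot (A i) Z - b i 0) ^+ 2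
        - y i 0 * (mxdot (A i) Z - b i 0)) + tau / 2 * (y i 0 * y i 0))) => [|i _];
      last by field; rewrite gt_eqF.
    rewrite big_split sumrB -!mulr_sumr /= -/(dot y y); lra.
  by apply: sumr_ge0 => i _; rewrite mulr_ge0 ?sqr_ge0 // invr_ge0 mulr_ge0 // ltW.
have hi : has_inf (range dualf).
  split; first by exists (dualf 0), 0.
  by eexists => _ [y _ <-]; exact: lb.
have [_ [yh _ <-] H] := inf_adherent D0 hi.
exists yh => y; apply: le_trans (ltW H) _; rewrite lerD2r.
by apply: ge_inf; [exact: hi.2|exists y].
Qed.

Section NearMinimizer.
Variables (D : R) (yh : 'cV[R]_m).
Hypothesis (yhP : forall y, dualf yh <= dualf y + D).

(** The gradient step of length [1/L] lowers the value by [|g|^2 / (2L)], and no value lies more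
    than [D] below that of [yh]. *)
Lemma near_min_descent y :
  dualf yh + (2 * smoothness)^-1 * dot (dualg y) (dualg y) <= dualf y + D.
Proof.
have L0 := smoothness_gt0; set g := dualg y.
have := yhP (y - smoothness^-1 *: g); have := dual_smooth y (y - smoothness^-1 *: g).
rewrite (_ : y - _ - y = - (smoothness^-1 *: g)); last by rewrite addrAC subrr add0r.
rewrite !(dotNr, dotNl, dotZl, dotZr) -/g opprK.
have -> : smoothness / 2 * (smoothness^-1 * (smoothness^-1 * dot g g)) =
  (2 * smoothness)^-1 * dot g g by field; rewrite gt_eqF.
have -> : - (smoothness^-1 * dot g g) = - 2 * ((2 * smoothness)^-1 * dot g g).
  by field; rewrite gt_eqF.
by lra.
Qed.

(** The descent bound at [yh] itself gives [|g|^2 / (2L) <= D], which controls the linear term of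
    the smoothness inequality by Young's inequality. *)
Lemma near_min_ball y : smoothness * dot (y - yh) (y - yh) <= D -> dualf y <= dualf yh + 2 * D.
Proof.
move=> yD; have L0 := smoothness_gt0; have := near_min_descent yh; have := dual_smooth yh y.
have : 0 <= (2 * smoothness)^-1 * dot (dualg yh - smoothness *: (y - yh)) (dualg yh - smoothness *: (y - yh)).
  by rewrite mulr_ge0 ?dot_ge0 // invr_ge0 mulr_ge0 // ltW.
rewrite dot_sqrBZ.
set u := dot (y - yh) (y - yh) in yD *; set v := dot (dualg yh) (y - yh); set w := dot (dualg yh) _.
have -> : (2 * smoothness)^-1 * (w - 2 * smoothness * v + smoothness ^+ 2 * u)
  = (2 * smoothness)^-1 * w - v + (smoothness * u) / 2 by field; rewrite gt_eqF.
by rewrite mulrAC; lra.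
Qed.

(** Convexity at [c], with [dualf y] bounded above on the ball and [dualf c] bounded below by
    descent. Once [|g|^2 / (2L)] exceeds [3 D], the ball lies strictly on one side of the cut
    through [c]. *)
Lemma near_min_cut y c : smoothness * dot (y - yh) (y - yh) <= D ->
  dot (dualg c) (y - c) <= 3 * D - (2 * smoothness)^-1 * dot (dualg c) (dualg c).
Proof.
by move=> /near_min_ball; have := dual_convex c y; have := near_min_descent c; lra.
Qed.

(** The value at [yh] is at most that at 0 plus [D]; in the weak duality bound at [Z], half of
    [tau/2 |yh|^2] is spent by Young's inequality on the residuals of [Z]. *)
Lemma near_min_norm (Z : 'M[R]_n) (e : R) : psdmx Z -> (forall i j, `|Z i j| <= 1) ->
  (forall i, `|mxdot (A i) Z - b i 0| <= e) ->
  tau / 4 * dot yh yh <= n%:R ^+ 2 / (2 * mu) + D + n%:R ^+ 2 + mu / 2 * n%:R ^+ 2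
    + tau^-1 * (m%:R * e ^+ 2).
Proof.
move=> pZ Z1 Ze; have := dual_lower yh pZ; have := yhP 0; have := dualf0.
have := ler_mxdot C1 Z1; have := ler_mxdot Z1 Z1; rewrite !mulr1.
rewrite (ger0_norm (mxdot_ge0 Z)) ler_norml => ZZ /andP[CZ _].
have ZZmu : mu / 2 * mxdot Z Z <= mu / 2 * n%:R ^+ 2.
  by rewrite ler_pM2l // divr_gt0.
have S : \sum_i yh i 0 * (mxdot (A i) Z - b i 0) <= tau / 4 * dot yh yh + tau^-1 * (m%:R * e ^+ 2).
  have -> : m%:R * e ^+ 2 = \sum_(i < m) e ^+ 2 by rewrite sumr_const card_ord mulr_natl.
  rewrite !mulr_sumr -big_split /=; apply: ler_sum => i _.
  set x := mxdot _ _ - _; have xe : x ^+ 2 <= e ^+ 2.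
    by rewrite -real_normK ?num_real // lerXn2r ?nnegrE // ?Ze // (le_trans _ (Ze i)).
  have : 0 <= (tau / 4) * (yh i 0 - 2 / tau * x) ^+ 2 by rewrite mulr_ge0 ?sqr_ge0 // divr_ge0 // ltW.
  have -> : (tau / 4) * (yh i 0 - 2 / tau * x) ^+ 2 =
    tau / 4 * (yh i 0 * yh i 0) - yh i 0 * x + tau^-1 * x ^+ 2 by field; rewrite gt_eqF.
  have : tau^-1 * x ^+ 2 <= tau^-1 * e ^+ 2 by rewrite ler_pM2l ?invr_gt0.
  lra.
lra.
Qed.

End NearMinimizer.
End RegularizedDual.

(** * The ellipsoid method *)

(** The matrix with rows [(1, -w^T)] and [(a w, 1)] is factored in two ways into block triangular
    matrices. *)
Lemma det_add_rank1 (F : comUnitRingType) n (a : F) (w : 'cV[F]_n) :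
  \det (1%:M + a *: (w *m w^T)) = 1 + a * (w^T *m w) 0 0.
Proof.
have e1 : block_mx 1%:M 0 (a *: w) (1%:M : 'M[F]_n) *m
    block_mx (1%:M : 'M[F]_1) (- w^T) 0 (1%:M + a *: (w *m w^T))
  = block_mx (1%:M : 'M[F]_1) (- w^T) (a *: w) 1%:M.
  rewrite mulmx_block !mul1mx !mulmx0 !addr0 !mul0mx !mulmx1 ?addr0 mulmxN -scalemxAl.
  by rewrite addrCA addNr addr0.
have e2 : block_mx (1%:M : 'M[F]_1) (- w^T) 0 (1%:M : 'M[F]_n) *m
    block_mx (1%:M + a *: (w^T *m w)) 0 (a *: w) 1%:M
  = block_mx (1%:M : 'M[F]_1) (- w^T) (a *: w) 1%:M.
  rewrite mulmx_block !mul1mx !mulmx0 !add0r !mul0mx ?add0r !mulmx1 mulNmx -scalemxAr.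
  by rewrite addrK.
have := congr1 determinant e1; rewrite -e2 !det_mulmx !det_lblock !det_ublock !det1 !mul1r mulr1.
by rewrite det_mx11 !mxE mulr1n => ->.
Qed.

Section Ellipsoid.
Context {R : realType}.

(** An ellipsoid is an affine image of the unit ball, with [B] not necessarily symmetric. A step
    then multiplies [B] on the right by one factor: nothing is inverted and determinants
    multiply. *)
Definition in_ellipsoid m (c : 'cV[R]_m) (B : 'M[R]_m) (y : 'cV[R]_m) :=
  exists2 z, dot z z <= 1 & y = c + B *m z.

Definition shrink m (al sg : R) (w : 'cV[R]_m) : 'M[R]_m := al%:M + (sg - al) *: (w *m w^T).

Lemma shrink_mul m al sg (w z : 'cV[R]_m) :
  shrink al sg w *m z = al *: z + ((sg - al) * dot w z) *: w.
Proof.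
rewrite mulmxDl mul_scalar_mx -scalemxAl -mulmxA -scalerA; congr (_ + _ *: _).
by apply/matrixP => i j; rewrite mxE big_ord1 (ord1 j) dot_trmul mxE mulrC.
Qed.

Lemma det_shrink m al sg (w : 'cV[R]_m.+1) : 0 < al -> dot w w = 1 ->
  \det (shrink al sg w) = al ^+ m * sg.
Proof.
move=> al0 w1; rewrite /shrink.
have -> : al%:M + (sg - al) *: (w *m w^T) = al *: (1%:M + ((sg - al) / al) *: (w *m w^T)).
  by rewrite scalerDr scale_scalar_mx mulr1 scalerA mulrCA divff ?mulr1 ?gt_eqF.
by rewrite detZ det_add_rank1 dot_trmul w1 mulr1 exprS; field; rewrite gt_eqF.
Qed.

(* The half of the unit ball where [w.z <= 0] lies in the ellipsoid centered at
   [- xi w] with semi-axis [sg] along [w] and [al] across it. *)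
Lemma half_ball_shrink m (xi al sg : R) (w z : 'cV[R]_m) : 0 <= xi -> xi <= 1 / 5 ->
  sg = 1 - xi -> al = 1 + xi ^+ 2 ->
  dot w w = 1 -> dot z z <= 1 -> dot w z <= 0 ->
  exists2 z', dot z' z' <= 1 & z + xi *: w = shrink al sg w *m z'.
Proof.
move=> xi0 xi5 sgE alE w1 z1 wz.
have sg0 : 0 < sg by lra.
have al0 : 0 < al by rewrite alE ltr_pwDl // exprn_ge0.
set t := dot w z + xi.
have wt : dot w (z + xi *: w) = t by rewrite dotDr dotZr w1 mulr1.
exists (al^-1 *: (z + xi *: w) + ((sg^-1 - al^-1) * t) *: w); last first.
  rewrite shrink_mul dotDr !dotZr wt w1 scalerDr !scalerA divff ?gt_eqF // scale1r.
  rewrite -addrA -scalerDl -[LHS]addr0; congr (_ + _); apply/esym/eqP.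
  rewrite scaler_eq0; apply/orP; left; apply/eqP; field.
  by rewrite !gt_eqF.
rewrite !(dotDl, dotDr, dotZl, dotZr) (dotC z w) w1; set v := dot w z in t wt wz *; set u := dot z z in z1 *.
have v2 : v ^+ 2 <= u by have := dot_CS w z; rewrite w1 mul1r.
have v1 : -1 <= v.
  have : v ^+ 2 <= 1 by exact: le_trans z1.
  by rewrite leNgt => v21; apply/negP => vl; move: v21; rewrite -leNgt; nra.
(* The squared norm of the preimage, split across and along [w]. [K] compares the semi-axes and
   holds as soon as [xi <= 1/4]; what then remains is [v (1 + v) <= 0], true because [v] is in
   [[-1, 0]]. *)
have F : (u - v ^+ 2) / al ^+ 2 + t ^+ 2 / sg ^+ 2 <= 1.
  have K : (1 - xi) ^+ 2 <= (1 + xi ^+ 2) ^+ 2 * (1 - 2 * xi).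
    have -> : (1 + xi ^+ 2) ^+ 2 * (1 - 2 * xi) = (1 - xi) ^+ 2 +
      xi ^+ 2 * ((1 - 4 * xi) + xi ^+ 2 * (1 - 2 * xi)) by ring.
    rewrite lerDl mulr_ge0 ?sqr_ge0 // addr_ge0; [by []|lra|].
    by rewrite mulr_ge0 ?sqr_ge0 //; lra.
  have K' : (u - v ^+ 2) / al ^+ 2 <= (1 - v ^+ 2) * (1 - 2 * xi) / sg ^+ 2.
    rewrite ler_pdivrMr ?exprn_gt0 // mulrAC ler_pdivlMr ?exprn_gt0 // sgE alE.
    apply: (@le_trans _ _ ((1 - v ^+ 2) * (1 - xi) ^+ 2)).
      by apply: ler_wpM2r; [exact: sqr_ge0|lra].
    rewrite -mulrA; apply: ler_wpM2l; first lra.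
    by rewrite mulrC.
  apply: le_trans (lerD K' (lexx _)) _; rewrite -mulrDl ler_pdivrMr ?exprn_gt0 // mul1r sgE /t.
  have : 0 <= xi * (- v) * (1 + v) by rewrite !mulr_ge0 //; lra.
  by move=> ?; nra.
by apply: le_trans F; rewrite /t; rewrite le_eqVlt; apply/orP; left; apply/eqP; field; rewrite !gt_eqF.
Qed.

(** In the coordinates [y = c + B z] the ellipsoid is the unit ball and the normal of the cut is
    [B^T g]. *)
Lemma ellipsoid_step m (xi al sg : R) (c g : 'cV[R]_m) (B : 'M[R]_m) :
  0 <= xi -> xi <= 1 / 5 -> sg = 1 - xi -> al = 1 + xi ^+ 2 ->
  0 < dot (B^T *m g) (B^T *m g) ->
  let w := (Num.sqrt (dot (B^T *m g) (B^T *m g)))^-1 *: (B^T *m g) in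
  dot w w = 1 /\
  forall y, in_ellipsoid c B y -> dot g (y - c) <= 0 ->
    in_ellipsoid (c - xi *: (B *m w)) (B *m shrink al sg w) y.
Proof.
move=> xi0 xi5 sgE alE u0 w; set u := B^T *m g in u0 w *.
have w1 : dot w w = 1.
  rewrite /w dotZl dotZr mulrA -invfM -expr2 sqr_sqrtr ?ltW // mulVf //.
  by rewrite gt_eqF.
split=> // y [z z1 ->]; rewrite addrAC subrr add0r dot_mulmx -/u => uz.
have wz : dot w z <= 0 by rewrite dotZl mulr_ge0_le0 // invr_ge0 sqrtr_ge0.
have [z' z'1 E] := half_ball_shrink xi0 xi5 sgE alE w1 z1 wz.
exists z' => //; rewrite -mulmxA -E mulmxDr -(scalemxAr xi B w) -addrA; congr (_ + _).
by rewrite [RHS]addrC addrK.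
Qed.

Context (eig : @spectral_oracle R) (eigP : spectral_oracle_spec eig).

(** For a unit eigenvector [u] of [B B^T], the points [x + r u] and [x - r u] come from [z1], [z2]
    in the unit ball, so [2 r = <B^T u, z1 - z2> <= 2 |B^T u|]. Every eigenvalue of [B B^T] is thus
    at least [r^2], and their product is [(det B)^2]. *)
Lemma ball_in_ellipsoid_det m (c x : 'cV[R]_m) (B : 'M[R]_m) (r : R) : 0 <= r ->
  (forall y, dot (y - x) (y - x) <= r ^+ 2 -> in_ellipsoid c B y) ->
  r ^+ (m * 2) <= \det B ^+ 2.
Proof.
move=> r0 sub; set P := B *m B^T.
have sP : P \is symmetricmx.
  have E : P^T = P by rewrite trmx_mul trmxK.
  by apply/symmxP => i j; rewrite -{1}E mxE.
have [U [d [UU UU' defP]]] := spectral_decomposition eigP sP.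
have dP i : r ^+ 2 <= d 0 i.
  have u1 : dot (col i U) (col i U) = 1.
    have -> : dot (col i U) (col i U) = (U^T *m U) i i.
      by rewrite !mxE; apply: eq_bigr => j _; rewrite !mxE.
    by rewrite UU' mxE eqxx.
  rewrite (spectral_eigenvalue i UU' defP) quad_formE -mulmxA dot_mulmx.
  set u := col i U in u1 *; set v := B^T *m u.
  have H a : `|a| <= 1 -> exists2 z, dot z z <= 1 & x + (a * r) *: u = c + B *m z.
    move=> a1; apply: sub; rewrite addrAC subrr add0r dotZl dotZr u1 mulr1 -expr2 exprMn.
    by rewrite -[leRHS]mul1r ler_wpM2r ?sqr_ge0 // -real_normK ?num_real // exprn_ile1.
  have [|z1 z11 E1] := H 1; first by rewrite normr1.
  have [|z2 z21 E2] := H (-1); first by rewrite normrN1.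
  have E : (2 * r) *: u = B *m (z1 - z2).
    rewrite mulmxBr; have -> : B *m z1 = (x + (1 * r) *: u) - c by rewrite E1 addrAC subrr add0r.
    have -> : B *m z2 = (x + (-1 * r) *: u) - c by rewrite E2 addrAC subrr add0r.
    by apply/matrixP => k l; rewrite !mxE; ring.
  have F : 2 * r = dot v (z1 - z2).
    by rewrite /v -dot_mulmx -E dotZr u1 mulr1.
  have G : dot (z1 - z2) (z1 - z2) <= 4.
    have := dot_ge0 (z1 + z2); rewrite !(dotBl, dotBr, dotDl, dotDr) (dotC z2 z1); lra.
  have K := dot_CS v (z1 - z2); rewrite -F in K.
  have : dot v v * dot (z1 - z2) (z1 - z2) <= dot v v * 4 by rewrite ler_wpM2l ?dot_ge0.
  by move: K; rewrite exprMn; lra.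
have -> : \det B ^+ 2 = \det P by rewrite det_mulmx det_tr expr2.
rewrite defP !det_mulmx mulrAC -det_mulmx UU det1 mul1r det_diag.
have -> : r ^+ (m * 2) = \prod_(i < m) r ^+ 2 by rewrite prodr_const card_ord mulnC exprM.
by apply: ler_prod => i _; rewrite dP sqr_ge0.
Qed.

(** By [1 + x <= exp x] the exponent is at most [xi^2 M - xi] with [M = m + 1] the dimension, and
    this equals [1/(25 M) - 1/(5 M)]. *)
Lemma shrink_rate m (xi : R) : xi = 1 / (5 * m.+1%:R) ->
  (1 + xi ^+ 2) ^+ m * (1 - xi) <= expR (- (4 / (25 * m.+1%:R))).
Proof.
move=> xiE; have m0 : 0 < m.+1%:R :> R by rewrite ltr0n.
have xi0 : 0 < xi by rewrite xiE divr_gt0 ?mulr_gt0.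
have xi5 : xi <= 1 / 5.
  by rewrite xiE ler_pM2l // lef_pV2 ?posrE ?mulr_gt0 // -[leLHS]mulr1 ler_pM2l ?ler1n.
apply: (@le_trans _ _ (expR (xi ^+ 2 * m.+1%:R) * expR (- xi))).
  apply: ler_pM; [by rewrite exprn_ge0 // addr_ge0 // sqr_ge0|lra| |exact: expR_ge1Dx].
  apply: (@le_trans _ _ ((1 + xi ^+ 2) ^+ m.+1)).
    by rewrite ler_weXn2l // lerDl sqr_ge0.
  by rewrite expRM_natr lerXn2r ?nnegrE ?expR_ge0 ?expR_ge1Dx // addr_ge0 ?sqr_ge0.
rewrite -expRD ler_expR le_eqVlt; apply/orP; left; apply/eqP.
by rewrite xiE; field; rewrite addrC natr1 gt_eqF.
Qed.

End Ellipsoid.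

(** * Accuracy *)

Section Accuracy.
Context {R : realType} (eig : @spectral_oracle R) (eigP : spectral_oracle_spec eig).
Context {m n : nat} (C : 'M[R]_n) (A : 'I_m -> 'M[R]_n) (b : 'cV[R]_m) (h : R).
Hypotheses (sC : C \is symmetricmx) (sA : forall i, A i \is symmetricmx).
Hypotheses (C1 : forall i j, `|C i j| <= 1) (A1 : forall k i j, `|A k i j| <= 1).
Hypotheses (h100 : 100 <= h) (mh : m%:R <= h) (nh : n%:R <= h).
Variable Z : 'M[R]_n.
Hypotheses (pZ : psdmx Z) (Z1 : forall i j, `|Z i j| <= 1).
(** The residual is not zero because the [A_i] of this section will be rounded matrices, for which
    the scaled optimum is only nearly feasible. *)
Hypothesis (Zb : forall i, `|mxdot (A i) Z - b i 0| <= h ^- 58).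

(** [mu] makes the bias [mu/4 |Z|^2] at most [h^-2]. The near minimizer satisfies
    [tau |yh|^2 <= 4 h^6], so [tau = h^-13] keeps it within radius [h^10], while the shift
    [tau |y_i|] of a residual is still at most [h^-3]. *)
Let mu := h ^- 4.
Let tau := h ^- 13.
Notation primal := (primal eig C A mu).
Notation dualf := (dualf eig C A b mu tau).
Notation dualg := (dualg eig C A b mu tau).
Notation L := (@smoothness R m n mu tau).

Let h0 : 0 < h. Proof. by rewrite (lt_le_trans _ h100). Qed.
Let h1 : 1 <= h. Proof. by rewrite (le_trans _ h100) // ler1n. Qed.
Let hX k : 0 < h ^+ k. Proof. exact: exprn_gt0. Qed.
Let mu0 : 0 < mu. Proof. by rewrite invr_gt0. Qed.
Let tau0 : 0 < tau. Proof. by rewrite invr_gt0. Qed.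

Let hM i j k : (i + k = j)%N -> h ^+ i * h ^- j = h ^- k.
Proof. by move=> <-; rewrite exprD invfM mulrA divff ?mul1r // gt_eqF. Qed.

Let hV i j : (i <= j)%N -> h ^- j <= h ^- i.
Proof. by move=> ij; rewrite lef_pV2 ?posrE // ler_weXn2l. Qed.

Let hVS i j : (i < j)%N -> 100 * h ^- j <= h ^- i.
Proof.
move=> ij; apply: le_trans (_ : h * h ^- i.+1 <= _).
  by rewrite ler_pM ?invr_ge0 ?(ltW (hX _)) // hV.
by rewrite -{1}(expr1 h) (hM (k := i)).
Qed.

Let hS i j : (i < j)%N -> 100 * h ^+ i <= h ^+ j.
Proof.
move=> ij; apply: le_trans (_ : h * h ^+ i <= _); first by rewrite ler_pM2r.
by rewrite -exprS ler_weXn2l.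
Qed.

Let n2 : n%:R ^+ 2 <= h ^+ 2. Proof. by rewrite lerXn2r ?nnegrE ?ler0n // ltW. Qed.

Lemma smoothness_le : 2 * L <= h ^+ 8.
Proof.
have t1 : tau <= 1 by rewrite invf_le1 // exprn_ege1.
have H : m%:R * n%:R ^+ 2 / mu <= h ^+ 7.
  rewrite /mu invrK (exprD h 3 4) ler_pM2r // (exprS h 2).
  by rewrite ler_pM // exprn_ge0.
have := @hS 7 8 isT; have : 1 <= h ^+ 7 by exact: exprn_ege1.
rewrite /smoothness; lra.
Qed.

Lemma slack_entry (y : 'cV[R]_m) i j : (forall k, `|y k 0| <= h ^+ 10) ->
  `|slack C A y i j| <= 2 * h ^+ 11.
Proof.
move=> yR; rewrite !mxE summxE; apply: le_trans (ler_normB _ _) _.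
have H : `|\sum_k (y k 0 *: A k) i j| <= h ^+ 11.
  apply: le_trans (ler_norm_sum _ _ _) _.
  apply: (@le_trans _ _ (\sum_(k < m) h ^+ 10)).
    apply: ler_sum => k _; rewrite mxE normrM -[X in _ <= X]mulr1; apply: ler_pM => //; exact: A1.
  by rewrite sumr_const card_ord -[_ *+ m]mulr_natl (exprS h 10) ler_pM2r.
have := C1 i j; have : 1 <= h ^+ 11 by exact: exprn_ege1.
lra.
Qed.

Lemma primal_entry (y : 'cV[R]_m) i j : (forall k, `|y k 0| <= h ^+ 10) ->
  `|primal y i j| <= 2 * h ^+ 16.
Proof.
move=> yR; set P := pospart eig (slack C A y).
have H : mxdot P P <= (2 * h ^+ 12) ^+ 2.
  apply: le_trans (mxdot_pospart_self eigP sC sA y) _.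
  apply: le_trans (ler_norm _) _.
  apply: le_trans (ler_mxdot (fun i j => slack_entry i j yR) (fun i j => slack_entry i j yR)) _.
  rewrite -expr2 -exprMn lerXn2r ?nnegrE ?mulr_ge0 ?exprn_ge0 ?(ltW h0) //.
  by rewrite mulrCA ler_pM2l // (exprS h 11) ler_pM2r.
have : P i j ^+ 2 <= (2 * h ^+ 12) ^+ 2 by exact: le_trans (mxdot_entry _ _ _) H.
rewrite -(real_normK (num_real (P i j))) ler_pXn2r => //; rewrite ?nnegrE ?normr_ge0 // ?mulr_ge0 ?exprn_ge0 ?(ltW h0) // => Pij.
rewrite mxE -/P normrM (gtr0_norm (x := mu^-1)) ?invr_gt0 // /mu invrK.
by rewrite (exprD h 4 12) mulrCA ler_pM2l.
Qed.

Lemma rhs_le i : `|b i 0| <= 2 * h ^+ 2.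
Proof.
have := Zb i; have := ler_mxdot (A1 i) Z1; rewrite !mulr1 => H1 H2.
have -> : b i 0 = mxdot (A i) Z - (mxdot (A i) Z - b i 0) by ring.
apply: le_trans (ler_normB _ _) _.
have : h ^- 58 <= 1 by rewrite invf_le1 // exprn_ege1.
have : 1 <= h ^+ 2 by exact: exprn_ege1.
by have := n2; lra.
Qed.

Lemma dualg_entry (y : 'cV[R]_m) i : (forall k, `|y k 0| <= h ^+ 10) -> `|dualg y i 0| <= h ^+ 19.
Proof.
move=> yR; rewrite mxE; apply: le_trans (ler_normD _ _) _.
have T : `|tau * y i 0| <= 1.
  rewrite normrM (gtr0_norm tau0) mulrC -(mulrV (x := h ^+ 10)) ?unitfE ?gt_eqF //.
  by rewrite ler_pM ?invr_ge0 ?(ltW (hX _)) // hV.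
have N := ler_normB (b i 0) (mxdot (A i) (primal y)).
have := ler_mxdot (A1 i) (fun i j => primal_entry i j yR); rewrite mul1r => H.
have : n%:R ^+ 2 * (2 * h ^+ 16) <= 2 * h ^+ 18.
  by rewrite mulrCA ler_pM2l // (exprD h 2 16) ler_pM2r.
have := rhs_le i; have := @hS 18 19 isT; have := @hS 2 18 isT.
have : 1 <= h ^+ 2 by exact: exprn_ege1.
lra.
Qed.

(** The ball of radius [h^-22] is the target that no cut may remove. As [2 L <= h^8], its radius
    satisfies [L r^2 <= h^-36], within the tolerance [D = h^-35]; the norm bound places it inside
    the initial ball of radius [h^10]. *)
Lemma near_min_exists : exists yh,
  (forall y, dualf yh <= dualf y + h ^- 35) /\
  (forall y, dot (y - yh) (y - yh) <= (h ^- 22) ^+ 2 -> dot y y <= h ^+ 20).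
Proof.
have D0 : 0 < h ^- 35 by rewrite invr_gt0.
have [yh yhP] := near_minimizer eigP b sC sA mu0 tau0 D0 pZ.
exists yh; split=> // y yr.
have := near_min_norm eigP sC sA mu0 tau0 C1 yhP pZ Z1 Zb => H.
have E1 : n%:R ^+ 2 / (2 * mu) <= h ^+ 6 / 2.
  rewrite invfM /mu invrK mulrA (exprD h 2 4) mulrAC ler_pM2r ?(ltW (hX _)) //.
  by rewrite ler_pM2r.
have E2 : mu / 2 * n%:R ^+ 2 <= 1.
  apply: (@le_trans _ _ (h ^- 2 * h ^+ 2)); last by rewrite mulVf // gt_eqF.
  rewrite ler_pM ?exprn_ge0 // ?divr_ge0 ?(ltW mu0) //.
  apply: le_trans (hV (_ : 2 <= 4)%N) => //; rewrite -/mu; have := mu0; lra.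
have E3 : tau^-1 * (m%:R * (h ^- 58) ^+ 2) <= 1.
  apply: (@le_trans _ _ (h ^+ 13 * (h * h ^- 116))).
    rewrite /tau invrK ler_pM2l // -exprVn -exprM; apply: ler_pM => //.
    by rewrite exprn_ge0 // invr_ge0 ltW.
    by rewrite exprVn.
  rewrite mulrA -exprSr (hM (k := 102)) //.
  by rewrite invf_le1 // exprn_ege1.
have E4 : h ^- 35 <= 1 by rewrite invf_le1 // exprn_ege1.
have E5 : tau * dot yh yh <= 4 * h ^+ 6.
  have := @hS 2 6 isT; have : 1 <= h ^+ 2 by exact: exprn_ege1.
  have := n2; lra.
have E6 : dot yh yh <= 4 * h ^+ 19.
  have := E5; rewrite /tau mulrC ler_pdivrMr // -mulrA -exprD; exact.
have : dot y y <= 2 * dot yh yh + 2 * dot (y - yh) (y - yh).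
  have := dot_ge0 (y - 2 *: yh); rewrite dot_sqrBZ !(dotBl, dotBr) (dotC yh y); lra.
have : (h ^- 22) ^+ 2 <= 1 by rewrite exprn_ile1 ?invr_ge0 ?(ltW (hX _)) // invf_le1 // exprn_ege1.
have := @hS 19 20 isT; have : 1 <= h ^+ 19 by exact: exprn_ege1.
lra.
Qed.

Section Iteration.
Variables (yh c ct gt : 'cV[R]_m).
Hypothesis (ctR : forall i, `|ct i 0| <= h ^+ 10).
Hypothesis (gtE : forall i, `|gt i 0 - dualg ct i 0| <= h ^- 58).

(** The gradient is taken at the rounded center [ct] and computed approximately as [gt], yet the cut
    passes through the exact center [c]: a gradient that is not small leaves a margin exceeding all
    these errors. *)
Lemma inexact_cut y :
  (forall y, dualf yh <= dualf y + h ^- 35) ->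
  (forall y, dot (y - yh) (y - yh) <= (h ^- 22) ^+ 2 -> dot y y <= h ^+ 20) ->
  (forall i, `|ct i 0 - c i 0| <= h ^- 60) ->
  h ^- 26 < dot gt gt -> dot (y - yh) (y - yh) <= (h ^- 22) ^+ 2 ->
  dot gt (y - c) <= 0.
Proof.
move=> yhP ball cct gt_big yr; set g := dualg ct.
have L0 : 0 < L := smoothness_gt0 mu0 tau0.
have yR i : `|y i 0| <= h ^+ 10.
  have : y i 0 ^+ 2 <= h ^+ 20 by apply: le_trans (dot_entry _ _) (ball _ yr).
  rewrite -(real_normK (num_real (y i 0))) (exprM h 10 2) ler_pXn2r ?nnegrE ?(ltW (hX _)) //.
have Lr : L * dot (y - yh) (y - yh) <= h ^- 35.
  apply: (@le_trans _ _ (h ^+ 8 * h ^- 44)).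
    rewrite ler_pM ?dot_ge0 ?(ltW L0) //; first by have := smoothness_le; lra.
    by rewrite -[44%N]/(22 * 2)%N exprM -[in leRHS]exprVn.
  by rewrite (hM (k := 36)) // hV.
have cut := near_min_cut eigP sC sA mu0 tau0 A1 yhP ct Lr.
have gg : h ^- 26 / 4 <= dot g g.
  have E : dot (gt - g) (gt - g) <= h ^- 115.
    apply: (@le_trans _ _ (\sum_(i < m) h ^- 116)).
      apply: ler_sum => i _; rewrite !mxE -expr2 -(real_normK (num_real _)).
      rewrite -[116%N]/(58 * 2)%N exprM -exprVn lerXn2r ?nnegrE ?invr_ge0 ?(ltW (hX _)) //.
      by have := gtE i; rewrite !mxE.
    by rewrite sumr_const card_ord -[_ *+ m]mulr_natl -(@hM 1 116 115) // ler_pM2r ?invr_gt0.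
  have : dot gt gt <= 2 * dot g g + 2 * dot (gt - g) (gt - g).
    have := dot_ge0 (gt - 2 *: g); rewrite dot_sqrBZ !(dotBl, dotBr) (dotC g gt); lra.
  have := @hVS 26 115 isT; have : 0 < h ^- 26 by rewrite invr_gt0.
  by move: gt_big; lra.
(* The margin is [25 D] with [D = h^-35]: [near_min_cut] consumes [3 D] of it and the rounding
   errors, bounded by [S] below, one more [D]. *)
have gL : 25 * h ^- 35 <= (2 * L)^-1 * dot g g.
  apply: (@le_trans _ _ (h ^- 8 * (h ^- 26 / 4))); last first.
    rewrite ler_pM ?invr_ge0 ?divr_ge0 ?invr_ge0 ?(ltW (hX _)) //.
    by rewrite lef_pV2 ?posrE ?mulr_gt0 // smoothness_le.
  have := @hVS 34 35 isT; rewrite mulrA -invfM -exprD; lra.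
rewrite (_ : dot gt (y - c) = dot g (y - ct) +
   \sum_i ((gt i 0 - g i 0) * (y i 0 - ct i 0) + gt i 0 * (ct i 0 - c i 0))); last first.
  by rewrite -big_split /=; apply: eq_bigr => i _; rewrite !mxE; ring.
have S : \sum_i ((gt i 0 - g i 0) * (y i 0 - ct i 0) + gt i 0 * (ct i 0 - c i 0)) <= h ^- 35.
  apply: (@le_trans _ _ (\sum_(i < m) h ^- 36)).
    apply: ler_sum => i _; apply: le_trans (ler_norm _) _; apply: le_trans (ler_normD _ _) _.
    have T1 : `|(gt i 0 - g i 0) * (y i 0 - ct i 0)| <= 2 * h ^- 48.
      rewrite normrM; apply: (@le_trans _ _ (h ^- 58 * (2 * h ^+ 10))).
        apply: ler_pM => //.
        have := ler_normB (y i 0) (ct i 0); have := yR i; have := ctR i; lra.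
      by rewrite mulrCA (mulrC (h ^- 58)) (hM (k := 48)).
    have T2 : `|gt i 0 * (ct i 0 - c i 0)| <= h ^- 40.
      rewrite normrM -(@hM 20 60 40) //; apply: ler_pM => //.
      have -> : gt i 0 = g i 0 + (gt i 0 - g i 0) by ring.
      apply: le_trans (ler_normD _ _) _; have := dualg_entry i ctR; have := gtE i.
      have : h ^- 58 <= 1 by rewrite invf_le1 // exprn_ege1.
      have := @hS 19 20 isT; have : 1 <= h ^+ 19 by exact: exprn_ege1.
      rewrite -/g; lra.
    have := @hVS 40 48 isT; have := @hVS 36 40 isT; have : 0 < h ^- 40 by rewrite invr_gt0.
    by move: T1 T2; lra.
  by rewrite sumr_const card_ord -[_ *+ m]mulr_natl -(@hM 1 36 35) // ler_pM2r ?invr_gt0.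
have : 0 < h ^- 35 by rewrite invr_gt0.
move: cut S gL; rewrite -/g; lra.
Qed.

Hypothesis (gt_small : dot gt gt <= h ^- 26).

Lemma small_gradient_entry i : `|dualg ct i 0| <= 2 * h ^- 13.
Proof.
have H : `|gt i 0| <= h ^- 13.
  have : gt i 0 ^+ 2 <= h ^- 26 by exact: le_trans (dot_entry _ _) gt_small.
  rewrite -(real_normK (num_real (gt i 0))) -[26%N]/(13 * 2)%N exprM -exprVn.
  by rewrite ler_pXn2r ?nnegrE ?invr_ge0 ?(ltW (hX _)).
have := gtE i; have := @hVS 13 58 isT; have : 0 < h ^- 13 by rewrite invr_gt0.
have : `|dualg ct i 0| <= `|gt i 0| + `|gt i 0 - dualg ct i 0|.
  by have := ler_normB (gt i 0) (gt i 0 - dualg ct i 0); rewrite opprB addrC addrNK.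
lra.
Qed.

(** The threshold [h^-13] for the gradient beats [|y_i| <= h^10] by [h^-3], of which the sum over
    [m] terms loses one power. *)
Lemma small_gradient_objective : mxdot C Z - mxdot C (primal ct) <= h ^- 1.
Proof.
apply: le_trans (dual_primal_gap eigP b tau sC sA mu0 ct pZ) _.
have S : \sum_i ct i 0 * (dualg ct i 0 + (mxdot (A i) Z - b i 0)) <= 3 * h ^- 2.
  apply: (@le_trans _ _ (\sum_(i < m) (3 * h ^- 3))); last first.
    rewrite sumr_const card_ord -[_ *+ m]mulr_natl mulrCA -(@hM 1 3 2) // ler_pM2l // ler_pM2r //.
    by rewrite invr_gt0.
  apply: ler_sum => i _; apply: le_trans (ler_norm _) _; rewrite normrM.
  rewrite -(@hM 10 13 3) // mulrCA; apply: ler_pM => //.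
  apply: le_trans (ler_normD _ _) _; have := small_gradient_entry i; have := Zb i.
  have := @hVS 13 58 isT; have : 0 < h ^- 13 by rewrite invr_gt0.
  lra.
have T : 0 <= tau * dot ct ct by rewrite mulr_ge0 ?dot_ge0 // ltW.
have ZZ : mu / 4 * mxdot Z Z <= h ^- 2.
  have := ler_mxdot Z1 Z1; rewrite !mulr1 (ger0_norm (mxdot_ge0 Z)) => ZZ.
  apply: (@le_trans _ _ (mu * h ^+ 2)); last by rewrite mulrC (hM (k := 2)).
  rewrite ler_pM ?divr_ge0 ?mxdot_ge0 ?(ltW mu0) //; first by have := mu0; lra.
  exact: le_trans ZZ n2.
have := @hVS 1 2 isT; have : 0 < h ^- 2 by rewrite invr_gt0.
by move: S T ZZ; rewrite -/mu -/tau; lra.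
Qed.

(** By the form of the dual gradient, the residual is [tau y_i - g_i]. *)
Lemma small_gradient_residual i : `|mxdot (A i) (primal ct) - b i 0| <= 2 * h ^- 3.
Proof.
have -> : mxdot (A i) (primal ct) - b i 0 = tau * ct i 0 - dualg ct i 0 by rewrite mxE; ring.
apply: le_trans (ler_normB _ _) _; have := small_gradient_entry i.
have : `|tau * ct i 0| <= h ^- 3.
  by rewrite normrM (gtr0_norm tau0) mulrC -(@hM 10 13 3) // ler_pM2r ?invr_gt0.
have := @hVS 3 13 isT; have : 0 < h ^- 3 by rewrite invr_gt0.
lra.
Qed.

End Iteration.
End Accuracy.

(** * Programs and their cost *)

(* Integers 0, 1, 7 and 8 of the store hold n, m, h and s, integers 2 to 5 are loop
   counters, integer 6 receives digits and 9 tells that the result is ready. Matrix 2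
   holds scalars and vectors, one per row: a and c, the largest entries of the A_i and
   of C (rows 1 and 2), the powers of the digit base h^141 (5 and 7) and the numbers
   all of whose n^2, resp. m, digits are h^140 (6 and 8), which are added to make
   digits nonnegative, the center, its rounding and the cut (11 to 13), the packed A_i
   (16) and the scaled b (17). Matrix 1 packs the A_i along i; matrices 3 to 6 are the
   slack, the ellipsoid, the absolute value of the slack and the primal. *)
Definition IV (x : nat) : iexp := ILoad (INat x).
Definition RV (x : nat) : rexp := RLoad (INat 2) (INat x) (INat 0).
Definition RVec (x j : nat) : rexp := RLoad (INat 2) (INat x) (IV j).
Definition RMat (q i j : nat) : rexp := RLoad (INat q) (IV i) (IV j).
Definition SetI (x : nat) (e : iexp) : cmd := ISet (INat x) e.
Definition SetV (x : nat) (e : rexp) : cmd := RSet (INat 2) (INat x) (INat 0) e.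
Definition SetVec (x j : nat) (e : rexp) : cmd := RSet (INat 2) (INat x) (IV j) e.
Definition SetMat (q i j : nat) (e : rexp) : cmd := RSet (INat q) (IV i) (IV j) e.
Definition For (x : nat) (e : iexp) (c : cmd) : cmd :=
  Seq (SetI x (INat 0))
    (While (TILe (IAdd (IV x) (INat 1)) e) (Seq c (SetI x (IAdd (IV x) (INat 1))))).

Fixpoint loop_free (c : cmd) : bool :=
  match c with
  | Skip | ISet _ _ | RSet _ _ _ _ => true
  | Seq c1 c2 | If _ c1 c2 => loop_free c1 && loop_free c2
  | _ => false
  end.

(** An upper bound read off the text of a loop-free program: a conditional is charged for both
    branches, so the bound does not depend on the store. *)
Fixpoint lcost (c : cmd) : nat :=
  match c with
  | ISet a e => (icost a + icost e).+1
  | RSet q i j e => (icost q + icost i + icost j + rcost e).+1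
  | Seq c1 c2 => lcost c1 + lcost c2
  | If b c1 c2 => tcost b + (lcost c1 + lcost c2)
  | _ => 1
  end.

Section Machine.
Context {R : realType} (kap : nat -> R) (eig : @spectral_oracle R).
Implicit Types (s : @store R) (Q : @store R -> Prop).

Fixpoint run (c : cmd) s : store :=
  match c with
  | ISet a e => set_int s (ieval s a) (ieval s e)
  | RSet q i j e =>
      set_mat s (ieval s q)
         (upd (mats s (ieval s q)) (ieval s i)
            (upd (mats s (ieval s q) (ieval s i)) (ieval s j) (reval s e)))
  | Seq c1 c2 => run c2 (run c1 s)
  | If b c1 c2 => if teval s b then run c1 s else run c2 s
  | _ => s
  end.

(** Total correctness with a time bound. One terminating execution is asserted, [exec] being a
    relation whose rule for [MSqrt] accepts any positive semidefinite root. *)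
Definition wp c s (T : R) Q := exists t s', [/\ exec kap eig c s t s', t <= T & Q s'].

Lemma wp_le c s T T' Q Q' : wp c s T Q -> T <= T' -> (forall s', Q s' -> Q' s') -> wp c s T' Q'.
Proof. by move=> [t [s' [E tT qs]]] TT QQ; exists t, s'; split; [|exact: le_trans TT|exact: QQ]. Qed.

Lemma wp_cost c s T T' Q : wp c s T Q -> T <= T' -> wp c s T' Q.
Proof. by move=> H TT; apply: wp_le H TT _. Qed.

Lemma wp_seq c1 c2 s T1 T2 Q : wp c1 s T1 (fun s' => wp c2 s' T2 Q) -> wp (Seq c1 c2) s (T1 + T2) Q.
Proof.
move=> [t1 [s1 [E1 t1T [t2 [s2 [E2 t2T q]]]]]]; exists (t1 + t2), s2.
by split=> //; [exact: ExecSeq E1 E2|exact: lerD].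
Qed.

Lemma wp_bind c1 c2 s T1 T2 Q1 Q : wp c1 s T1 Q1 -> (forall s', Q1 s' -> wp c2 s' T2 Q) ->
  wp (Seq c1 c2) s (T1 + T2) Q.
Proof. by move=> H1 H2; apply: wp_seq; apply: wp_le H1 (lexx _) H2. Qed.

Lemma wp_if b c1 c2 s T Q : 0 <= T -> (teval s b -> wp c1 s T Q) -> (~~ teval s b -> wp c2 s T Q) ->
  wp (If b c1 c2) s ((tcost b)%:R + T) Q.
Proof.
move=> T0 H1 H2; have [t [s' [E tT q]]] : wp (if teval s b then c1 else c2) s T Q.
  by case: ifPn.
exists ((tcost b)%:R + t), s'; split=> //; first exact: ExecIf.
by rewrite lerD2l.
Qed.

Lemma exec_run c s : loop_free c -> exists2 t, exec kap eig c s t (run c s) & t <= (lcost c)%:R.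
Proof.
elim: c s => //=.
- by move=> s _; exists 1 => //; exact: ExecSkip.
- by move=> a e s _; eexists; first exact: ExecISet.
- by move=> q i j e s _; eexists; first exact: ExecRSet.
- move=> c1 IH1 c2 IH2 s /andP[/(IH1 s) [t1 E1 t1T] /(IH2 (run c1 s)) [t2 E2 t2T]].
  by exists (t1 + t2); [exact: ExecSeq E1 E2|rewrite natrD lerD].
- move=> b c1 IH1 c2 IH2 s /andP[/(IH1 s) [t1 E1 t1T] /(IH2 s) [t2 E2 t2T]].
  exists ((tcost b)%:R + (if teval s b then t1 else t2)); first by apply: ExecIf; case: ifP.
  rewrite !natrD lerD2l; case: ifP => _; first by rewrite ler_wpDr.
  by rewrite ler_wpDl.
Qed.

Lemma wp_run c s Q : loop_free c -> Q (run c s) -> wp c s (lcost c)%:R Q.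
Proof. by move=> /exec_run-/(_ s) [t E tT] q; exists t, (run c s). Qed.

Lemma wp_while (b : test) c s N T (I : nat -> store -> Prop) :
  0 <= T -> I 0%N s ->
  (forall k s', I k s' -> teval s' b -> (k < N)%N /\ wp c s' T (I k.+1)) ->
  wp (While b c) s (N.+1%:R * (T + (tcost b)%:R)) (fun s' => ~~ teval s' b /\ exists k, I k s').
Proof.
move=> T0 I0 step.
have tc : 0 <= T + (tcost b)%:R by rewrite addr_ge0.
(* The time allotted from iteration [k] on. The last summand covers [N < k], where the truncated
   difference is 0 but a failing test has still to be paid. *)
suff H k s' : I k s' -> wp (While b c) s' ((N.+1 - k)%:R * (T + (tcost b)%:R) + (tcost b)%:R * (N < k)%:R)
    (fun s' => ~~ teval s' b /\ exists k, I k s').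
  by apply: wp_le (H _ _ I0) _ _ => //; rewrite subn0 mulr0 addr0.
move: {2}(N.+1 - k)%N (leqnn (N.+1 - k)) => d; elim: d k s' => [|d IH] k s' kd Ik.
  have Nk : (N < k)%N by rewrite -subn_eq0 -leqn0.
  have F : ~~ teval s' b by apply/negP => /(step _ _ Ik)[]; rewrite ltnNge (ltnW Nk).
  exists (tcost b)%:R, s'; split; [exact: ExecWhileF| |by split=> //; exists k].
  by rewrite Nk mulr1 ler_wpDl // mulr_ge0.
have [tb|F] := boolP (teval s' b); last first.
  exists (tcost b)%:R, s'; split; [exact: ExecWhileF| |by split=> //; exists k].
  case: ltnP => Nk; first by rewrite mulr1 ler_wpDl // mulr_ge0.
  rewrite mulr0 addr0 subSn // -natr1 mulrDl mul1r addrA ler_wpDl // addr_ge0 // mulr_ge0 //.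
have [kN [t1 [s1 [E1 t1T I1]]]] := step _ _ Ik tb.
have [|t2 [s2 [E2 t2T q]]] := IH k.+1 s1 _ I1.
  by lia.
exists ((tcost b)%:R + t1 + t2), s2; split=> //; first exact: ExecWhileT E1 E2.
move: t2T; have -> : (N < k.+1)%N = false by lia.
have -> : (N < k)%N = false by lia.
rewrite !mulr0 !addr0 subSS subSn ?(ltnW kN) // -(natr1 (N - k)) mulrDl mul1r.
by lra.
Qed.

(** The overhead [icost e + 14] of a round is made of the test ([icost e + 5]), the increment (6)
    and the initialization (3), which is paid only once. *)
Lemma wp_for x e c s N T (I : nat -> store -> Prop) :
  0 <= T -> (forall i s', I i s' -> ieval s' e = N) ->
  I 0%N (set_int s x 0) ->
  (forall i s', (i < N)%N -> ints s' x = i -> I i s' ->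
     wp c s' T (fun s'' => ints s'' x = i /\ I i.+1 (set_int s'' x i.+1))) ->
  wp (For x e c) s (N.+1%:R * (T + (icost e + 14)%:R)) (fun s' => I N s' /\ ints s' x = N).
Proof.
move=> T0 eN I0 step; pose J i s' := [/\ I i s', ints s' x = i & (i <= N)%N].
apply: (@wp_le _ _ (3%:R + N.+1%:R * (T + 6%:R + (icost e + 5)%:R))
         _ (fun s' => ~~ teval s' (TILe (IAdd (IV x) (INat 1)) e) /\ exists k, J k s')).
- apply: wp_seq; exists 3%:R, (set_int s x 0); split=> //; first exact: (ExecISet _ _ s (INat x) (INat 0)).
  have -> : (icost e + 5 = tcost (TILe (IAdd (IV x) (INat 1)) e))%N by rewrite /= addnC.
  apply: wp_while; first by rewrite addr_ge0.
    by split=> //=; rewrite /upd eqxx.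
  move=> k s' [Ik xk kN] /=; rewrite (eN _ _ Ik) xk addn1 => ltkN; split=> //.
  apply: wp_seq; apply: wp_le (step _ _ ltkN xk Ik) _ _ => // s'' [xk' Ik'].
  exists 6%:R, (set_int s'' x k.+1); split=> //.
    have -> : k.+1 = ieval s'' (IAdd (IV x) (INat 1)) by rewrite /= xk' addn1.
    exact: (ExecISet kap eig s'' (INat x) (IAdd (IV x) (INat 1))).
  by split=> //=; rewrite /upd eqxx.
- by rewrite -(natr1 N) !natrD; have : 0 <= N%:R :> R by []; lra.
move=> s' [/=]; rewrite -ltnNge => H [k [Ik xk kN]].
move: H; rewrite (eN _ _ Ik) xk addn1 ltnS => Nk.
have E : k = N by apply/eqP; rewrite eqn_leq kN.
by rewrite E in Ik xk.
Qed.

Definition frame (Is Rs Qs : seq nat) s s' :=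
  [/\ forall a, a \notin Is -> ints s' a = ints s a,
      forall x, x \notin Rs -> mats s' 2 x = mats s 2 x &
      forall q, q != 2%N -> q \notin Qs -> mats s' q = mats s q].

Lemma frame_refl Is Rs Qs s : frame Is Rs Qs s s.
Proof. by []. Qed.

Lemma frame_trans Is Rs Qs s1 s2 s3 :
  frame Is Rs Qs s1 s2 -> frame Is Rs Qs s2 s3 -> frame Is Rs Qs s1 s3.
Proof.
move=> [i1 r1 q1] [i2 r2 q2]; split=> [a H|x H|q H K]; first by rewrite i2 // i1.
  by rewrite r2 // r1.
by rewrite q2 // q1.
Qed.

Lemma frame_sub Is Rs Qs Is' Rs' Qs' s s' : {subset Is <= Is'} -> {subset Rs <= Rs'} ->
  {subset Qs <= Qs'} -> frame Is Rs Qs s s' -> frame Is' Rs' Qs' s s'.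
Proof.
move=> sI sR sQ [fI fR fQ]; split=> [a H|x H|q H K]; [apply: fI|apply: fR|apply: fQ] => //.
- exact: contra (sI a) H.
- exact: contra (sR x) H.
- exact: contra (sQ q) K.
Qed.

Lemma frame_comp Is1 Rs1 Qs1 Is2 Rs2 Qs2 Is Rs Qs s1 s2 s3 :
  frame Is1 Rs1 Qs1 s1 s2 -> frame Is2 Rs2 Qs2 s2 s3 ->
  all (mem Is) (Is1 ++ Is2) -> all (mem Rs) (Rs1 ++ Rs2) -> all (mem Qs) (Qs1 ++ Qs2) ->
  frame Is Rs Qs s1 s3.
Proof.
move=> f1 f2; rewrite !all_cat => /andP[/allP i1 /allP i2] /andP[/allP r1 /allP r2] /andP[/allP q1 /allP q2].
exact: frame_trans (frame_sub i1 r1 q1 f1) (frame_sub i2 r2 q2 f2).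
Qed.

Lemma frame_int Is Rs Qs s s' a v : a \in Is ->
  frame Is Rs Qs s s' -> frame Is Rs Qs s (set_int s' a v).
Proof.
move=> aI [fI fR fQ]; split=> //= b bI; rewrite /upd; case: eqP => [E|_]; last exact: fI.
by rewrite E aI in bI.
Qed.

Lemma frame_row Is Rs Qs s s' x f : x \in Rs ->
  frame Is Rs Qs s s' -> frame Is Rs Qs s (set_mat s' 2 (upd (mats s' 2) x f)).
Proof.
move=> xR [fI fR fQ]; split=> //= [y yR|q q2 qQ]; rewrite /upd /=.
  by case: eqP => [E|_]; [rewrite E xR in yR|exact: fR].
by rewrite (negPf q2) fQ.
Qed.

Lemma frame_mat Is Rs Qs s s' q M : q \in Qs -> q != 2%N ->
  frame Is Rs Qs s s' -> frame Is Rs Qs s (set_mat s' q M).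
Proof.
move=> qQ q2 [fI fR fQ]; split=> //= [y yR|r r2 rQ]; rewrite /upd /=.
  by rewrite eq_sym (negPf q2) fR.
by case: eqP => [E|_]; [rewrite E qQ in rQ|exact: fQ].
Qed.

End Machine.

Ltac frm := rewrite /=; repeat first [exact: frame_refl
  | apply: frame_int; [by rewrite ?inE ?eqxx ?orbT|]
  | apply: frame_row; [by rewrite ?inE ?eqxx ?orbT|]
  | apply: frame_mat; [by rewrite ?inE ?eqxx ?orbT|by []|] | eassumption].

(** Exponents are numerals of the program, so a power is a fixed product of constant cost; opacity,
    set below, keeps simplification from expanding 141 factors. *)
Fixpoint ipow (e : iexp) (k : nat) : iexp :=
  if k is k'.+1 then IMul e (ipow e k') else INat 1.

Lemma ieval_ipow (R : realType) (s : @store R) e k : ieval s (ipow e k) = (ieval s e ^ k)%N.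
Proof. by elim: k => // k IH; rewrite /ipow -/ipow /= IH expnS. Qed.
#[global] Opaque ipow.

Definition HPow (k : nat) : rexp := RNat (ipow (IV 7) k).

(* With [z] in row 3 and a power of two [t > z] in row 4, divides [t] by
   [2 ^ (141 s)] and leaves the integer part of [z / t] in the integer 6. *)
Definition Extract : cmd :=
  Seq (SetI 6 (INat 0))
    (For 5 (IMul (INat 141) (IV 8))
       (Seq (SetV 4 (RDiv (RV 4) (RNat (INat 2))))
       (Seq (SetI 6 (IMul (INat 2) (IV 6)))
            (If (TRLe (RV 4) (RV 3))
                (Seq (SetV 3 (RSub (RV 3) (RV 4))) (SetI 6 (IAdd (IV 6) (INat 1))))
                Skip)))).

(** Reals reach the integers only through comparisons, so an integer part is found bit by bit: as
    [h^141 = 2^(141 s)], the halvings of [Extract] end at [t = 1]. *)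
Definition Floor (e : rexp) : cmd :=
  Seq (Seq (SetV 3 e) (SetV 4 (HPow 141))) Extract.

Lemma flat_index n i j k l : (j < n)%N -> (l < n)%N ->
  (i * n + j == k * n + l)%N = (i == k) && (j == l).
Proof.
move=> jn ln; apply/eqP/andP => [E|[/eqP-> /eqP->]] //.
have n0 : (0 < n)%N by exact: leq_ltn_trans jn.
have := congr1 (fun x => x %/ n)%N E; have := congr1 (fun x => x %% n)%N E.
by rewrite !modnMDl !divnMDl // !modn_small // !divn_small // !addn0 => -> ->.
Qed.

Lemma flat_lt m n i j : (i < m)%N -> (j < n)%N -> (i * n + j < m * n)%N.
Proof.
move=> im jn; apply: leq_trans (_ : i.+1 * n <= _)%N; last by rewrite leq_mul2r im orbT.
by rewrite mulSnr ltn_add2l.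
Qed.

(** * Loops that fill or sum arrays *)

Section Procedures.
Context {R : realType} (kap : nat -> R) (eig : @spectral_oracle R).
Implicit Types (s : @store R).
Notation wp := (wp kap eig).

Lemma frame_cons Is Rs Qs s s' x : frame Is Rs Qs s s' -> frame (x :: Is) Rs Qs s s'.
Proof. by apply: frame_sub => // a; rewrite inE orbC => ->. Qed.

(** The invariant [P] sees only the matrices, hence is untouched by the increment of the counter;
    the integers are left to the frame. *)
Lemma wp_loop x e c s N T Is Rs Qs (P : nat -> (nat -> nat -> nat -> R) -> Prop) :
  0 <= T -> x \notin Is ->
  (forall s', frame (x :: Is) Rs Qs s s' -> ieval s' e = N) ->
  P 0%N (mats s) ->
  (forall i s', (i < N)%N -> ints s' x = i -> frame (x :: Is) Rs Qs s s' -> P i (mats s') ->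
     wp c s' T (fun s'' => frame Is Rs Qs s' s'' /\ P i.+1 (mats s''))) ->
  wp (For x e c) s (N.+1%:R * (T + (icost e + 14)%:R))
    (fun s' => frame (x :: Is) Rs Qs s s' /\ P N (mats s')).
Proof.
move=> T0 xI eN P0 step; have xx : x \in x :: Is by rewrite mem_head.
apply: wp_le (wp_for (I := fun i s' => frame (x :: Is) Rs Qs s s' /\ P i (mats s')) T0 _ _ _) _ _.
- by move=> i s' [f _]; exact: eN f.
- by split=> //; apply: frame_int.
- move=> i s' iN xi [f p]; apply: wp_le (step _ _ iN xi f p) (lexx _) _ => s'' [f' p'].
  split; first by have [-> //] := f'.
  by split=> //; apply: frame_int => //; apply: frame_trans f (frame_cons x f').
- exact: lexx.
- by move=> s' [].
Qed.

(** Indexing the invariant by the row-major position makes a double loop behave like a single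
    one. *)
Lemma wp_loop2 x y e1 e2 c s n1 n T Is Rs Qs (P : nat -> (nat -> nat -> nat -> R) -> Prop) :
  0 <= T -> x \notin y :: Is -> y \notin Is ->
  (forall s', frame (x :: y :: Is) Rs Qs s s' -> ieval s' e1 = n1) ->
  (forall s', frame (x :: y :: Is) Rs Qs s s' -> ieval s' e2 = n) ->
  P 0%N (mats s) ->
  (forall i j s', (i < n1)%N -> (j < n)%N -> ints s' x = i -> ints s' y = j ->
     frame (x :: y :: Is) Rs Qs s s' -> P (i * n + j)%N (mats s') ->
     wp c s' T (fun s'' => frame Is Rs Qs s' s'' /\ P (i * n + j).+1 (mats s''))) ->
  wp (For x e1 (For y e2 c)) s
    (n1.+1%:R * (n.+1%:R * (T + (icost e2 + 14)%:R) + (icost e1 + 14)%:R))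
    (fun s' => frame (x :: y :: Is) Rs Qs s s' /\ P (n1 * n)%N (mats s')).
Proof.
move=> T0 xI yI e1N e2N P0 step.
have T1 : 0 <= n.+1%:R * (T + (icost e2 + 14)%:R) by rewrite mulr_ge0 // addr_ge0.
apply: (wp_loop (P := fun i M => P (i * n)%N M) T1 xI e1N) => // i s' iN xi fr p.
apply: wp_le (wp_loop (N := n) (P := fun j M => P (i * n + j)%N M) T0 yI _ _ _) (lexx _) _ => //.
- by move=> s'' fr'; apply: e2N; exact: frame_trans fr (frame_cons x fr').
- by rewrite addn0.
- move=> j s'' jN yj fr' p'; have [fI _ _] := fr'; rewrite addnS.
  by apply: step => //; [rewrite fI|exact: frame_trans fr (frame_cons x fr')].
by move=> s'' [fr' p']; split=> //; rewrite mulSnr.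
Qed.

Lemma wp_accum x e r f s N (F : nat -> R) :
  (forall s', frame [:: x] [:: r] [::] s s' -> ieval s' e = N) ->
  (forall s' j, (j < N)%N -> frame [:: x] [:: r] [::] s s' -> ints s' x = j ->
     reval s' f = F j) ->
  wp (For x e (SetV r (RAdd (RV r) f))) s
    (N.+1%:R * ((lcost (SetV r (RAdd (RV r) f)))%:R + (icost e + 14)%:R))
    (fun s' => frame [:: x] [:: r] [::] s s' /\
       mats s' 2 r 0%N = mats s 2 r 0%N + \sum_(j < N) F j).
Proof.
move=> eN fF; apply: (wp_loop (P := fun i M => M 2%N r 0%N = mats s 2 r 0%N + \sum_(j < i) F j)) => //.
  by rewrite big_ord0 addr0.
move=> i s' iN xi fr p; apply: wp_run => //; split; first by frm.
by rewrite /= /upd !eqxx p (fF s' i) // big_ord_recr addrA.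
Qed.

(** The expression [f] may read the old value of the entry being overwritten, which admits updates
    in place such as the normalization of a vector. *)
Lemma wp_vec x e r f s N (F : nat -> R) :
  (forall s', frame [:: x] [:: r] [::] s s' -> ieval s' e = N) ->
  (forall s' j, (j < N)%N -> frame [:: x] [:: r] [::] s s' -> ints s' x = j ->
     mats s' 2 r j = mats s 2 r j -> reval s' f = F j) ->
  wp (For x e (SetVec r x f)) s
    (N.+1%:R * ((lcost (SetVec r x f))%:R + (icost e + 14)%:R))
    (fun s' => frame [:: x] [:: r] [::] s s' /\ forall j, (j < N)%N -> mats s' 2 r j = F j).
Proof.
move=> eN fF; apply: wp_le (wp_loop (P := fun i M => (forall j, (j < i)%N -> M 2%N r j = F j) /\
  (forall j, (i <= j)%N -> M 2%N r j = mats s 2 r j)) _ _ eN _ _) (lexx _) _ => //.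
  move=> i s' iN xi fr [p1 p2]; apply: wp_run => //; split; first by frm.
  rewrite /= /upd !eqxx xi (fF s' i) ?p2 //; split=> j; case: eqP => [->|/eqP ji] // H.
  - by apply: p1; rewrite ltn_neqAle ji -ltnS.
  - by rewrite ltnn in H.
  - by apply: p2; exact: ltnW.
by move=> s' [f' [p _]].
Qed.

Lemma wp_mat x1 e1 x2 e2 q f s N1 N2 (F : nat -> nat -> R) : q != 2%N -> x1 != x2 ->
  (forall s', frame [:: x1; x2] [::] [:: q] s s' -> ieval s' e1 = N1) ->
  (forall s', frame [:: x1; x2] [::] [:: q] s s' -> ieval s' e2 = N2) ->
  (forall s' i j, (i < N1)%N -> (j < N2)%N -> frame [:: x1; x2] [::] [:: q] s s' ->
     ints s' x1 = i -> ints s' x2 = j -> mats s' q i j = mats s q i j -> reval s' f = F i j) ->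
  wp (For x1 e1 (For x2 e2 (SetMat q x1 x2 f))) s
    (N1.+1%:R * (N2.+1%:R * ((lcost (SetMat q x1 x2 f))%:R + (icost e2 + 14)%:R) + (icost e1 + 14)%:R))
    (fun s' => frame [:: x1; x2] [::] [:: q] s s' /\
       forall i j, (i < N1)%N -> (j < N2)%N -> mats s' q i j = F i j).
Proof.
move=> q2 x12 e1N e2N fF.
pose P k M := forall i j, (j < N2)%N ->
  M q i j = if (i * N2 + j < k)%N then F i j else mats s q i j.
apply: wp_le (wp_loop2 (P := P) (Is := [::]) _ _ _ e1N e2N _ _) (lexx _) _ => //.
- by rewrite inE.
- move=> i j s' iN jN xi yj fr p; apply: wp_run => //; split; first by frm.
  move=> i' j' j'N; rewrite /= /upd !eqxx xi yj ltnS leq_eqVlt flat_index //.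
  have [->|ii] := eqVneq i' i; have [->|jj] := eqVneq j' j; rewrite /= ?p //.
  by apply: fF; rewrite // p // ltnn.
by move=> s' [fr p]; split=> // i j iN jN; rewrite p // flat_lt.
Qed.

Lemma wp_matvec x e y e' r f s N N' (F : nat -> nat -> R) : x != y ->
  (forall s', frame [:: x; y] [:: r] [::] s s' -> ieval s' e = N) ->
  (forall s', frame [:: x; y] [:: r] [::] s s' -> ieval s' e' = N') ->
  (forall s' i j, (i < N)%N -> (j < N')%N -> frame [:: x; y] [:: r] [::] s s' ->
     ints s' x = i -> ints s' y = j -> reval s' f = F i j) ->
  wp (For x e (Seq (SetVec r x (RNat (INat 0)))
        (For y e' (SetVec r x (RAdd (RVec r x) f))))) s
    (N.+1%:R * ((lcost (SetVec r x (RNat (INat 0))))%:R +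
        N'.+1%:R * ((lcost (SetVec r x (RAdd (RVec r x) f)))%:R + (icost e' + 14)%:R) + (icost e + 14)%:R))
    (fun s' => frame [:: x; y] [:: r] [::] s s' /\
       forall i, (i < N)%N -> mats s' 2 r i = \sum_(j < N') F i j).
Proof.
move=> xy eN e'N fF; have rr : r \in [:: r] by rewrite mem_head.
have T0 : 0 <= N'.+1%:R * ((lcost (SetVec r x (RAdd (RVec r x) f)))%:R + (icost e' + 14)%:R) :> R.
  by rewrite mulr_ge0.
have xN : x \notin [:: y] by rewrite inE.
apply: (wp_loop (P := fun i M => forall k, (k < i)%N -> M 2%N r k = \sum_(j < N') F k j) _ xN) => //.
move=> i s' iN xi fr p; apply: wp_seq; apply: wp_run => //=; set s1 := set_mat _ _ _.
have fr1 : frame [::] [:: r] [::] s' s1 by frm.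
have fr1' : frame [:: x; y] [:: r] [::] s s1.
  by apply: frame_trans fr (frame_sub _ _ _ fr1).
apply: wp_le (wp_loop (P := fun j M => M 2%N r i = \sum_(k < j) F i k /\
   (forall k, (k < i)%N -> M 2%N r k = \sum_(j < N') F k j)) (Is := [::]) (Rs := [:: r]) (Qs := [::]) _ _ _ _ _) (lexx _) _ => //.
- by move=> s'' f'; apply: e'N; apply: frame_trans fr1' (frame_cons x f').
- rewrite /s1 /= /upd !eqxx xi eqxx big_ord0; split=> // k ki.
  by case: eqP => [E|_]; [rewrite E ltnn in ki|exact: p].
- move=> j s2 jN yj fr2 [p1 p2]; apply: wp_run => //; split; first by frm.
  have xi2 : ints s2 x = i by have [-> //] := fr2; rewrite inE.
  rewrite /= /upd !eqxx xi2 eqxx p1 (fF s2 i j) //; last exact: frame_trans fr1' (frame_cons x fr2).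
  rewrite big_ord_recr; split=> // k ki.
  by case: eqP => [E|_]; [rewrite E ltnn in ki|exact: p2].
move=> s'' [f' [p1 p2]]; split; first by apply: frame_trans (frame_sub _ _ _ fr1) f'.
move=> k; rewrite ltnS leq_eqVlt => /predU1P[->|ki]; [exact: p1|exact: p2].
Qed.

Lemma wp_extract sb z t s : ints s 8 = sb -> mats s 2 3 0%N = z -> mats s 2 4 0%N = t ->
  0 <= z < t ->
  wp Extract s (3%:R + (141 * sb).+1%:R * 100%:R)
    (fun s' => [/\ frame [:: 5; 6] [:: 3; 4] [::] s s',
      mats s' 2 4 0%N = t / 2 ^+ (141 * sb) &
      z = (ints s' 6)%:R * mats s' 2 4 0%N + mats s' 2 3 0%N /\
      0 <= mats s' 2 3 0%N < mats s' 2 4 0%N]).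
Proof.
move=> hs hz ht zt; apply: wp_seq; apply: wp_run => //=.
(* Binary long division: [z] is quotient times [t] plus a remainder below [t], and [t] is halved in
   each round. *)
pose I i s' := [/\ frame [:: 5; 6] [:: 3; 4] [::] s s', mats s' 2 4 0%N = t / 2 ^+ i,
  z = (ints s' 6)%:R * mats s' 2 4 0%N + mats s' 2 3 0%N &
  0 <= mats s' 2 3 0%N < mats s' 2 4 0%N].
apply: wp_le (wp_for (I := I) (N := (141 * sb)%N) (T := 82%:R) _ _ _ _) _ _ => //.
- by move=> i s' [[fI _ _] _ _ _] /=; rewrite (fI 8) // hs.
- split=> /=; first by frm.
  + by rewrite ht expr0 divr1.
  + by rewrite /upd /= mul0r add0r hz.
  + by rewrite hz ht.
- move=> i s' iN xi [fr p1 p2 /andP[p3 p4]].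
  apply: wp_le (wp_run kap eig (c := (Seq (SetV 4 (RDiv (RV 4) (RNat (INat 2))))
       (Seq (SetI 6 (IMul (INat 2) (IV 6)))
            (If (TRLe (RV 4) (RV 3))
                (Seq (SetV 3 (RSub (RV 3) (RV 4))) (SetI 6 (IAdd (IV 6) (INat 1))))
                Skip)))) (s := s') (Q := fun s'' => ints s'' 5 = i /\ I i.+1 (set_int s'' 5 i.+1)) isT _) _ _ => //; last by rewrite ler_nat.
  have E : mats s' 2 4 0%N / 2 = t / 2 ^+ i.+1 by rewrite p1 exprS invfM; ring.
  rewrite /= /upd /=; case: ifPn => [le|]; [|rewrite -ltNge => lt].
    split; first by rewrite /= /upd.
    split; first by frm.
    + by rewrite /= /upd /= E.
    + rewrite /= /upd /= natrD natrM p2; lra.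
    + by rewrite /= /upd /=; lra.
  split; first by rewrite /= /upd.
  split; first by frm.
  + by rewrite /= /upd /= E.
  + rewrite /= /upd /= natrM p2; lra.
  + by rewrite /= /upd /=; lra.
- by rewrite -natrD.
- by move=> s' [[fr p1 p2 p3] _].
Qed.

End Procedures.

(** * Packed numbers *)

Section Digits.
Context {R : realType}.
Implicit Types (D : nat -> R) (B : R).

(** Horner's scheme, most significant digit first. The digits are arbitrary reals, so that the value
    is linear in them; that they are naturals below the base matters only when they are read
    back. *)
Fixpoint digits_value B D (k : nat) : R :=
  if k is k'.+1 then digits_value B D k' * B + D k' else 0.

Lemma digits_valueD B D k l :
  digits_value B D (k + l) = digits_value B D k * B ^+ l + digits_value B (fun j => D (k + j)%N) l.
Proof.
elim: l => [|l IH]; first by rewrite addn0 expr0 mulr1 addr0.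
by rewrite addnS /= IH exprSr; ring.
Qed.

Lemma digits_value_head B D l :
  digits_value B D l.+1 = D 0%N * B ^+ l + digits_value B (fun j => D j.+1) l.
Proof. by rewrite -[l.+1]/(1 + l)%N digits_valueD /= mul0r add0r. Qed.

Lemma eq_digits_value B D D' k : (forall j, (j < k)%N -> D j = D' j) ->
  digits_value B D k = digits_value B D' k.
Proof.
elim: k => //= k IH E; rewrite E // IH // => j jk; apply: E; exact: ltnW.
Qed.

(** One multiplication per [i] thus forms the linear combinations at all positions
    simultaneously. *)
Lemma digits_value_sum (I : finType) B (c : I -> R) (D : I -> nat -> R) k :
  \sum_i c i * digits_value B (D i) k = digits_value B (fun j => \sum_i c i * D i j) k.
Proof.
elim: k => [|k IH] /=; first by rewrite big1 // => i _; rewrite mulr0.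
by rewrite -IH mulr_suml -big_split; apply: eq_bigr => i _; rewrite /=; ring.
Qed.

Lemma digits_value_add B D D' k :
  digits_value B D k + digits_value B D' k = digits_value B (fun j => D j + D' j) k.
Proof. by elim: k => [|k IH] /=; [rewrite addr0|rewrite -IH; ring]. Qed.

Lemma digits_value_bound (b : nat) (d : nat -> nat) k : (forall j, (j < k)%N -> (d j < b)%N) ->
  0 <= digits_value b%:R (fun j => (d j)%:R) k <= b%:R ^+ k - 1.
Proof.
elim: k => [|k IH] db /=; first by rewrite expr0 subrr lexx.
have /andP[h0 h1] := IH (fun j jk => db j (ltnW jk)).
have : (d k)%:R <= b%:R - 1 :> R by rewrite lerBrDr natr1 ler_nat db.
have b0 : 0 <= b%:R :> R by []. have d0 : 0 <= (d k)%:R :> R by [].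
move: h0 h1; set v := digits_value _ _ _ => h0 h1 dk.
rewrite addr_ge0 ?mulr_ge0 //= exprSr; have : v * b%:R <= (b%:R ^+ k - 1) * b%:R by rewrite ler_wpM2r.
lra.
Qed.

Lemma euclid_unique (t z w : R) (d e : nat) : 0 <= z < t -> 0 <= w < t ->
  d%:R * t + z = e%:R * t + w -> d = e /\ z = w.
Proof.
move=> /andP[z0 zt] /andP[w0 wt] E.
have t0 : 0 < t by exact: le_lt_trans zt.
have H (a b : nat) (x y : R) : 0 <= x -> y < t -> a%:R * t + x = b%:R * t + y -> (a <= b)%N.
  move=> x0 yt ab; rewrite leqNgt; apply/negP => ba.
  have : b%:R + 1 <= a%:R :> R by rewrite natr1 ler_nat.
  by rewrite -(ler_pM2r t0); lra.
have de : d = e by apply/eqP; rewrite eqn_leq (H d e z w) ?(H e d w z).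
by split=> //; move: E; rewrite de => /addrI.
Qed.

Lemma truncn_unique (v : R) d : d%:R <= v -> v < d%:R + 1 -> d = Num.truncn v.
Proof. by move=> dv vd; apply/esym/truncn_def; rewrite dv -natr1. Qed.

End Digits.

(** * Reading the digits of a packed number *)

Section Procedures.
Context {R : realType} (kap : nat -> R) (eig : @spectral_oracle R).
Implicit Types (s : @store R).
Notation wp := (wp kap eig).
Context (sb : nat) (sb0 : (0 < sb)%N).
Let hn := (2 ^ sb)%N.
(** The base. The largest digits will be sums of [n^2] products of a rounded primal entry, at most
    [h^77], and a rounded entry of some [A_i], at most [h^60]: they are bounded by [h^139], the
    shift by [h^140] makes them nonnegative, and the result is below [h^141]. *)
Let beta : R := hn%:R ^+ 141.

Definition scaled s := ints s 8 = sb /\ ints s 7 = hn.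

Lemma scaled_frame Is Rs Qs s s' : 7 \notin Is -> 8 \notin Is ->
  frame Is Rs Qs s s' -> scaled s -> scaled s'.
Proof. by move=> I7 I8 [fI _ _] [s8 s7]; split; rewrite fI. Qed.

Lemma beta_pow : beta = 2 ^+ (141 * sb).
Proof. by rewrite /beta /hn natrX -exprM mulnC. Qed.

Let T0 : R := (150 * 100 * sb)%:R.

Lemma extract_cost : 3%:R + (141 * sb).+1%:R * 100%:R <= T0.
Proof. by rewrite -natrM -natrD ler_nat; lia. Qed.

Lemma wp_floor e s v : scaled s -> reval s e = v -> 0 <= v < beta ->
  wp (Floor e) s ((lcost (Seq (SetV 3 e) (SetV 4 (HPow 141))))%:R + T0)
    (fun s' => frame [:: 5; 6] [:: 3; 4] [::] s s' /\ ints s' 6 = Num.truncn v).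
Proof.
move=> [s8 s7] ev vb; apply: wp_seq; apply: wp_run => //.
have E4 : mats (run (Seq (SetV 3 e) (SetV 4 (HPow 141))) s) 2 4 0%N = beta.
  by rewrite /= /upd /= ieval_ipow natrX /= s7.
have E3 : mats (run (Seq (SetV 3 e) (SetV 4 (HPow 141))) s) 2 3 0%N = v.
  by rewrite /= /upd /= ev.
have fr1 : frame [:: 5; 6] [:: 3; 4] [::] s (run (Seq (SetV 3 e) (SetV 4 (HPow 141))) s).
  by frm.
have s8' : ints (run (Seq (SetV 3 e) (SetV 4 (HPow 141))) s) 8 = sb by [].
move: fr1 E4 E3 s8'; set s1 := run _ s => fr1 E4 E3 s8'.
apply: wp_le (wp_extract kap eig s8' E3 E4 vb) extract_cost _ => s' [fr2 th [zE zb]].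
split; first exact: frame_trans fr1 fr2.
move: zE zb; rewrite th beta_pow divff ?expf_neq0 ?pnatr_eq0 // mulr1 => zE /andP[z0 z1].
by apply: truncn_unique; rewrite zE; lra.
Qed.

(** Dividing [t] by the base exposes the leading digit, and what remains in rows 3 and 4 is the
    packed tail with its own power of the base. [Extract] can therefore be repeated as it stands. *)
Lemma wp_extract_digit s (d : nat -> nat) k l : scaled s ->
  (forall j, (j < k + l.+1)%N -> (d j)%:R < beta) ->
  mats s 2 3 0%N = digits_value beta (fun j => (d (k + j)%N)%:R) l.+1 ->
  mats s 2 4 0%N = beta ^+ l.+1 ->
  wp Extract s T0 (fun s' => [/\ frame [:: 5; 6] [:: 3; 4] [::] s s',
    ints s' 6 = d k, mats s' 2 4 0%N = beta ^+ l &
    mats s' 2 3 0%N = digits_value beta (fun j => (d (k.+1 + j)%N)%:R) l]).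
Proof.
move=> [s8 s7] db E3 E4.
have bN : beta = (hn ^ 141)%:R by rewrite /beta natrX.
have beta0 : 0 < beta by rewrite exprn_gt0 // ltr0n expn_gt0.
have dv l' k' : (k' + l' <= k + l.+1)%N ->
    0 <= digits_value beta (fun j => (d (k' + j)%N)%:R) l' < beta ^+ l'.
  move=> kl; have /andP[h0 h1] : 0 <= digits_value beta (fun j => (d (k' + j)%N)%:R) l' <= beta ^+ l' - 1.
    rewrite bN; apply: digits_value_bound => j jl.
    by rewrite -(ltr_nat R) -bN db // (leq_trans _ kl) // ltn_add2l.
  by rewrite h0; lra.
apply: wp_le (wp_extract kap eig s8 E3 E4 _) extract_cost _; first exact: dv.
move=> s' [fr th [zE zb]].
have th' : mats s' 2 4 0%N = beta ^+ l.
  by rewrite th -beta_pow exprS mulrC mulKf // gt_eqF.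
move: zE zb; rewrite th' digits_value_head addn0.
rewrite (@eq_digits_value _ _ _ (fun j => (d (k.+1 + j)%N)%:R)) => [|j _]; last by rewrite addnS.
move=> zE zb; have [|dE zE'] := euclid_unique _ zb zE; last by split.
by apply: dv; rewrite addSnnS.
Qed.

Lemma wp_unpack_vec x e r f s N (d : nat -> nat) (F : nat -> R) :
  x \notin [:: 5; 6; 7; 8] -> r \notin [:: 3; 4] -> scaled s ->
  (forall s', frame [:: x; 5; 6] [:: 3; 4; r] [::] s s' -> ieval s' e = N) ->
  (forall j, (j < N)%N -> (d j)%:R < beta) ->
  mats s 2 3 0%N = digits_value beta (fun j => (d j)%:R) N -> mats s 2 4 0%N = beta ^+ N ->
  (forall s' j, (j < N)%N -> frame [:: x; 5; 6] [:: 3; 4; r] [::] s s' -> ints s' x = j ->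
     ints s' 6 = d j -> reval s' f = F j) ->
  wp (For x e (Seq Extract (SetVec r x f))) s
    (N.+1%:R * ((T0 + (lcost (SetVec r x f))%:R) + (icost e + 14)%:R))
    (fun s' => frame [:: x; 5; 6] [:: 3; 4; r] [::] s s' /\
       forall j, (j < N)%N -> mats s' 2 r j = F j).
Proof.
rewrite !inE !negb_or => /and4P[x5 x6 x7 x8] /andP[r3 r4] sc eN db E3 E4 fF.
pose P i (M : nat -> nat -> nat -> R) := [/\ forall j, (j < i)%N -> M 2%N r j = F j,
  M 2%N 3%N 0%N = digits_value beta (fun j => (d (i + j)%N)%:R) (N - i) & M 2%N 4%N 0%N = beta ^+ (N - i)].
apply: wp_le (wp_loop (P := P) (Is := [:: 5; 6]) (Rs := [:: 3; 4; r]) (Qs := [::]) _ _ eN _ _) (lexx _) _ => //; last first.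
- by move=> s' [fr' [p1 _ _]].
- move=> i s' iN xi fr [p1 p2 p3]; apply: wp_seq.
  have sc' : scaled s' by apply: scaled_frame fr sc; rewrite !inE !negb_or ?x7 ?x8 // eq_sym ?x7 ?x8.
  have NS : (N - i = (N - i.+1).+1)%N by rewrite subnSK.
  rewrite NS in p2 p3.
  have db' j : (j < i + (N - i.+1).+1)%N -> (d j)%:R < beta.
    by rewrite -NS subnKC ?(ltnW iN) //; exact: db.
  apply: wp_le (wp_extract_digit sc' db' p2 p3) (lexx _) _ => s1 [fr1 d1 th1 z1].
  have fr1' : frame [:: 5; 6] [:: 3; 4; r] [::] s' s1.
    by apply: frame_sub fr1 => // y; rewrite !inE => /orP[] ->; rewrite ?orbT.
  have xi1 : ints s1 x = i by have [-> //] := fr1; rewrite !inE negb_or x5.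
  apply: wp_run => //; split; first by frm.
  have fF' : reval s1 f = F i by apply: fF => //; exact: frame_trans fr (frame_cons x fr1').
  rewrite /P /= /upd /= !eqxx xi1 fF' (eq_sym 3%N) (negPf r3) (eq_sym 4%N) (negPf r4).
  split=> // j; case: eqP => [->//|/eqP ji]; rewrite ltnS leq_eqVlt (negPf ji) /= => jl.
  by have [_ -> //] := fr1; rewrite ?p1 // !inE negb_or r3.
- by split=> //; rewrite subn0.
- by rewrite !inE negb_or x5.
by rewrite addr_ge0.
Qed.

Lemma wp_unpack_mat x y e q f s n (d : nat -> nat) (F : nat -> nat -> R) :
  x != y -> x \notin [:: 5; 6; 7; 8] -> y \notin [:: 5; 6; 7; 8] -> q != 2%N -> scaled s ->
  (forall s', frame [:: x; y; 5; 6] [:: 3; 4] [:: q] s s' -> ieval s' e = n) ->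
  (forall j, (j < n * n)%N -> (d j)%:R < beta) ->
  mats s 2 3 0%N = digits_value beta (fun j => (d j)%:R) (n * n) ->
  mats s 2 4 0%N = beta ^+ (n * n) ->
  (forall s' i j, (i < n)%N -> (j < n)%N -> frame [:: x; y; 5; 6] [:: 3; 4] [:: q] s s' ->
     ints s' x = i -> ints s' y = j -> ints s' 6 = d (i * n + j)%N -> reval s' f = F i j) ->
  wp (For x e (For y e (Seq Extract (SetMat q x y f)))) s
    (n.+1%:R * (n.+1%:R * ((T0 + (lcost (SetMat q x y f))%:R) + (icost e + 14)%:R) + (icost e + 14)%:R))
    (fun s' => frame [:: x; y; 5; 6] [:: 3; 4] [:: q] s s' /\
       forall i j, (i < n)%N -> (j < n)%N -> mats s' q i j = F i j).
Proof.
rewrite !inE !negb_or => xy /and4P[x5 x6 x7 x8] /and4P[y5 y6 y7 y8] q2 sc eN db E3 E4 fF.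
pose P k (M : nat -> nat -> nat -> R) := [/\
  forall i j, (j < n)%N -> (i * n + j < k)%N -> M q i j = F i j,
  M 2%N 3%N 0%N = digits_value beta (fun j => (d (k + j)%N)%:R) (n * n - k) &
  M 2%N 4%N 0%N = beta ^+ (n * n - k)].
apply: wp_le (wp_loop2 (P := P) (Is := [:: 5; 6]) (Rs := [:: 3; 4]) (Qs := [:: q]) _ _ _ eN eN _ _) (lexx _) _ => //.
- by rewrite addr_ge0.
- by rewrite !inE !negb_or xy x5.
- by rewrite !inE negb_or y5.
- by split=> //; rewrite subn0.
- move=> i j s1 iN jn xi yj fr1 [a1 a3 a4]; apply: wp_seq.
  have sc' : scaled s1.
    by apply: scaled_frame fr1 sc; rewrite !inE !negb_or ?(eq_sym 7) ?(eq_sym 8) ?x7 ?x8 ?y7 ?y8.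
  have lt : (i * n + j < n * n)%N by exact: flat_lt.
  have NS : (n * n - (i * n + j) = (n * n - (i * n + j).+1).+1)%N by rewrite subnSK.
  rewrite NS in a3 a4.
  have db' k : (k < (i * n + j) + (n * n - (i * n + j).+1).+1)%N -> (d k)%:R < beta.
    by rewrite -NS subnKC ?(ltnW lt) //; exact: db.
  apply: wp_le (wp_extract_digit sc' db' a3 a4) (lexx _) _ => s2 [fr2 d2 th2 z2].
  have fr2' : frame [:: 5; 6] [:: 3; 4] [:: q] s1 s2 by apply: frame_sub fr2.
  have yj2 : ints s2 y = j by have [-> //] := fr2; rewrite !inE negb_or y5.
  have xi2 : ints s2 x = i by have [-> //] := fr2; rewrite !inE negb_or x5.
  apply: wp_run => //; split; first by frm.
  have fF' : reval s2 f = F i j.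
    apply: fF => //; apply: frame_trans fr1 _; apply: frame_cons; exact: frame_cons.
  rewrite /P /= /upd /= !eqxx xi2 yj2 fF' (eq_sym 2%N) (negPf q2) ?eqxx.
  have Mq : mats s2 q = mats s1 q by have [_ _ ->] := fr2.
  split=> // k l ln; rewrite ltnS leq_eqVlt flat_index //.
  by have [->|kk] := eqVneq k i; have [->|ll] := eqVneq l j; rewrite /= ?Mq //; exact: a1.
by move=> s' [fr' [p1 _ _]]; split=> // i j iN jN; apply: p1; rewrite ?flat_lt.
Qed.

End Procedures.

(** * Absorbing overheads into constants *)

Section Costs.
Context {R : realType}.

(** Every cost is brought to the form [k%:R * U] with [k] independent of the instance. The constants
    are never evaluated: [eexists] leaves [K] unknown and these lemmas build it along the structure
    of the program, so that [K] precedes the field and the instance in the statements. *)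
Lemma cost_const (k : nat) (U : R) : 1 <= U -> k%:R <= k%:R * U.
Proof. by move=> U1; rewrite -[leLHS]mulr1 ler_wpM2l. Qed.

Lemma cost_add (k1 k2 : nat) (T1 T2 U : R) :
  T1 <= k1%:R * U -> T2 <= k2%:R * U -> T1 + T2 <= (k1 + k2)%:R * U.
Proof. by move=> H1 H2; rewrite natrD mulrDl lerD. Qed.

(** [N + 1 <= 2 N] accounts for the factor 2; [U] is the scale of the body and [V] that of the
    loop. *)
Lemma cost_for (k c N : nat) (T U V : R) : (0 < N)%N -> 1 <= U -> T <= k%:R * U ->
  N%:R * U <= V -> N.+1%:R * (T + c%:R) <= (2 * (k + c))%:R * V.
Proof.
move=> N0 U1 TU NV.
have TcU : T + c%:R <= (k + c)%:R * U by apply: cost_add TU (cost_const c U1).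
apply: (@le_trans _ _ (N.+1%:R * ((k + c)%:R * U))); first by rewrite ler_wpM2l.
apply: (@le_trans _ _ ((2 * (k + c))%:R * (N%:R * U))); last by rewrite ler_wpM2l.
have -> : (2 * (k + c))%:R * (N%:R * U) = (2 * N)%:R * ((k + c)%:R * U) by rewrite !natrM; ring.
rewrite ler_wpM2r ?mulr_ge0 ?(le_trans _ U1) // ler_nat; lia.
Qed.

Lemma cost_loop (k c N : nat) (V : R) : (0 < N)%N -> N%:R <= V ->
  N.+1%:R * (k%:R + c%:R) <= (2 * (k + c))%:R * V.
Proof. by move=> N0 NV; apply: (@cost_for _ _ _ _ 1) => //; rewrite mulr1. Qed.

Lemma cost_le (k : nat) (T U V : R) : T <= k%:R * U -> U <= V -> T <= k%:R * V.
Proof. by move=> TU UV; apply: le_trans TU _; rewrite ler_wpM2l. Qed.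

End Costs.

(** * Preprocessing *)

Definition RAbsMax (x : nat) (f : rexp) : cmd :=
  Seq (If (TRLe (RV x) f) (SetV x f) Skip)
      (If (TRLe (RV x) (RSub (RNat (INat 0)) f)) (SetV x (RSub (RNat (INat 0)) f)) Skip).

Definition MaxAbs (q : iexp) (x : nat) : cmd :=
  For 3 (IV 0) (For 4 (IV 0) (RAbsMax x (RLoad q (IV 3) (IV 4)))).

Definition Powers (x y : nat) (e1 e2 : iexp) : cmd :=
  Seq (Seq (SetV x (RNat (INat 1))) (SetV y (RNat (INat 0))))
    (For 3 e1 (For 4 e2
      (Seq (SetV x (RMul (RV x) (HPow 141)))
           (SetV y (RAdd (RMul (RV y) (HPow 141)) (HPow 140)))))).

Definition BitSize : cmd :=
  Seq (Seq (SetI 7 (INat 1)) (SetI 8 (INat 0)))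
    (While (TNot (TRLe (RDiv (RNat (IMul (INat 100) (IMul (IV 0) (IV 1))))
                             (RLoad (INat 2) (INat 0) (INat 0))) (RNat (IV 7))))
      (Seq (SetI 7 (IMul (INat 2) (IV 7))) (SetI 8 (IAdd (IV 8) (INat 1))))).

(** One rounded entry is appended to two packed numbers by Horner steps: to that of [A_i], whose
    digits run over the entries, and to that of the entry, whose digits run over [i]. *)
Definition PackEntry : cmd :=
  Seq (Floor (RMul (RAdd (RDiv (RLoad (IAdd (IV 2) (INat 3)) (IV 3) (IV 4)) (RV 1))
                         (RNat (INat 1))) (HPow 60)))
  (Seq (SetV 3 (RSub (RNat (IV 6)) (HPow 60)))
  (Seq (SetVec 16 2 (RAdd (RMul (RVec 16 2) (HPow 141)) (RV 3)))
       (SetMat 1 3 4 (RAdd (RMul (RMat 1 3 4) (HPow 141)) (RV 3))))).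

Definition Pack : cmd :=
  For 2 (IV 1) (Seq (SetVec 16 2 (RNat (INat 0))) (For 3 (IV 0) (For 4 (IV 0) PackEntry))).

(** The Kronecker delta: the sum of the two truncated differences is [|i - j|]. *)
Definition Delta (i j : nat) : iexp :=
  ISub (INat 1) (IAdd (ISub (IV i) (IV j)) (ISub (IV j) (IV i))).

Definition Preprocess : cmd :=
  Seq (Seq (SetV 2 (RNat (INat 0))) (MaxAbs (INat 0) 2))
  (Seq (Seq (SetV 1 (RNat (INat 0))) (For 2 (IV 1) (MaxAbs (IAdd (IV 2) (INat 3)) 1)))
  (Seq BitSize
  (Seq (Powers 5 6 (IV 0) (IV 0))
  (Seq (Powers 7 8 (IV 1) (INat 1))
  (Seq (For 2 (IV 1) (SetVec 17 2 (RDiv (RLoad (INat 1) (IV 2) (INat 0))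
         (RMul (RV 1) (RLoad (INat 2) (INat 0) (INat 1))))))
  (Seq (For 3 (IV 0) (For 4 (IV 0) (SetMat 1 3 4 (RNat (INat 0)))))
  (Seq Pack
  (Seq (For 2 (IV 1) (SetVec 11 2 (RNat (INat 0))))
  (Seq (For 2 (IV 1) (For 3 (IV 1) (SetMat 4 2 3 (RMul (HPow 10) (RNat (Delta 2 3))))))
       (SetI 9 (INat 0))))))))))).

Section PreprocessSpec.
Context {R : realType} (kap : nat -> R) (eig : @spectral_oracle R).
Implicit Types (s : @store R).
Notation wp := (wp kap eig).

(** The maximum is given by its universal property: being an upper bound normalizes the data, and
    minimality later compares it with the norms in the accuracy guarantee. *)
Definition is_max (v0 : R) (S : R -> Prop) (v : R) :=
  [/\ v0 <= v, forall x, S x -> `|x| <= v &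
      forall u, v0 <= u -> (forall x, S x -> `|x| <= u) -> v <= u].

Lemma is_max_add v0 (S S' : R -> Prop) v y : is_max v0 S v ->
  (forall x, S' x <-> S x \/ x = y) -> is_max v0 S' (Num.max v `|y|).
Proof.
move=> [v0v Sv vm] SS; split.
- by rewrite le_max v0v.
- by move=> x /SS[/Sv xv|->]; rewrite le_max ?xv ?lexx ?orbT.
move=> u v0u Su; rewrite ge_max vm => //= [|x Sx]; last by apply: Su; apply/SS; left.
by apply: Su; apply/SS; right.
Qed.

Lemma is_max_ext v0 (S S' : R -> Prop) v : is_max v0 S v -> (forall x, S x <-> S' x) -> is_max v0 S' v.
Proof.
move=> [h1 h2 h3] E; split=> // [x /E|u vu Su]; first exact: h2.
by apply: h3 => // x /E; exact: Su.
Qed.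

Lemma run_absmax x f s y : (forall s', frame [::] [:: x] [::] s s' -> reval s' f = y) ->
  frame [::] [:: x] [::] s (run (RAbsMax x f) s) /\
  mats (run (RAbsMax x f) s) 2 x 0%N = Num.max (mats s 2 x 0%N) `|y|.
Proof.
move=> fy; rewrite /RAbsMax /=; set s1 := (if _ then _ else s).
have [fr1 E1] : frame [::] [:: x] [::] s s1 /\ mats s1 2 x 0%N = Num.max (mats s 2 x 0%N) y.
  rewrite /s1 (fy s) //; case: (lerP (mats s 2 x 0%N) y) => H; split; try by frm.
    by rewrite /= /upd !eqxx.
rewrite (fy s1) // mulr0n sub0r E1; case: lerP => H; split; try by frm.
- rewrite /= /upd !eqxx; have := H; rewrite ge_max => /andP[H1 H2].
  have y0 : y <= 0 by lra.
  by rewrite ler0_norm // max_r.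
- move: H; rewrite lt_max E1 => /orP[]H.
    have [y0|y0] := lerP 0 y; first by rewrite ger0_norm.
    by rewrite ltr0_norm // !max_l // ?ltW //; lra.
  by rewrite ger0_norm //; lra.
Qed.

Lemma wp_maxabs q (Q x : nat) s (n : nat) S : (0 < n)%N -> ints s 0 = n -> Q != 2%N ->
  (forall s', frame [:: 3; 4] [:: x] [::] s s' -> ieval s' q = Q) ->
  is_max 0 S (mats s 2 x 0%N) ->
  wp (MaxAbs q x) s ((2 * (2 * (lcost (RAbsMax x (RLoad q (IV 3) (IV 4))) + 16) + 16))%:R * (n * n)%:R)
    (fun s' => frame [:: 3; 4] [:: x] [::] s s' /\
      is_max 0 (fun y => S y \/ exists i j, [/\ (i < n)%N, (j < n)%N & y = mats s Q i j])
        (mats s' 2 x 0%N)).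
Proof.
move=> n0 s0 Q2 qQ S0.
have eN s' : frame [:: 3; 4] [:: x] [::] s s' -> ieval s' (IV 0) = n.
  by move=> [fI _ _]; rewrite /= fI // s0.
apply: wp_le (wp_loop2 (T := (lcost (RAbsMax x (RLoad q (IV 3) (IV 4))))%:R)
  (P := fun k M => is_max 0 (fun y => S y \/ exists i j, [/\ (j < n)%N, (i * n + j < k)%N & y = mats s Q i j])
   (M 2%N x 0%N)) _ _ _ eN eN _ _) _ _ => //.
- apply: is_max_ext S0 _ => y; split; first by left.
  by move=> [//|[i [j []]]].
- move=> i j s' iN jN xi yj fr p; apply: wp_run => //.
  have [|fr' E] := @run_absmax x (RLoad q (IV 3) (IV 4)) s' (mats s Q i j).
    move=> s'' fr'; rewrite /= qQ; last exact: frame_trans fr (frame_cons _ (frame_cons _ fr')).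
    have [fI _ fQ] := fr'; rewrite !fI // xi yj fQ //.
    by have [_ _ ->] := fr.
  split=> //; rewrite E; apply: is_max_add p _ => y; split.
    move=> [Sy|[k [l [ln]]]]; first by left; left.
    rewrite ltnS leq_eqVlt flat_index // => /orP[/andP[/eqP-> /eqP->] ->|H E']; first by right.
    by left; right; exists k, l.
  move=> [[Sy|[k [l [ln H E']]]]|->]; first by left.
    by right; exists k, l; split=> //; exact: leqW.
  by right; exists i, j; split.
- apply: (@cost_for _ _ _ _ _ n%:R) => //.
  + by rewrite ler1n.
  + exact: cost_loop.
  + by rewrite natrM.
move=> s' [fr p]; split=> //; apply: is_max_ext p _ => y.
split=> -[Sy|[i [j [h1 h2 h3]]]]; [by left| |by left|]; right; exists i, j; split=> //.
- by rewrite -(ltn_pmul2r n0); apply: leq_ltn_trans h2; rewrite leq_addr.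
- exact: flat_lt.
Qed.

Lemma wp_powers (x y : nat) e1 e2 s (n1 n2 sb : nat) : (0 < n1)%N -> (0 < n2)%N -> scaled sb s -> x != y ->
  (forall s', frame [:: 3; 4] [:: x; y] [::] s s' -> ieval s' e1 = n1) ->
  (forall s', frame [:: 3; 4] [:: x; y] [::] s s' -> ieval s' e2 = n2) ->
  let b : R := (2 ^ sb)%:R in
  wp (Powers x y e1 e2) s
    ((lcost (Seq (SetV x (RNat (INat 1))) (SetV y (RNat (INat 0)))) +
      2 * (2 * (lcost (Seq (SetV x (RMul (RV x) (HPow 141)))
           (SetV y (RAdd (RMul (RV y) (HPow 141)) (HPow 140)))) + (icost e2 + 14)) + (icost e1 + 14)))%:R
       * (n1 * n2)%:R)
    (fun s' => [/\ frame [:: 3; 4] [:: x; y] [::] s s',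
      mats s' 2 x 0%N = (b ^+ 141) ^+ (n1 * n2) &
      mats s' 2 y 0%N = digits_value (b ^+ 141) (fun => b ^+ 140) (n1 * n2)]).
Proof.
move=> n10 n20 sc xy e1N e2N b.
have nn1 : 1 <= (n1 * n2)%:R :> R by rewrite ler1n muln_gt0 n10.
have yx : y != x by rewrite eq_sym.
apply: wp_cost.
- apply: wp_seq; apply: wp_run => //.
  set s1 := run _ s.
  have fr1 : frame [:: 3; 4] [:: x; y] [::] s s1 by rewrite /s1; frm.
  apply: wp_le (wp_loop2 (n1 := n1) (n := n2) (Is := [::]) (Rs := [:: x; y]) (Qs := [::])
    (T := (lcost (Seq (SetV x (RMul (RV x) (HPow 141)))
           (SetV y (RAdd (RMul (RV y) (HPow 141)) (HPow 140)))))%:R)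
    (P := fun k M => M 2%N x 0%N = (b ^+ 141) ^+ k /\
       M 2%N y 0%N = digits_value (b ^+ 141) (fun => b ^+ 140) k) _ _ _ _ _ _ _) (lexx _) _ => //.
  + by move=> s' fr; apply: e1N; exact: frame_trans fr1 fr.
  + by move=> s' fr; apply: e2N; exact: frame_trans fr1 fr.
  + by rewrite /s1 /= /upd /= !eqxx (negPf xy).
  + move=> i j s' iN jN xi yj fr [p1 p2]; apply: wp_run => //.
    have s7 : ints s' 7 = (2 ^ sb)%N by have [fI _ _] := fr; rewrite fI //; have [fI' _ _] := fr1; rewrite fI' // sc.2.
    split; first by frm.
    rewrite /= /upd /= !eqxx (negPf xy) (negPf yx) !ieval_ipow /= s7 p1 p2 !natrX -natrX -/b; split=> //; by rewrite [RHS]exprSr.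
  by move=> s' [fr [p1 p2]]; split=> //; exact: frame_trans fr1 fr.
- apply: cost_add; first exact: cost_const.
  apply: (@cost_for _ _ _ _ _ n2%:R) => //.
  + by rewrite ler1n.
  + exact: cost_loop.
  by rewrite natrM.
Qed.

Lemma wp_bitsize s (n m : nat) (eps : R) (sb : nat) : ints s 0 = n -> ints s 1 = m -> mats s 2 0%N 0%N = eps ->
  (100 * (n * m))%:R / eps <= (2 ^ sb)%:R ->
  (forall k, (k < sb)%N -> (2 ^ k)%:R < (100 * (n * m))%:R / eps) ->
  wp BitSize s (3%:R + 3%:R + sb.+1%:R * (200%:R + 0%:R)) (fun s' => frame [:: 7; 8] [::] [::] s s' /\ scaled sb s').
Proof.
move=> s0 s1 seps sbP sbmin.
apply: wp_seq; apply: wp_le (wp_run kap eig _ _) _ _; [done| |by rewrite -natrD ler_nat|]; last by move=> s'; exact.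
set t := run _ s.
pose I k s' := [/\ frame [:: 7; 8] [::] [::] s s', ints s' 7 = (2 ^ k)%N, ints s' 8 = k & (k <= sb)%N].
have tE k s' : I k s' -> teval s' (TNot (TRLe (RDiv (RNat (IMul (INat 100) (IMul (IV 0) (IV 1))))
      (RLoad (INat 2) (INat 0) (INat 0))) (RNat (IV 7)))) = ~~ ((100 * (n * m))%:R / eps <= (2 ^ k)%:R).
  by move=> [[fI fR _] s7 _ _]; rewrite /= (fI 0%N) // (fI 1%N) // fR // s7 s0 s1 seps.
apply: wp_le (wp_while (N := sb) (T := 100%:R) (I := I) _ _ _) _ _ => //.
- by split=> //; rewrite /t; frm.
- move=> k s' Ik; rewrite (tE _ _ Ik) => H; have [fr s7 s8 ksb] := Ik.
  have lt : (k < sb)%N.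
    by rewrite ltn_neqAle ksb andbT; apply/eqP => E; move: H; rewrite E sbP.
  split=> //; apply: wp_le (wp_run kap eig (Q := I k.+1) _ _) _ _ => //; last by rewrite ler_nat.
  split=> //=; first by frm.
  + by rewrite /upd /= s7 expnS.
  + by rewrite /upd /= s8 addn1.
- by rewrite addr0 ler_wpM2l // -natrD ler_nat.
move=> s' [ft [k Ik]]; rewrite (tE _ _ Ik) negbK in ft; have [fr s7 s8 ksb] := Ik.
split=> //; have -> : sb = k.
  apply/eqP; rewrite eqn_leq ksb andbT leqNgt; apply/negP => /sbmin.
  by rewrite ltNge ft.
by split.
Qed.

End PreprocessSpec.

Section ScaledEntries.
Context {R : realType} (kap : nat -> R) (eig : @spectral_oracle R).
Implicit Types (s : @store R).
Notation wp := (wp kap eig).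
Context (n m sb : nat) (n0 : (0 < n)%N) (m0 : (0 < m)%N) (sb0 : (0 < sb)%N).
Let h : R := (2 ^ sb)%:R.

Lemma pow_ge2 : 2 <= h.
Proof. by rewrite ler_nat -{1}(expn1 2) leq_pexp2l. Qed.

Let hX k : 0 < h ^+ k. Proof. by rewrite exprn_gt0 // (lt_le_trans _ pow_ge2). Qed.

Lemma lt_powS k : 2 * h ^+ k <= h ^+ k.+1.
Proof. by rewrite exprS ler_pM2r // pow_ge2. Qed.

(* Entry k, in row-major order, of A_i / a, rounded like [round_scaled] below. *)
Definition scaled_entry (a : R) (M : nat -> nat -> nat -> R) (i k : nat) : R :=
  (Num.truncn ((M (i + 3)%N (k %/ n)%N (k %% n)%N / a + 1) * h ^+ 60))%:R - h ^+ 60.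

Lemma floor_cost (k c : nat) : k%:R + (c * sb)%:R <= (k + c)%:R * sb%:R :> R.
Proof. by rewrite (natrM _ c sb) natrD mulrDl lerD2r -[leLHS]mulr1 ler_wpM2l // ler1n. Qed.

End ScaledEntries.

Lemma wp_pack : exists K : nat, forall (R : realType) (kap : nat -> R) (eig : @spectral_oracle R)
  (n m sb : nat) (n0 : (0 < n)%N) (m0 : (0 < m)%N) (sb0 : (0 < sb)%N) (s : @store R) a,
  let h : R := (2 ^ sb)%:R in
  scaled sb s -> ints s 0 = n -> ints s 1 = m -> mats s 2 1%N 0%N = a ->
  (forall i p q, (i < m)%N -> (p < n)%N -> (q < n)%N -> `|mats s (i + 3) p q / a| <= 1) ->
  (forall p q, (p < n)%N -> (q < n)%N -> mats s 1 p q = 0) ->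
  wp kap eig Pack s (K%:R * (m * (n * n * sb))%:R)
  (fun s' => [/\ frame [:: 2; 3; 4; 5; 6] [:: 3; 4; 16] [:: 1] s s',
     forall i, (i < m)%N -> mats s' 2 16%N i =
       digits_value (h ^+ 141) (scaled_entry n sb a (mats s) i) (n * n) &
     forall p q, (p < n)%N -> (q < n)%N -> mats s' 1 p q =
       digits_value (h ^+ 141) (fun i => scaled_entry n sb a (mats s) i (p * n + q)) m]).
Proof.
eexists => R kap eig n m sb n0 m0 sb0 s a h sc s0 s1 sa ea z1.
pose az := scaled_entry n sb a (mats s); set B := h ^+ 141.
have U1 : 1 <= (n * n * sb)%:R :> R by rewrite ler1n !muln_gt0 n0.
have h2 : 2 <= h := pow_ge2 sb0.
have hX k : 0 < h ^+ k by rewrite exprn_gt0 // (lt_le_trans _ h2).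
have hE k : ((2 ^ sb) ^ k)%:R = h ^+ k :> R by rewrite natrX.
have eN Rs Qs s' : frame [:: 2; 3; 4; 5; 6] Rs Qs s s' -> ieval s' (IV 0) = n.
  by move=> [fI _ _]; rewrite /= fI.
have eM Rs Qs s' : frame [:: 2; 3; 4; 5; 6] Rs Qs s s' -> ieval s' (IV 1) = m.
  by move=> [fI _ _]; rewrite /= fI.
pose P i (M : nat -> nat -> nat -> R) :=
  (forall k, (k < i)%N -> M 2%N 16%N k = digits_value B (az k) (n * n)) /\
  (forall p q, (p < n)%N -> (q < n)%N -> M 1%N p q = digits_value B (fun k => az k (p * n + q)%N) i).
apply: wp_cost.
  apply: wp_le (wp_loop (P := P) (N := m) (Is := [:: 3; 4; 5; 6]) (Rs := [:: 3; 4; 16]) (Qs := [:: 1%N]) _ _ _ _ _) (lexx _) _;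
    [| | | | | ]; last first.
  - by move=> s' [fr [p1 p2]]; split; [exact: fr|exact: p1|exact: p2].
  - move=> i s' im xi fr [p1 p2]; apply: wp_seq; apply: wp_run => //; set s2 := run _ s'.
    have fr2 : frame [:: 3; 4; 5; 6] [:: 3; 4; 16] [:: 1%N] s' s2 by rewrite /s2; frm.
    have fr02 : frame [:: 2; 3; 4; 5; 6] [:: 3; 4; 16] [:: 1%N] s s2 := frame_trans fr (frame_cons 2 fr2).
    (* While [A_i] is being packed, the entries before position [k] have already received digit [i]
       and the later ones have not. *)
    pose P' k (M : nat -> nat -> nat -> R) := [/\
       forall l, (l < i)%N -> M 2%N 16%N l = digits_value B (az l) (n * n),
       M 2%N 16%N i = digits_value B (az i) k &
       forall p q, (p < n)%N -> (q < n)%N -> M 1%N p q =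
         digits_value B (fun l => az l (p * n + q)%N) (if (p * n + q < k)%N then i.+1 else i)].
    apply: wp_le (wp_loop2 (P := P') (n1 := n) (n := n) (Is := [:: 5; 6]) (Rs := [:: 3; 4; 16]) (Qs := [:: 1%N]) _ _ _ _ _ _ _) (lexx _) _;
      [| | | | | | | ]; last first.
    + move=> s3 [fr3 [q1 q2 q3]]; split; first exact: frame_trans fr2 fr3.
      split=> [k|p q pn qn]; first by rewrite ltnS leq_eqVlt => /predU1P[->//|]; exact: q1.
      by rewrite q3 // ifT // flat_lt.
    + move=> p q s3 pn qn xp yq fr3 [q1 q2 q3].
      have fr03 : frame [:: 2; 3; 4; 5; 6] [:: 3; 4; 16] [:: 1%N] s s3 := frame_trans fr02 (frame_cons 2 fr3).
      have [fI fR fQ] := fr03.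
      have xi3 : ints s3 2 = i by have [fI3 _ _] := fr3; rewrite fI3 // /s2 /=.
      have sc3 : scaled sb s3 by apply: scaled_frame fr03 sc.
      pose v := (mats s (i + 3) p q / a + 1) * h ^+ 60.
      apply: wp_bind (wp_floor kap eig sb0 (v := v) sc3 _ _) _.
      * rewrite /= ieval_ipow /= sc3.2 natrX xp yq xi3 fR // sa fQ //; last by rewrite addn3.
        by rewrite addn3.
      * have := ea i p q im pn qn; rewrite ler_norml => /andP[l1 l2]; rewrite /v mulr_ge0 ?(ltW (hX _)) //=; last lra.
        apply: (@le_lt_trans _ _ (2 * h ^+ 60)); first by rewrite ler_pM2r //; lra.
        apply: (@le_lt_trans _ _ (h ^+ 61)); first exact: lt_powS.
        by rewrite ltr_eXn2l // (lt_le_trans _ h2) // ltr1n.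
      move=> s4 [fr4 d4]; apply: wp_run => //.
      have fr4' : frame [:: 5; 6] [:: 3; 4; 16] [:: 1%N] s3 s4.
        by apply: frame_sub fr4 => // y; rewrite !inE => /orP[] ->; rewrite ?orbT.
      split; first by frm.
      have [gI gR gQ] := fr4.
      have i7 : ints s4 7 = (2 ^ sb)%N by rewrite gI // sc3.2.
      have zE : (ints s4 6)%:R - h ^+ 60 = az i (p * n + q)%N.
        by rewrite d4 /az /scaled_entry divnMDl // divn_small // modnMDl modn_small // addn0.
      rewrite /P' /= /upd /= !ieval_ipow /= i7 (gI 2%N) // xi3 (gI 3%N) // (gI 4%N) // xp yq !eqxx /=.
      rewrite !hE -/B zE (gR 16%N) // gQ // q2; split=> //.
        by move=> l li; case: eqP => [E|_]; [rewrite E ltnn in li|exact: q1].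
      move=> p' q' p'n q'n; rewrite ltnS leq_eqVlt flat_index //.
      case: (eqVneq p' p) => [->|pp] /=; last first.
        exact: q3.
      case: (eqVneq q' q) => [->|qq] /=.
        by rewrite q3 // ltnn.
      exact: q3.
    + split.
      * by move=> l li; rewrite /s2 /= /upd /= xi; case: eqP => [E|_]; [rewrite E ltnn in li|exact: p1].
      * by rewrite /s2 /= /upd /= xi eqxx.
      * by move=> p q pn qn; rewrite ltn0; exact: p2.
    + move=> s3 fr3; apply: eN; exact: frame_trans fr02 (frame_cons 2 fr3).
    + move=> s3 fr3; apply: eN; exact: frame_trans fr02 (frame_cons 2 fr3).
    + by [].
    + by [].
    + by rewrite -!natrD ler0n.
  - by split=> // p q pn qn; rewrite z1.
  - by move=> s'; exact: eM.
  - by [].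
  - by rewrite -!(natrD, natrM) ler0n.
apply: (@cost_for _ _ _ _ _ (n * n * sb)%:R) => //; last by rewrite -natrM.
apply: cost_add; first exact: cost_const.
apply: (@cost_for _ _ _ _ _ (n * sb)%:R) => //; last by rewrite -natrM mulnA.
  by rewrite ler1n muln_gt0 n0.
apply: (@cost_for _ _ _ _ _ sb%:R) => //; last by rewrite -natrM.
  by rewrite ler1n.
apply: cost_add; first exact: floor_cost.
by apply: cost_const; rewrite ler1n.
Unshelve. all: try exact: 0%N.
Qed.

Section Setup.
Context {R : realType}.
Implicit Types (s : @store R).

(* The contents of the memory that the main loop reads; s0 is the initial store. *)
Record setup (n m sb : nat) (a c : R) s0 s : Prop := Setup {
  setup_n : ints s 0 = n;
  setup_m : ints s 1 = m;
  setup_scaled : scaled sb s;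
  setup_C : mats s 0 = mats s0 0;
  setup_c : mats s 2 2%N 0%N = c;
  setup_rho : mats s 2 0%N = mats s0 2 0%N;
  setup_b : forall j, (j < m)%N -> mats s 2 17%N j = mats s0 1 j 0%N / (a * mats s0 2 0%N 1%N);
  setup_T1 : mats s 2 5%N 0%N = ((2 ^ sb)%:R ^+ 141) ^+ (n * n);
  setup_O1 : mats s 2 6%N 0%N = digits_value ((2 ^ sb)%:R ^+ 141) (fun => (2 ^ sb)%:R ^+ 140) (n * n);
  setup_T2 : mats s 2 7%N 0%N = ((2 ^ sb)%:R ^+ 141) ^+ m;
  setup_O2 : mats s 2 8%N 0%N = digits_value ((2 ^ sb)%:R ^+ 141) (fun => (2 ^ sb)%:R ^+ 140) m;
  setup_A : forall i, (i < m)%N -> mats s 2 16%N i =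
     digits_value ((2 ^ sb)%:R ^+ 141) (scaled_entry n sb a (mats s0) i) (n * n);
  setup_A' : forall p q, (p < n)%N -> (q < n)%N -> mats s 1 p q =
     digits_value ((2 ^ sb)%:R ^+ 141) (fun i => scaled_entry n sb a (mats s0) i (p * n + q)) m
}.

(** The lists contain what the main loop writes before its final output; everything that [setup]
    records lies outside them. *)
Lemma setup_frame n m sb a c s0 s s' Is Rs Qs :
  {subset Is <= [:: 2; 3; 4; 5; 6; 9]} ->
  {subset Rs <= [:: 3; 4; 9; 10; 11; 12; 13; 14; 15]} -> {subset Qs <= [:: 3; 4; 5; 6; 7]} ->
  frame Is Rs Qs s s' -> setup n m sb a c s0 s -> setup n m sb a c s0 s'.
Proof.
move=> hI hR hQ fr; have [fI fR fQ] := frame_sub hI hR hQ fr.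
case=> h1 h2 h3 h4 h5 h6 h7 h8 h9 h10 h11 h12 h13.
split; rewrite ?fI ?fR ?fQ //.
by have [s8 s7] := h3; split; rewrite fI.
Qed.

End Setup.

Definition entries_of {R : realType} (k n : nat) (M : nat -> nat -> nat -> R) (y : R) :=
  exists i p q, [/\ (i < k)%N, (p < n)%N, (q < n)%N & y = M (i + 3)%N p q].

Lemma wp_preprocess : exists K : nat, forall (R : realType) (kap : nat -> R) (eig : @spectral_oracle R)
  (n m sb : nat) (n0 : (0 < n)%N) (m0 : (0 < m)%N) (sb0 : (0 < sb)%N) (s0 : @store R),
  let h : R := (2 ^ sb)%:R in
  ints s0 0 = n -> ints s0 1 = m ->
  (100 * (n * m))%:R / mats s0 2 0%N 0%N <= h ->
  (forall k, (k < sb)%N -> (2 ^ k)%:R < (100 * (n * m))%:R / mats s0 2 0%N 0%N) ->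
  wp kap eig Preprocess s0 (K%:R * ((m * m + m * (n * n)) * sb)%:R)
  (fun s => exists a c, [/\
     is_max 0 (fun y => exists p q, [/\ (p < n)%N, (q < n)%N & y = mats s0 0 p q]) c,
     is_max 0 (entries_of m n (mats s0)) a,
     setup n m sb a c s0 s /\ ints s 9 = 0%N,
     forall j, (j < m)%N -> mats s 2 11%N j = 0 &
     forall i j, (i < m)%N -> (j < m)%N -> mats s 4 i j = h ^+ 10 * (i == j)%:R]).
Proof.
have [KP wp_pack] := wp_pack.
eexists => R kap eig n m sb n0 m0 sb0 s0 h s00 s01 sbP sbmin.
have V1 : 1 <= ((m * m + m * (n * n)) * sb)%:R :> R.
  by rewrite ler1n !muln_gt0 addn_gt0 !muln_gt0 m0.
have leV k : (k <= (m * m + m * (n * n)) * sb)%N -> k%:R <= ((m * m + m * (n * n)) * sb)%:R :> R.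
  by rewrite ler_nat.
have fr01 : forall (Is Rs Qs : seq nat) (s s' : @store R), frame Is Rs Qs s s' ->
   0%N \notin Is -> 1%N \notin Is -> ints s 0 = n -> ints s 1 = m -> ints s' 0 = n /\ ints s' 1 = m.
  by move=> Is Rs Qs s s' [fI _ _] i0 i1 e0 e1; rewrite !fI.
apply: wp_cost.
  apply: wp_seq; apply: wp_seq; apply: wp_run => //; set s1 := run _ s0.
  have fr1 : frame [::] [:: 2] [::] s0 s1 by rewrite /s1; frm.
  apply: wp_le (wp_maxabs kap eig (Q := 0%N) (S := fun=> False) n0 _ _ _ _) (lexx _) _ => //.
  move=> s2 [fr2 mC].
  have [_ _ fQ1] := fr1; rewrite fQ1 // in mC.
  have fr02 : frame [:: 3; 4] [:: 2] [::] s0 s2 by apply: (frame_comp fr1 fr2).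
  have [s20 s21] := fr01 _ _ _ _ _ fr02 isT isT s00 s01.
  apply: wp_seq; apply: wp_seq; apply: wp_run => //; set s3 := run _ s2.
  have fr3 : frame [::] [:: 1] [::] s2 s3 by rewrite /s3; frm.
  have fr03 : frame [:: 2; 3; 4] [:: 1; 2] [::] s0 s3.
    by apply: (frame_comp fr02 fr3).
  apply: wp_le (wp_loop (N := m) (Is := [:: 3; 4]) (Rs := [:: 1%N]) (Qs := [::])
     (P := fun i M => is_max 0 (entries_of i n (mats s0)) (M 2%N 1%N 0%N)) _ _ _ _ _) (lexx _) _;
     [| | | | | ]; last first.
  move=> s4 [fr4 mA].
  have fr04 : frame [:: 2; 3; 4] [:: 1; 2] [::] s0 s4.
    by apply: (frame_comp fr03 fr4).
  have [s40 s41] := fr01 _ _ _ _ _ fr04 isT isT s00 s01.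
  have [_ fR04 fQ04] := fr04.
  have c4 : mats s4 2 2%N 0%N = mats s2 2 2%N 0%N.
    have [_ fR4 _] := fr4; have [_ fR3 _] := fr3; by rewrite fR4 // fR3.
  apply: wp_bind (wp_bitsize kap eig (sb := sb) s40 s41 erefl _ _) _;
    [by rewrite fR04|by move=> k; rewrite fR04 //; exact: sbmin|].
  move=> s5 [fr5 sc5].
  have fr05 : frame [:: 2; 3; 4; 7; 8] [:: 1; 2] [::] s0 s5.
    by apply: (frame_comp fr04 fr5).
  have [s50 s51] := fr01 _ _ _ _ _ fr05 isT isT s00 s01.
  apply: wp_bind (wp_powers kap eig n0 n0 sc5 _ _ _) _; [by []| | |].
    by move=> s' [fI _ _] /=; rewrite fI.
    by move=> s' [fI _ _] /=; rewrite fI.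
  move=> s6 [fr6 T1 O1].
  have sc6 : scaled sb s6 by apply: scaled_frame fr6 sc5.
  have [s60 s61] := fr01 _ _ _ _ _ fr6 isT isT s50 s51.
  apply: wp_bind (wp_powers kap eig m0 (n2 := 1) _ sc6 _ _ _) _; [by []|by []| |by []|].
    by move=> s' [fI _ _] /=; rewrite fI.
  rewrite muln1 => s7 [fr7 T2 O2].
  have sc7 : scaled sb s7 by apply: scaled_frame fr7 sc6.
  have [s70 s71] := fr01 _ _ _ _ _ fr7 isT isT s60 s61.
  have fr07 : frame [:: 2; 3; 4; 7; 8] [:: 1; 2; 5; 6; 7; 8] [::] s0 s7.
    have f67 : frame [:: 3; 4] [:: 5; 6; 7; 8] [::] s5 s7 by apply: (frame_comp fr6 fr7).
    by apply: (frame_comp fr05 f67).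
  have [_ fR7 _] := fr7; have [_ fR6 _] := fr6; have [_ fR5 _] := fr5; have [_ fR07 fQ07] := fr07.
  pose a := mats s4 2 1%N 0%N; pose c := mats s2 2 2%N 0%N.
  have a7 : mats s7 2 1%N 0%N = a by rewrite fR7 // fR6 // fR5.
  have c7 : mats s7 2 2%N 0%N = c by rewrite fR7 // fR6 // fR5 // c4.
  apply: wp_bind (wp_vec kap eig (N := m)
    (F := fun j => mats s0 1 j 0%N / (a * mats s0 2 0%N 1%N)) _ _) _.
    by move=> s' [fI _ _] /=; rewrite fI.
    by move=> s' j jm [fI fR fQ] xj _ /=; rewrite !fR // a7 fR07 // fQ // fQ07 // xj.
  move=> s8 [fr8 b8].
  have [_ fR8 _] := fr8.
  have sc8 : scaled sb s8 by apply: scaled_frame fr8 sc7.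
  have [s80 s81] := fr01 _ _ _ _ _ fr8 isT isT s70 s71.
  apply: wp_bind (wp_mat kap eig (N1 := n) (N2 := n) (F := fun _ _ => 0) _ _ _ _ _) _; [by []|by []| | |by []|].
    by move=> s' [fI _ _] /=; rewrite fI.
    by move=> s' [fI _ _] /=; rewrite fI.
  move=> s9 [fr9 z9].
  have sc9 : scaled sb s9 by apply: scaled_frame fr9 sc8.
  have [s90 s91] := fr01 _ _ _ _ _ fr9 isT isT s80 s81.
  have [_ fR9 fQ9] := fr9.
  have fr09 : frame [:: 2; 3; 4; 7; 8] [:: 1; 2; 5; 6; 7; 8; 17] [:: 1] s0 s9.
    have f89 : frame [:: 2; 3; 4] [:: 17] [:: 1] s7 s9 by apply: (frame_comp fr8 fr9).
    by apply: (frame_comp fr07 f89).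
  have [_ fR09 fQ09] := fr09.
  have a9 : mats s9 2 1%N 0%N = a by rewrite fR9 // fR8.
  have A1 i p q : (i < m)%N -> (p < n)%N -> (q < n)%N -> `|mats s9 (i + 3) p q / a| <= 1.
    move=> im pn qn; rewrite fQ09; [|by rewrite addn3|by rewrite addn3].
    have [a0 ub _] := mA; have := ub (mats s0 (i + 3)%N p q) (ex_intro _ i (ex_intro _ p (ex_intro _ q (And4 im pn qn erefl)))).
    rewrite -/a => H; rewrite normrM normfV (ger0_norm a0).
    (* If all entries of the [A_i] vanish, then [a = 0] and division by it yields 0. *)
    have [a00|an0] := eqVneq (mats s4 2 1%N 0%N) 0; first by rewrite /a a00 invr0 mulr0.
    by rewrite ler_pdivrMr ?mul1r // lt_def an0.
  apply: wp_bind (wp_pack _ kap eig n m sb n0 m0 sb0 s9 a sc9 s90 s91 a9 A1 z9) _.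
  move=> s10 [fr10 pA pA'].
  have [_ fR10 fQ10] := fr10.
  have sc10 : scaled sb s10 by apply: scaled_frame fr10 sc9.
  have [s100 s101] := fr01 _ _ _ _ _ fr10 isT isT s90 s91.
  apply: wp_bind (wp_vec kap eig (N := m) (F := fun=> 0) _ _) _; [ | by []|].
    by move=> s' [fI _ _] /=; rewrite fI.
  move=> s11 [fr11 c11].
  have [_ fR11 fQ11] := fr11.
  have sc11 : scaled sb s11 by apply: scaled_frame fr11 sc10.
  have [s110 s111] := fr01 _ _ _ _ _ fr11 isT isT s100 s101.
  apply: wp_bind (wp_mat kap eig (N1 := m) (N2 := m) (F := fun i j => h ^+ 10 * (i == j)%:R) _ _ _ _ _) _; [by []|by []| | | |].
    by move=> s' [fI _ _] /=; rewrite fI.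
    by move=> s' [fI _ _] /=; rewrite fI.
    move=> s' i j im jm fr xi yj _; have [s8' s7'] : scaled sb s' by apply: scaled_frame fr sc11.
    rewrite /= ieval_ipow /= s7' natrX xi yj -/h; congr (_ * _%:R).
    by case: eqP => [->|]; lia.
  move=> s12 [fr12 B12].
  have [_ fR12 fQ12] := fr12.
  have sc12 : scaled sb s12 by apply: scaled_frame fr12 sc11.
  have [s120 s121] := fr01 _ _ _ _ _ fr12 isT isT s110 s111.
  apply: wp_run => //; exists a, c; split.
  - by apply: is_max_ext mC _ => y; split=> [[|//]|]; [|right].
  - exact: mA.
  - split=> //; split=> //=.
    + by rewrite fQ12 // fQ11 // fQ10 // fQ09.
    + by rewrite fR12 // fR11 // fR10 // fR9 // fR8.
    + by rewrite fR12 // fR11 // fR10 // fR09.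
    + by move=> j jm; rewrite fR12 // fR11 // fR10 // fR9 // b8.
    + by rewrite fR12 // fR11 // fR10 // fR9 // fR8 // fR7.
    + by rewrite fR12 // fR11 // fR10 // fR9 // fR8 // fR7.
    + by rewrite fR12 // fR11 // fR10 // fR9 // fR8.
    + by rewrite fR12 // fR11 // fR10 // fR9 // fR8.
    + move=> i im; rewrite fR12 // fR11 // pA //; apply: eq_digits_value => k kn.
      by rewrite /scaled_entry fQ09 // addn3.
    + move=> p q pn qn; rewrite fQ12 // fQ11 // pA' //; apply: eq_digits_value => k kn.
      by rewrite /scaled_entry fQ09 // addn3.
  - by move=> j jm /=; rewrite fR12 // c11.
  - by move=> i j im jm /=; rewrite B12.
  - move=> i s' im xi fr' p.
    have fr0' : frame [:: 2; 3; 4] [:: 1; 2] [::] s0 s'.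
      by apply: (frame_comp fr03 fr').
    have [_ _ fQ'] := fr0'.
    have [s'0 _] := fr01 _ _ _ _ _ fr0' isT isT s00 s01.
    apply: wp_le (wp_maxabs kap eig (Q := (i + 3)%N) n0 s'0 _ _ p) (lexx _) _; [by rewrite addn3| |].
      by move=> s'' [fI _ _] /=; rewrite fI // xi.
    move=> s'' [fr'' mx]; split=> //; apply: is_max_ext mx _ => y; split.
      move=> [[k [p' [q' [ki pn qn ->]]]]|[p' [q' [pn qn ->]]]].
        by exists k, p', q'; split=> //; exact: leqW.
      by exists i, p', q'; split=> //; rewrite fQ' // addn3.
    move=> [k [p' [q' [ki pn qn ->]]]]; move: ki; rewrite ltnS leq_eqVlt => /predU1P[->|ki].
      by right; exists p', q'; split=> //; rewrite fQ' // addn3.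
    by left; exists k, p', q'.
  - by split=> // x [k [p [q []]]].
  - by move=> s' [fI _ _]; rewrite /= fI // s21.
  - by [].
  - by rewrite mulr_ge0.
have mn1 : (m * (n * n) <= (m * m + m * (n * n)) * sb)%N by nia.
have nn1 : (n * n <= (m * m + m * (n * n)) * sb)%N by nia.
have n1 : (n <= (m * m + m * (n * n)) * sb)%N by nia.
have m1 : (m <= (m * m + m * (n * n)) * sb)%N by nia.
have mm1 : (m * m <= (m * m + m * (n * n)) * sb)%N by nia.
have sb1 : (sb <= (m * m + m * (n * n)) * sb)%N by nia.
have mns1 : (m * (n * n * sb) <= (m * m + m * (n * n)) * sb)%N by nia.
have [R1 R2] : 1 <= 1 :> R /\ forall k : nat, (0 < k)%N -> 1 <= k%:R :> R.
  by split=> // k k0; rewrite ler1n.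
apply: cost_add.
  apply: cost_add; first exact: cost_const.
  by apply: cost_le (lexx _) (leV _ nn1).
apply: cost_add.
  apply: cost_add; first exact: cost_const.
  apply: (@cost_for _ _ _ _ _ (n * n)%:R) => //; last by rewrite -natrM leV.
  by rewrite R2 // muln_gt0 n0.
apply: cost_add.
  apply: cost_add; first by rewrite -natrD; exact: cost_const.
  by apply: cost_loop; rewrite ?leV.
apply: cost_add; first exact: cost_le (lexx _) (leV _ nn1).
apply: cost_add; first by rewrite muln1; exact: cost_le (lexx _) (leV _ m1).
apply: cost_add.
  by apply: cost_loop; rewrite ?leV.
apply: cost_add.
  apply: (@cost_for _ _ _ _ _ n%:R) => //; [exact: R2| |by rewrite -natrM leV].
  exact: cost_loop.
apply: cost_add; first exact: cost_le (lexx _) (leV _ mns1).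
apply: cost_add.
  by apply: cost_loop; rewrite ?leV.
apply: cost_add.
  apply: (@cost_for _ _ _ _ _ m%:R) => //; [exact: R2| |by rewrite -natrM leV].
  exact: cost_loop.
exact: cost_const.
Qed.

(** * The gradient *)

Definition RoundCenterBody : cmd :=
  Seq (Floor (RMul (RAdd (RVec 11 2) (HPow 10)) (HPow 60)))
    (Seq (SetVec 12 2 (RSub (RNat (IV 6)) (HPow 70)))
         (SetV 10 (RAdd (RV 10) (RMul (RVec 12 2) (RVec 16 2))))).

(** The digit minus the shift [h^140] is a sum of products of two numbers scaled by [h^60] each;
    hence the denominator [h^120]. *)
Definition slackEntry : rexp :=
  RSub (RDiv (RMat 0 3 4) (RV 2)) (RDiv (RSub (RNat (IV 6)) (HPow 140)) (HPow 120)).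

Definition primalEntry : rexp :=
  RMul (RDiv (RAdd (RMat 3 3 4) (RMat 5 3 4)) (RNat (INat 2))) (HPow 4).

Definition RoundPrimalBody : cmd :=
  Seq (SetMat 6 3 4 primalEntry)
  (Seq (Floor (RMul (RAdd (RMat 6 3 4) (HPow 17)) (HPow 60)))
       (SetV 10 (RAdd (RV 10) (RMul (RSub (RNat (IV 6)) (HPow 77)) (RMat 1 3 4))))).

(** Of the exponent 73, the part 60 undoes the scaling of the rounded center and 13 comes from
    [tau]. *)
Definition gradientEntry : rexp :=
  RAdd (RSub (RVec 17 2) (RDiv (RSub (RNat (IV 6)) (HPow 140)) (HPow 120)))
       (RDiv (RVec 12 2) (HPow 73)).

Definition Gradient : cmd :=
  Seq (SetV 10 (RV 6))
  (Seq (For 2 (IV 1) RoundCenterBody)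
  (Seq (Seq (SetV 3 (RV 10)) (SetV 4 (RV 5)))
  (Seq (For 3 (IV 0) (For 4 (IV 0) (Seq Extract (SetMat 3 3 4 slackEntry))))
  (Seq (MMul (INat 5) (INat 3) (INat 3) (IV 0))
  (Seq (MSqrt (INat 5) (INat 5) (IV 0))
  (Seq (SetV 10 (RV 8))
  (Seq (For 3 (IV 0) (For 4 (IV 0) RoundPrimalBody))
  (Seq (Seq (SetV 3 (RV 10)) (SetV 4 (RV 7)))
       (For 2 (IV 1) (Seq Extract (SetVec 13 2 gradientEntry))))))))))).

Section GradientSpec.
Context {R : realType} (kap : nat -> R) (eig : @spectral_oracle R) (eigP : spectral_oracle_spec eig).
Implicit Types (s : @store R).
Notation wp := (wp kap eig).
Context (sb : nat) (sb0 : (0 < sb)%N).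
Let h : R := (2 ^ sb)%:R.

Let h2 : 2 <= h. Proof. exact: pow_ge2. Qed.
Let hX k : 0 < h ^+ k. Proof. by rewrite exprn_gt0 // (lt_le_trans _ h2). Qed.
Let hE k : ((2 ^ sb) ^ k)%:R = h ^+ k :> R. Proof. by rewrite natrX. Qed.

(* Rounds [x * h ^+ 60] down; the shift by [h ^+ k] makes the argument nonnegative. *)
Definition round_scaled (k : nat) (x : R) : R :=
  (Num.truncn ((x + h ^+ k) * h ^+ 60))%:R - h ^+ (k + 60).

Lemma round_scaledP k x : `|x| <= h ^+ k ->
  [/\ 0 <= x * h ^+ 60 - round_scaled k x <= 1, `|round_scaled k x| <= h ^+ (k + 60) &
      round_scaled k x \is a Num.int].
Proof.
rewrite ler_norml => /andP[x1 x2]; rewrite /round_scaled.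
have v0 : 0 <= (x + h ^+ k) * h ^+ 60 by rewrite mulr_ge0 ?(ltW (hX _)) //; lra.
have /andP[t1 t2] := truncn_itv v0; move: t2; rewrite -natr1 => t2.
have E : x * h ^+ 60 = (x + h ^+ k) * h ^+ 60 - h ^+ (k + 60) by rewrite exprD; ring.
have v1 : (x + h ^+ k) * h ^+ 60 <= 2 * h ^+ (k + 60).
  by rewrite exprD mulrA ler_pM2r //; lra.
split.
- by rewrite E; apply/andP; split; lra.
- rewrite ler_norml; apply/andP; split; last lra.
  have : 0 <= (Num.truncn ((x + h ^+ k) * h ^+ 60))%:R :> R by []. lra.
- by rewrite rpredB // -hE ?rpred_nat.
Qed.

Lemma round_arg k x : (k + 62 <= 141)%N -> `|x| <= h ^+ k -> 0 <= (x + h ^+ k) * h ^+ 60 < h ^+ 141.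
Proof.
rewrite ler_norml => k141 /andP[x1 x2]; rewrite mulr_ge0 ?(ltW (hX _)) //=; last lra.
apply: (@le_lt_trans _ _ (2 * h ^+ (k + 60))); first by rewrite exprD mulrA ler_pM2r //; lra.
apply: (@le_lt_trans _ _ (h ^+ (k + 61))); first by have := @lt_powS R sb sb0 (k + 60); rewrite -addnS.
by rewrite ltr_eXn2l ?(lt_le_trans _ h2) // ?ltr1n //; lia.
Qed.

(** For an integer bounded by [h^139] the truncation loses nothing: it only names the natural number
    [x + h^140] as a digit below the base. *)
Lemma truncn_digit (x : R) : x \is a Num.int -> `|x| <= h ^+ 139 ->
  (Num.truncn (x + h ^+ 140))%:R = x + h ^+ 140 /\ x + h ^+ 140 < h ^+ 141.
Proof.
move=> xi /[dup]; rewrite {1}ler_norml => /andP[x1 x2] _.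
have hp := @lt_powS R sb sb0 140; have hp' := @lt_powS R sb sb0 139; rewrite -/h in hp hp'.
have hp0 := hX 139; split; last by lra.
apply: truncnK; rewrite natrEint rpredD //; first by lra.
by rewrite -hE intr_nat.
Qed.

Lemma wp_round_center (m : nat) s : ints s 1 = m -> scaled sb s ->
  (forall i, (i < m)%N -> `|mats s 2 11%N i| <= h ^+ 10) ->
  wp (For 2 (IV 1) RoundCenterBody) s
   (m.+1%:R * ((lcost (Seq (SetV 3 (RMul (RAdd (RVec 11 2) (HPow 10)) (HPow 60))) (SetV 4 (HPow 141))))%:R
        + (150 * 100 * sb)%:R +
      (lcost (Seq (SetVec 12 2 (RSub (RNat (IV 6)) (HPow 70)))
         (SetV 10 (RAdd (RV 10) (RMul (RVec 12 2) (RVec 16 2))))))%:R + (icost (IV 1) + 14)%:R))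
   (fun s' => [/\ frame [:: 2; 5; 6] [:: 3; 4; 10; 12] [::] s s',
     forall i, (i < m)%N -> mats s' 2 12%N i = round_scaled 10 (mats s 2 11%N i) &
     mats s' 2 10%N 0%N = mats s 2 10%N 0%N +
       \sum_(i < m) round_scaled 10 (mats s 2 11%N i) * mats s 2 16%N i]).
Proof.
move=> s1 sc cb.
pose P k (M : nat -> nat -> nat -> R) :=
  (forall i, (i < k)%N -> M 2%N 12%N i = round_scaled 10 (mats s 2 11%N i)) /\
  M 2%N 10%N 0%N = mats s 2 10%N 0%N +
    \sum_(i < k) round_scaled 10 (mats s 2 11%N i) * mats s 2 16%N i.
apply: wp_le (wp_loop (P := P) (Is := [:: 5; 6]) (Rs := [:: 3; 4; 10; 12]) (Qs := [::]) _ _ _ _ _) (lexx _) _;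
  [| | | | | ]; last first.
- by move=> s' [fr [p1 p2]]; split.
- move=> i s' im xi fr [p1 p2]; have [fI fR _] := fr.
  have [s8 s7] : scaled sb s' by apply: scaled_frame fr sc.
  apply: wp_bind (wp_floor kap eig sb0 (v := (mats s 2 11%N i + h ^+ 10) * h ^+ 60) _ _ _) _.
  + by split.
  + by rewrite /= !ieval_ipow /= s7 xi fR // !hE.
  + by apply: round_arg => //; exact: cb.
  move=> s2 [fr2 d2]; apply: wp_run => //; have [fI2 fR2 _] := fr2.
  have fr2' : frame [:: 5; 6] [:: 3; 4; 10; 12] [::] s' s2.
    by apply: frame_sub fr2 => // y; rewrite !inE => /orP[] ->; rewrite ?orbT.
  split; first by frm.
  have E : (ints s2 6)%:R - h ^+ 70 = round_scaled 10 (mats s 2 11%N i) by rewrite d2.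
  rewrite /P /= /upd /= !ieval_ipow /= (fI2 7%N) // s7 (fI2 2%N) // xi !hE E !eqxx /=.
  rewrite (fR2 10%N) // (fR2 12%N) // (fR2 16%N) // (fR 16%N) // p2 big_ord_recr addrA; split=> //.
  by move=> k; rewrite ltnS leq_eqVlt => /predU1P[->|ki]; [rewrite eqxx|rewrite ltn_eqF // p1].
- by split=> //; rewrite big_ord0 addr0.
- by move=> s' [fI _ _]; rewrite /= fI.
- by [].
- by rewrite -!natrD ler0n.
Qed.

Definition primal_cell (n : nat) (M : nat -> nat -> nat -> R) (k : nat) : R :=
  (M 3%N (k %/ n)%N (k %% n)%N + M 5%N (k %/ n)%N (k %% n)%N) / 2 * h ^+ 4.

Lemma wp_round_primal (n : nat) s : (0 < n)%N -> ints s 0 = n -> scaled sb s ->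
  (forall k, (k < n * n)%N -> `|primal_cell n (mats s) k| <= h ^+ 17) ->
  wp (For 3 (IV 0) (For 4 (IV 0) RoundPrimalBody)) s
   (n.+1%:R * (n.+1%:R * ((lcost (SetMat 6 3 4 primalEntry))%:R +
       ((lcost (Seq (SetV 3 (RMul (RAdd (RMat 6 3 4) (HPow 17)) (HPow 60))) (SetV 4 (HPow 141))))%:R
        + (150 * 100 * sb)%:R +
      (lcost (SetV 10 (RAdd (RV 10) (RMul (RSub (RNat (IV 6)) (HPow 77)) (RMat 1 3 4)))))%:R)
       + (icost (IV 0) + 14)%:R) + (icost (IV 0) + 14)%:R))
   (fun s' => [/\ frame [:: 3; 4; 5; 6] [:: 3; 4; 10] [:: 6] s s',
     forall p q, (p < n)%N -> (q < n)%N -> mats s' 6 p q = primal_cell n (mats s) (p * n + q) &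
     mats s' 2 10%N 0%N = mats s 2 10%N 0%N +
       \sum_(k < n * n) round_scaled 17 (primal_cell n (mats s) k) * mats s 1 (k %/ n)%N (k %% n)%N]).
Proof.
move=> n0 s0 sc cb.
pose P k (M : nat -> nat -> nat -> R) :=
  (forall p q, (q < n)%N -> (p * n + q < k)%N -> M 6%N p q = primal_cell n (mats s) (p * n + q)) /\
  M 2%N 10%N 0%N = mats s 2 10%N 0%N +
    \sum_(j < k) round_scaled 17 (primal_cell n (mats s) j) * mats s 1 (j %/ n)%N (j %% n)%N.
have eN Rs Qs s' : frame [:: 3; 4; 5; 6] Rs Qs s s' -> ieval s' (IV 0) = n.
  by move=> [fI _ _]; rewrite /= fI.
apply: wp_le (wp_loop2 (P := P) (n1 := n) (n := n) (Is := [:: 5; 6]) (Rs := [:: 3; 4; 10]) (Qs := [:: 6%N]) _ _ _ _ _ _ _) (lexx _) _;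
  [| | | | | | | ]; last first.
- move=> s' [fr [p1 p2]]; split=> // p q pn qn; apply: p1 => //.
  exact: flat_lt.
- move=> p q s' pn qn xp yq fr [p1 p2]; have [fI fR fQ] := fr.
  have [s8 s7] : scaled sb s' by apply: scaled_frame fr sc.
  have dE : ((p * n + q) %/ n = p)%N by rewrite divnMDl // divn_small // addn0.
  have mE : ((p * n + q) %% n = q)%N by rewrite modnMDl modn_small.
  pose x := primal_cell n (mats s) (p * n + q).
  have lt : (p * n + q < n * n)%N by exact: flat_lt.
  apply: wp_seq; apply: wp_run => //; set s1 := run _ s'.
  have fr1 : frame [::] [::] [:: 6%N] s' s1 by rewrite /s1; frm.
  have [fI1 fR1 fQ1] := fr1.
  have x1 : mats s1 6 p q = x.
    rewrite /s1 /= /upd /= xp yq !eqxx ieval_ipow /= s7 hE fQ // fQ //.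
    by rewrite /x /primal_cell dE mE.
  have x1' p' q' : (p' != p) || (q' != q) -> mats s1 6 p' q' = mats s' 6 p' q'.
    rewrite /s1 /= /upd /= xp yq; case: eqP => [->|//] /=; by case: eqP.
  clearbody s1.
  apply: wp_bind (wp_floor kap eig sb0 (v := (x + h ^+ 17) * h ^+ 60) _ _ _) _.
  + by split; rewrite fI1.
  + by rewrite /= !ieval_ipow /= !fI1 // s7 xp yq x1 !hE.
  + by apply: round_arg => //; exact: cb.
  move=> s2 [fr2 d2]; apply: wp_run => //; have [fI2 fR2 fQ2] := fr2.
  have fr2' : frame [:: 5; 6] [:: 3; 4; 10] [:: 6%N] s' s2 by apply: (frame_comp fr1 fr2).
  split; first by frm.
  have E : (ints s2 6)%:R - h ^+ 77 = round_scaled 17 x by rewrite d2.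
  have [fI2' _ fQ2'] := fr2'.
  rewrite /P /= /upd /= !ieval_ipow /= (fI2' 7%N) // s7 (fI2' 3%N) // xp (fI2' 4%N) // yq !hE E /=.
  rewrite (fQ2' 1%N) // fQ // fR2 // fR1 // p2 big_ord_recr /= dE mE addrA; split=> // p' q' q'n.
  rewrite fQ2 // ltnS leq_eqVlt flat_index // => /orP[/andP[/eqP-> /eqP->]|lt'].
    by rewrite x1.
  rewrite x1' ?p1 // -negb_and -(flat_index _ _ q'n qn).
  by rewrite neq_ltn lt'.
- by split=> //; rewrite big_ord0 addr0.
- by move=> s'; exact: eN.
- by move=> s'; exact: eN.
- by [].
- by [].
- by rewrite -!natrD ler0n.
Qed.

End GradientSpec.

Section Blocks.
Context {R : realType}.

Lemma put_in k l (B : 'M[R]_(k, l)) M (i : 'I_k) (j : 'I_l) : put B M i j = B i j.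
Proof. by rewrite /put !valK. Qed.

Lemma block_put k (B : 'M[R]_k) M : block k (put B M) = B.
Proof. by apply/matrixP => i j; rewrite mxE put_in. Qed.

Lemma sum_flat n l (F : nat -> nat -> R) :
  \sum_(k < l * n) F (k %/ n)%N (k %% n)%N = \sum_(p < l) \sum_(q < n) F p q.
Proof.
elim: l => [|l IH]; first by rewrite !big_ord0.
rewrite big_ord_recr /= -IH -!(big_mkord xpredT (fun k => F (k %/ n)%N (k %% n)%N)).
rewrite mulSnr (big_cat_nat (n := l * n)) ?leq_addr //=; congr (_ + _).
rewrite -{1}[(l * n)%N]add0n big_addn addKn big_mkord; apply: eq_bigr => q _.
have n0 : (0 < n)%N by exact: leq_ltn_trans (ltn_ord q).
by rewrite addnC divnMDl // modnMDl modn_small // divn_small // addn0.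
Qed.

(** The summands [e1], [e2] collect the matrix instructions, so that the unknown constants multiply
    only the arithmetic part. *)
Lemma cost_adde (k1 k2 : nat) (T1 T2 U e1 e2 : R) :
  T1 <= k1%:R * U + e1 -> T2 <= k2%:R * U + e2 -> T1 + T2 <= (k1 + k2)%:R * U + (e1 + e2).
Proof. by move=> H1 H2; rewrite natrD mulrDl addrACA lerD. Qed.

Lemma cost_e0 (k : nat) (T U : R) : T <= k%:R * U -> T <= k%:R * U + 0.
Proof. by rewrite addr0. Qed.

Lemma cost_instr (k : nat) (U x : R) : 1 <= U -> k%:R + x <= k%:R * U + x.
Proof. by move=> U1; rewrite lerD2r; exact: cost_const. Qed.

End Blocks.

Section BlockInstructions.
Context {R : realType} (kap : nat -> R) (eig : @spectral_oracle R) (eigP : spectral_oracle_spec eig).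
Implicit Types (s : @store R).
Notation wp := (wp kap eig).

Lemma wp_mmul s r p e k : ieval s e = k ->
  wp (MMul (INat r) (INat p) (INat p) e) s ((3 + icost e).+1%:R + kap k)
    (fun s' => s' = set_block s r (block k (mats s p) *m block k (mats s p))).
Proof. by move=> <-; eexists; eexists; split; [exact: ExecMMul|exact: lexx|]. Qed.

Lemma wp_msqrt s r p e k (M : 'M[R]_k) : ieval s e = k -> M \is symmetricmx ->
  block k (mats s p) = M *m M ->
  wp (MSqrt (INat r) (INat p) e) s ((2 + icost e).+1%:R + kap k)
    (fun s' => s' = set_block s r (mxabs eig M)).
Proof.
move=> ek; subst k => sM bM; eexists; eexists; split; last by [].
  by apply: ExecMSqrt; [exact: mxabs_psd|rewrite /= bM mxabs_sqr].
exact: lexx.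
Qed.

End BlockInstructions.

Section Normalized.
Context {R : realType}.
Definition normalized_C n (c : R) (M : nat -> nat -> nat -> R) : 'M[R]_n :=
  \matrix_(i, j) (M 0%N i j / c).
Definition rounded_A m n sb (a : R) (M : nat -> nat -> nat -> R) (i : 'I_m) : 'M[R]_n :=
  \matrix_(p, q) (scaled_entry n sb a M i (p * n + q) / (2 ^ sb)%:R ^+ 60).
Definition normalized_b m (a : R) (M : nat -> nat -> nat -> R) : 'cV[R]_m :=
  \col_i (M 1%N i 0%N / (a * M 2%N 0%N 1%N)).
Definition rounded_center m sb (x : nat -> R) : 'cV[R]_m :=
  \col_i (round_scaled sb 10 (x i) / (2 ^ sb)%:R ^+ 60).

Lemma scaled_entryE n sb (a : R) M i k :
  scaled_entry n sb a M i k = round_scaled sb 0 (M (i + 3)%N (k %/ n)%N (k %% n)%N / a).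
Proof. by rewrite /scaled_entry /round_scaled expr0. Qed.
End Normalized.

(** The slack and the primal are exact for the rounded center and the rounded [A_i]: sums of
    integers are unpacked without loss and the matrix instructions are exact. The only error of the
    gradient comes from rounding the primal before its products with the packed [A_i]. *)
Lemma wp_gradient : exists K : nat, forall (R : realType) (kap : nat -> R) (eig : @spectral_oracle R)
  (eigP : spectral_oracle_spec eig)
  (n m sb : nat) (n0 : (0 < n)%N) (m0 : (0 < m)%N) (sb0 : (0 < sb)%N) (a c : R) (s0 s : @store R),
  let h : R := (2 ^ sb)%:R in
  let C := normalized_C n c (mats s0) in
  let A := @rounded_A R m n sb a (mats s0) in
  let b := normalized_b m a (mats s0) in
  let ct := rounded_center m sb (mats s 2 11%N) in
  100 <= h -> m%:R <= h -> n%:R <= h ->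
  (forall i p q, (i < m)%N -> (p < n)%N -> (q < n)%N -> `|mats s0 (i + 3) p q / a| <= 1) ->
  (forall i j, `|C i j| <= 1) -> C \is symmetricmx -> (forall i, A i \is symmetricmx) ->
  (forall i j, `|primal eig C A (h ^- 4) ct i j| <= h ^+ 17) ->
  setup n m sb a c s0 s -> (forall i, (i < m)%N -> `|mats s 2 11%N i| <= h ^+ 10) ->
  wp kap eig Gradient s (K%:R * ((n * n + m * m) * sb)%:R + 2 * kap n)
  (fun s' => [/\ frame [:: 2; 3; 4; 5; 6] [:: 3; 4; 10; 12; 13] [:: 3; 5; 6] s s',
    forall i j : 'I_n, mats s' 6 i j = primal eig C A (h ^- 4) ct i j &
    forall i : 'I_m, `|mats s' 2 13%N i - dualg eig C A b (h ^- 4) (h ^- 13) ct i 0| <= h ^- 58]).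
Proof.
eexists => R kap eig eigP n m sb n0 m0 sb0 a c s0 s h C A b ct h100 mh nh A1 C1 sC sA pb S cb.
have U1 : 1 <= ((n * n + m * m) * sb)%:R :> R by rewrite ler1n !muln_gt0 addn_gt0 !muln_gt0 n0.
have h2 : 2 <= h := pow_ge2 sb0.
have hX k : 0 < h ^+ k by rewrite exprn_gt0 // (lt_le_trans _ h2).
have h1 : 1 <= h by lra.
have hE k : ((2 ^ sb) ^ k)%:R = h ^+ k :> R by rewrite natrX.
pose cz (i : nat) := round_scaled sb 10 (mats s 2 11%N i).
pose az := scaled_entry n sb a (mats s0).
have az_spec i k : (i < m)%N -> (k < n * n)%N -> `|az i k| <= h ^+ 60 /\ az i k \is a Num.int.
  move=> im kn; rewrite /az scaled_entryE.
  have kd : (k %/ n < n)%N by rewrite ltn_divLR.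
  have := @round_scaledP R sb sb0 0 (mats s0 (i + 3)%N (k %/ n)%N (k %% n)%N / a).
  rewrite expr0 => /(_ (A1 _ _ _ im kd (ltn_pmod k n0))) [_ H1 H2].
  by split.
have cz_spec i : (i < m)%N -> `|cz i| <= h ^+ 70 /\ cz i \is a Num.int.
  by move=> im; have [_ H1 H2] := @round_scaledP R sb sb0 10 _ (cb i im); split.
pose D1 (k : nat) := \sum_(i < m) cz i * az i k.
have D1_spec k : (k < n * n)%N -> `|D1 k| <= h ^+ 139 /\ D1 k \is a Num.int.
  move=> kn; split; last first.
    by apply: rpred_sum => i _; rewrite rpredM ?(cz_spec _ (ltn_ord i)).2 ?(az_spec _ _ (ltn_ord i) kn).2.
  apply: le_trans (ler_norm_sum _ _ _) _.
  apply: (@le_trans _ _ (\sum_(i < m) h ^+ 130)).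
    apply: ler_sum => i _; rewrite normrM (exprD h 70 60) ler_pM //.
      exact: (cz_spec _ (ltn_ord i)).1.
    exact: (az_spec _ _ (ltn_ord i) kn).1.
  rewrite sumr_const card_ord -[_ *+ m]mulr_natl; apply: (@le_trans _ _ (h ^+ 131)).
    by rewrite (exprS h 130) ler_pM2r.
  by rewrite ler_weXn2l.
pose d1 k := Num.truncn (D1 k + h ^+ 140).
have d1E k : (k < n * n)%N -> (d1 k)%:R = D1 k + h ^+ 140 /\ (d1 k)%:R < h ^+ 141.
  move=> kn; have [H1 H2] := D1_spec k kn.
  by have [H3 H4] := truncn_digit sb0 H2 H1; rewrite /d1 H3.
apply: wp_cost.
  apply: wp_seq; apply: wp_run => //; set s1 := run _ s.
  have fr1 : frame [::] [:: 10] [::] s s1 by rewrite /s1; frm.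
  have acc1 : mats s1 2 10%N 0%N = digits_value (h ^+ 141) (fun => h ^+ 140) (n * n).
    by rewrite /s1 /= /upd /= (setup_O1 S).
  clearbody s1; have [fI1 fR1 fQ1] := fr1.
  have sc1 : scaled sb s1 by apply: scaled_frame fr1 (setup_scaled S).
  apply: wp_bind (wp_round_center kap eig sb0 (m := m) _ sc1 _) _.
    by rewrite fI1 // (setup_m S).
    by move=> i im; rewrite fR1 // cb.
  move=> s2 [fr2 cz2 acc2].
  have fr02 : frame [:: 2; 5; 6] [:: 3; 4; 10; 12] [::] s s2 by apply: (frame_comp fr1 fr2).
  have S2 : setup n m sb a c s0 s2 by apply: setup_frame fr02 S; apply/allP.
  have zE : mats s2 2 10%N 0%N = digits_value (h ^+ 141) (fun k => (d1 k)%:R) (n * n).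
    rewrite acc2 acc1.
    have -> : \sum_(i < m) round_scaled sb 10 (mats s1 2 11%N i) * mats s1 2 16%N i =
        \sum_(i < m) cz i * digits_value (h ^+ 141) (az i) (n * n).
      by apply: eq_bigr => i _; rewrite !fR1 // (setup_A S).
    rewrite digits_value_sum addrC digits_value_add; apply: eq_digits_value => k kn.
    by have [-> _] := d1E k kn.
  apply: wp_seq; apply: wp_run => //; set s3 := run _ s2.
  have fr3 : frame [::] [:: 3; 4] [::] s2 s3 by rewrite /s3; frm.
  have z3 : mats s3 2 3%N 0%N = digits_value (h ^+ 141) (fun k => (d1 k)%:R) (n * n).
    by rewrite /s3 /= /upd /= zE.
  have t3 : mats s3 2 4%N 0%N = (h ^+ 141) ^+ (n * n).
    by rewrite /s3 /= /upd /= (setup_T1 S2).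
  clearbody s3.
  have S3 : setup n m sb a c s0 s3 by apply: setup_frame fr3 S2; apply/allP.
  have [fI3 fR3 fQ3] := fr3.
  apply: wp_bind (wp_unpack_mat kap eig sb0 (d := d1)
    (F := fun i j => mats s0 0 i j / c - D1 (i * n + j)%N / h ^+ 120) _ _ _ _ (setup_scaled S3) _ _ z3 t3 _) _ => //.
    by move=> s' [fI _ _]; rewrite /= fI // (setup_n S3).
    by move=> k /d1E[].
    move=> s' p q pn qn fr xp yq dd; have [fI fR fQ] := fr.
    have [s8 s7] : scaled sb s' by apply: scaled_frame fr (setup_scaled S3).
    rewrite /= !ieval_ipow /= s7 !hE xp yq dd fQ // (setup_C S3) fR // (setup_c S3).
    by have [-> _] := d1E _ (flat_lt pn qn); rewrite addrK.
  move=> s4 [fr4 M4].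
  have fr04 : frame [:: 2; 3; 4; 5; 6] [:: 3; 4; 10; 12] [:: 3] s s4.
    have fr03 : frame [:: 2; 5; 6] [:: 3; 4; 10; 12] [::] s s3 by apply: (frame_comp fr02 fr3).
    by apply: (frame_comp fr03 fr4).
  have [fI04 fR04 fQ04] := fr04.
  have s4n : ieval s4 (IV 0) = n by rewrite /= fI04 // (setup_n S).
  have slackE : block n (mats s4 3) = slack C A ct.
    apply/matrixP => p q; rewrite !mxE M4 // summxE; congr (_ - _).
    rewrite /D1 mulr_suml; apply: eq_bigr => i _; rewrite !mxE -/(az i (p * n + q)%N) -/(cz i).
    rewrite -[120%N]/(60 + 60)%N exprD; field.
    by rewrite pnatr_eq0 -lt0n expn_gt0.
  have sS : slack C A ct \is symmetricmx by apply: slack_sym.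
  apply: wp_bind (wp_mmul kap eig 5 3 s4n) _ => _ ->.
  rewrite slackE; set s5 := set_block _ _ _.
  have fr5 : frame [::] [::] [:: 5] s4 s5 by rewrite /s5 /set_block; frm.
  have b5 : block n (mats s5 5) = slack C A ct *m slack C A ct.
    by rewrite /s5 /= /upd /= block_put.
  clearbody s5; have [fI5 fR5 fQ5] := fr5.
  apply: wp_bind (wp_msqrt kap eigP 5 _ sS b5) _; first by rewrite /= fI5.
  move=> _ ->; set s6 := set_block _ _ _.
  have fr6 : frame [::] [::] [:: 5] s5 s6 by rewrite /s6 /set_block; frm.
  have N6 (i j : 'I_n) : mats s6 5 i j = mxabs eig (slack C A ct) i j.
    by rewrite /s6 /= /upd /= put_in.
  clearbody s6; have [fI6 fR6 fQ6] := fr6.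
  have fr06 : frame [:: 2; 3; 4; 5; 6] [:: 3; 4; 10; 12] [:: 3; 5] s s6.
    have fr56 : frame [::] [::] [:: 5] s4 s6 by apply: (frame_comp fr5 fr6).
    by apply: (frame_comp fr04 fr56).
  have S6 : setup n m sb a c s0 s6 by apply: setup_frame fr06 S; apply/allP.
  apply: wp_seq; apply: wp_run => //; set s7 := run _ s6.
  have fr7 : frame [::] [:: 10] [::] s6 s7 by rewrite /s7; frm.
  have acc7 : mats s7 2 10%N 0%N = digits_value (h ^+ 141) (fun => h ^+ 140) m.
    by rewrite /s7 /= /upd /= (setup_O2 S6).
  clearbody s7; have [fI7 fR7 fQ7] := fr7.
  have S7 : setup n m sb a c s0 s7 by apply: setup_frame fr7 S6; apply/allP.
  have cellE (p q : 'I_n) : primal_cell sb n (mats s7) (p * n + q)%N = primal eig C A (h ^- 4) ct p q.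
    rewrite /primal_cell divnMDl // divn_small // addn0 modnMDl modn_small //.
    rewrite fQ7 // fQ7 // N6 fQ6 // fQ5 // /primal invrK /pospart -slackE !mxE -/h.
    by rewrite mulrC; congr (_ * _); rewrite mulrC.
  have cell_le k : (k < n * n)%N -> `|primal_cell sb n (mats s7) k| <= h ^+ 17.
    move=> kn; have kd : (k %/ n < n)%N by rewrite ltn_divLR.
    rewrite (divn_eq k n) (cellE (Ordinal kd) (Ordinal (ltn_pmod k n0))); exact: pb.
  apply: wp_bind (wp_round_primal kap eig sb0 n0 (setup_n S7) (setup_scaled S7) cell_le) _.
  move=> s8 [fr8 X8 acc8].
  pose xz (k : nat) := round_scaled sb 17 (primal_cell sb n (mats s7) k).
  have xz_spec k : (k < n * n)%N -> [/\ 0 <= primal_cell sb n (mats s7) k * h ^+ 60 - xz k <= 1,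
      `|xz k| <= h ^+ 77 & xz k \is a Num.int].
    by move=> kn; apply: round_scaledP => //; exact: cell_le.
  (* These are the digits that dictate the base: [n^2 h^(77 + 60) <= h^139]. Those of [D1] stay
     below [h^131]. *)
  pose D2 (i : nat) := \sum_(k < n * n) xz k * az i k.
  have D2_spec i : (i < m)%N -> `|D2 i| <= h ^+ 139 /\ D2 i \is a Num.int.
    move=> im; split; last first.
      apply: rpred_sum => k _; have [_ _ H] := xz_spec _ (ltn_ord k).
      by rewrite rpredM ?H ?(az_spec _ _ im (ltn_ord k)).2.
    apply: le_trans (ler_norm_sum _ _ _) _.
    apply: (@le_trans _ _ (\sum_(k < n * n) h ^+ 137)).
      apply: ler_sum => k _; rewrite normrM (exprD h 77 60); have [_ H _] := xz_spec _ (ltn_ord k).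
      by rewrite ler_pM // (az_spec _ _ im (ltn_ord k)).1.
    rewrite sumr_const card_ord -[_ *+ (n * n)]mulr_natl (exprD h 2 137) ler_pM2r // natrM expr2.
    by rewrite ler_pM.
  pose d2 i := Num.truncn (D2 i + h ^+ 140).
  have d2E i : (i < m)%N -> (d2 i)%:R = D2 i + h ^+ 140 /\ (d2 i)%:R < h ^+ 141.
    move=> im; have [H1 H2] := D2_spec i im.
    by have [H3 H4] := truncn_digit sb0 H2 H1; rewrite /d2 H3.
  have z8 : mats s8 2 10%N 0%N = digits_value (h ^+ 141) (fun k => (d2 k)%:R) m.
    rewrite acc8 acc7.
    have -> : \sum_(k < n * n) round_scaled sb 17 (primal_cell sb n (mats s7) k) *
          mats s7 1 (k %/ n)%N (k %% n)%N =
        \sum_(k < n * n) xz k * digits_value (h ^+ 141) (fun i => az i k) m.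
      apply: eq_bigr => k _; rewrite (setup_A' S7) ?ltn_pmod ?ltn_divLR // -divn_eq.
      by [].
    rewrite digits_value_sum addrC digits_value_add; apply: eq_digits_value => i im.
    by have [-> _] := d2E i im.
  have fr08 : frame [:: 2; 3; 4; 5; 6] [:: 3; 4; 10; 12] [:: 3; 5; 6] s s8.
    have fr78 : frame [:: 3; 4; 5; 6] [:: 3; 4; 10] [:: 6] s6 s8 by apply: (frame_comp fr7 fr8).
    by apply: (frame_comp fr06 fr78).
  have S8 : setup n m sb a c s0 s8 by apply: setup_frame fr08 S; apply/allP.
  apply: wp_seq; apply: wp_run => //; set s9 := run _ s8.
  have fr9 : frame [::] [:: 3; 4] [::] s8 s9 by rewrite /s9; frm.
  have z9 : mats s9 2 3%N 0%N = digits_value (h ^+ 141) (fun k => (d2 k)%:R) m.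
    by rewrite /s9 /= /upd /= z8.
  have t9 : mats s9 2 4%N 0%N = (h ^+ 141) ^+ m.
    by rewrite /s9 /= /upd /= (setup_T2 S8).
  clearbody s9; have [fI9 fR9 fQ9] := fr9.
  have S9 : setup n m sb a c s0 s9 by apply: setup_frame fr9 S8; apply/allP.
  have cz9 i : (i < m)%N -> mats s9 2 12%N i = cz i.
    move=> im; have [_ fR8 _] := fr8; have [_ fR4 _] := fr4.
    by rewrite fR9 // fR8 // fR7 // fR6 // fR5 // fR4 // fR3 // cz2 // fR1.
  apply: wp_le (wp_unpack_vec kap eig sb0 (d := d2)
    (F := fun i => mats s0 1 i 0%N / (a * mats s0 2 0%N 1%N) - D2 i / h ^+ 120 + cz i / h ^+ 73)
    _ _ (setup_scaled S9) _ _ z9 t9 _) (lexx _) _ => //.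
    by move=> s' [fI _ _]; rewrite /= fI // (setup_m S9).
    by move=> k /d2E[].
    move=> s' i im fr xi dd; have [fI fR fQ] := fr.
    have [s8' s7'] : scaled sb s' by apply: scaled_frame fr (setup_scaled S9).
    rewrite /= !ieval_ipow /= s7' !hE xi dd fR // (setup_b S9) // fR // cz9 //.
    by have [-> _] := d2E _ im; rewrite addrK.
  move=> s10 [fr10 g10]; have [_ _ fQ10] := fr10.
  have fr910 : frame [:: 2; 5; 6] [:: 3; 4; 13] [::] s8 s10 by apply: (frame_comp fr9 fr10).
  split; first by apply: (frame_comp fr08 fr910).
    by move=> i j; rewrite fQ10 // fQ9 // X8 // cellE.
  move=> i; rewrite g10 // !mxE -/(cz i).
  have -> : mxdot (A i) (primal eig C A (h ^- 4) ct) =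
      \sum_(k < n * n) az i k / h ^+ 60 * primal_cell sb n (mats s7) k.
    transitivity (\sum_(p < n) \sum_(q < n) (az i (p * n + q)%N / h ^+ 60 *
        primal_cell sb n (mats s7) (p * n + q)%N)).
      by apply: eq_bigr => p _; apply: eq_bigr => q _; rewrite mxE cellE.
    rewrite -(sum_flat n n (fun p q => az i (p * n + q)%N / h ^+ 60 *
        primal_cell sb n (mats s7) (p * n + q)%N)).
    by apply: eq_bigr => k _; rewrite -divn_eq.
  set bi := _ / _; set S0 := \sum_(k < _) _.
  have -> : bi - D2 i / h ^+ 120 + cz i / h ^+ 73 - (bi - S0 + h ^- 13 * (cz i / h ^+ 60)) =
      S0 - D2 i / h ^+ 120.
    have -> : cz i / h ^+ 73 = h ^- 13 * (cz i / h ^+ 60) by rewrite mulrCA -invfM -exprD.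
    by move: (h ^- 13 * _) (D2 i / _) => u v; ring.
  rewrite /S0 /D2 mulr_suml -sumrB; apply: le_trans (ler_norm_sum _ _ _) _.
  (* Each primal entry is off by at most [h^-60] and is multiplied by a number of absolute value at
     most 1; the [n^2] terms cost two powers of [h]. *)
  apply: (@le_trans _ _ (\sum_(k < n * n) h ^- 60)).
    apply: ler_sum => k _; have [/andP[x0 x1] _ _] := xz_spec _ (ltn_ord k).
    have [az1 _] := az_spec _ _ (ltn_ord i) (ltn_ord k).
    have -> : az i k / h ^+ 60 * primal_cell sb n (mats s7) k - xz k * az i k / h ^+ 120 =
        az i k / h ^+ 60 * ((primal_cell sb n (mats s7) k * h ^+ 60 - xz k) * h ^- 60).
      rewrite -[120%N]/(60 + 60)%N exprD; field.
      by rewrite pnatr_eq0 -lt0n expn_gt0.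
    rewrite normrM -[leRHS]mul1r; apply: ler_pM => //.
      by rewrite normrM normfV (gtr0_norm (hX 60)) ler_pdivrMr ?mul1r.
    rewrite normrM normfV (gtr0_norm (hX 60)) -[leRHS]mul1r ler_wpM2r ?invr_ge0 ?(ltW (hX _)) //.
    by rewrite ger0_norm.
  rewrite sumr_const card_ord -[_ *+ (n * n)]mulr_natl -[60%N]/(2 + 58)%N (exprD h 2 58) invfM mulrA.
  rewrite -[leRHS]mul1r ler_wpM2r ?invr_ge0 ?(ltW (hX _)) // ler_pdivrMr // mul1r natrM expr2.
  by rewrite ler_pM.
pose U : R := ((n * n + m * m) * sb)%:R.
have leU k : (k <= (n * n + m * m) * sb)%N -> k%:R <= U by rewrite ler_nat.
have n1 : (n * sb <= (n * n + m * m) * sb)%N by nia.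
have nn1 : (n * (n * sb) <= (n * n + m * m) * sb)%N by nia.
have m1 : (m * sb <= (n * n + m * m) * sb)%N by nia.
have R2 : forall k : nat, (0 < k)%N -> 1 <= k%:R :> R by move=> k k0; rewrite ler1n.
have Tsb : (150 * 100 * sb)%:R <= (150 * 100)%:R * sb%:R :> R by rewrite natrM.
have floor_le e : (lcost (Seq (SetV 3 e) (SetV 4 (HPow 141))))%:R + (150 * 100 * sb)%:R <=
    (lcost (Seq (SetV 3 e) (SetV 4 (HPow 141))) + 150 * 100)%:R * sb%:R :> R.
  exact: floor_cost.
apply: le_trans.
  apply: (@cost_adde _ _ _ _ _ U); first by apply/cost_e0/cost_const.
  apply: cost_adde.
    apply: cost_e0; apply: (@cost_for _ _ _ _ _ sb%:R) => //; [exact: R2| |by rewrite -natrM leU].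
    by apply: cost_add; [exact: floor_le|apply: cost_const; exact: R2].
  apply: cost_adde; first by apply/cost_e0/cost_const.
  apply: cost_adde.
    apply: cost_e0; apply: (@cost_for _ _ _ _ _ (n * sb)%:R) => //; [by rewrite R2 // muln_gt0 n0| |by rewrite -natrM leU].
    apply: (@cost_for _ _ _ _ _ sb%:R) => //; [exact: R2| |by rewrite -natrM].
    by apply: cost_add; [exact: Tsb|apply: cost_const; exact: R2].
  apply: cost_adde; first exact: cost_instr.
  apply: cost_adde; first exact: cost_instr.
  apply: cost_adde; first by apply/cost_e0/cost_const.
  apply: cost_adde.
    apply: cost_e0; apply: (@cost_for _ _ _ _ _ (n * sb)%:R) => //; [by rewrite R2 // muln_gt0 n0| |by rewrite -natrM leU].
    apply: (@cost_for _ _ _ _ _ sb%:R) => //; [exact: R2| |by rewrite -natrM].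
    apply: cost_add; first by apply: cost_const; exact: R2.
    by apply: cost_add; [exact: floor_le|apply: cost_const; exact: R2].
  apply: cost_adde; first by apply/cost_e0/cost_const.
  apply: cost_e0; apply: (@cost_for _ _ _ _ _ sb%:R) => //; [exact: R2| |by rewrite -natrM leU].
  by apply: cost_add; [exact: Tsb|apply: cost_const; exact: R2].
rewrite -/U; apply: lerD; [exact: lexx|lra].
Qed.

(** * The main loop *)

Section EllipsoidIteration.
Context {R : realType} (eig : @spectral_oracle R) (eigP : spectral_oracle_spec eig).
Context (m : nat) (m0 : (0 < m)%N).

(** Shorter than the classical step [1/(m + 1)]. In exchange the semi-axes [1 - xi] and [1 + xi^2]
    are rational, and [m = 1] needs no separate treatment. *)
Definition step_xi : R := 1 / (5 * m%:R).
Definition step_alpha : R := 1 + step_xi ^+ 2.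
Definition step_sigma : R := 1 - step_xi.
Definition step_rate : R := expR (- (4 / (25 * m%:R))).
Definition cut_direction (B : 'M[R]_m) (g : 'cV[R]_m) : 'cV[R]_m :=
  (Num.sqrt (dot (B^T *m g) (B^T *m g)))^-1 *: (B^T *m g).
Definition next_center (c : 'cV[R]_m) (B : 'M[R]_m) (g : 'cV[R]_m) : 'cV[R]_m :=
  c - step_xi *: (B *m cut_direction B g).
Definition next_shape (B : 'M[R]_m) (g : 'cV[R]_m) : 'M[R]_m :=
  B *m shrink step_alpha step_sigma (cut_direction B g).

(** Positivity of the determinant keeps [B] invertible, so that a nonzero cut stays nonzero after
    multiplication by [B^T]. *)
Definition ellipsoid_bound (S : 'cV[R]_m -> Prop) (V : R) (c : 'cV[R]_m) (B : 'M[R]_m) :=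
  [/\ forall y, S y -> in_ellipsoid c B y, 0 < \det B & \det B <= V].

Lemma step_xi_bounds : 0 < step_xi /\ step_xi <= 1 / 5.
Proof.
have mp : 0 < m%:R :> R by rewrite ltr0n.
split; first by rewrite divr_gt0 ?mulr_gt0.
by rewrite ler_pM2l // lef_pV2 ?posrE ?mulr_gt0 // -[leLHS]mulr1 ler_pM2l // ler1n.
Qed.

Lemma ellipsoid_iterate S V c B g : ellipsoid_bound S V c B -> 0 < dot g g ->
  (forall y, S y -> dot g (y - c) <= 0) ->
  ellipsoid_bound S (V * step_rate) (next_center c B g) (next_shape B g).
Proof.
move=> [sub dB BV] g0 cut; have [xi0 xi5] := step_xi_bounds.
have al0 : 0 < step_alpha by rewrite ltr_pwDl // sqr_ge0.
have u0 : 0 < dot (B^T *m g) (B^T *m g).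
  rewrite lt_def dot_ge0 andbT; apply/eqP => /dot_eq0 E.
  have Bu : B^T \in unitmx by rewrite unitmxE det_tr unitfE gt_eqF.
  have gE : g = 0 by rewrite -(mulKmx Bu g) E mulmx0.
  by move: g0; rewrite gE /dot big1 ?ltxx // => i _; rewrite mxE mul0r.
have [w1 step] := ellipsoid_step c (ltW xi0) xi5 erefl erefl u0.
have rate : step_alpha ^+ m.-1 * step_sigma <= step_rate.
  have := @shrink_rate R m.-1 step_xi; rewrite prednK // => /(_ erefl); exact.
have dS : \det (shrink step_alpha step_sigma (cut_direction B g)) = step_alpha ^+ m.-1 * step_sigma.
  move: w1; rewrite -/(cut_direction B g); move: (cut_direction B g).
  by case: (m) m0 => // m' _ w w1; exact: det_shrink.
have dS0 : 0 < step_alpha ^+ m.-1 * step_sigma.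
  by rewrite mulr_gt0 ?exprn_gt0 // /step_sigma; lra.
split.
- by move=> y Sy; apply: step; [exact: sub|exact: cut].
- by rewrite det_mulmx dS mulr_gt0.
- by rewrite det_mulmx dS ler_pM // ltW.
Qed.

(** The ball of radius [h^-22] forces [det B >= h^(-22 m)], while the upper bound decays from
    [h^(10 m)] at rate [exp (-4/(25 m))]. With [h <= e^sb] this gives [4 k / (25 m) <= 32 m sb],
    that is [k <= 200 m^2 sb]. *)
Lemma ellipsoid_iteration_bound (sb k : nat) (yh c : 'cV[R]_m) (B : 'M[R]_m) : (0 < sb)%N ->
  let h : R := (2 ^ sb)%:R in
  ellipsoid_bound (fun y => dot (y - yh) (y - yh) <= (h ^- 22) ^+ 2)
    ((h ^+ 10) ^+ m * step_rate ^+ k) c B -> (k < 300 * (m * m * sb))%N.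
Proof.
move=> sb0 h [sub dB BV].
have h0 : 0 < h by rewrite ltr0n expn_gt0.
have r0 : 0 <= h ^- 22 by rewrite invr_ge0 ltW ?exprn_gt0.
have := ball_in_ellipsoid_det eigP r0 sub; rewrite exprM ler_pXn2r ?nnegrE ?exprn_ge0 // ?(ltW dB) // => rB.
have {rB} H := le_trans rB BV.
have mp : 0 < m%:R :> R by rewrite ltr0n.
have he : h ^+ 32 <= expR (32%:R * sb%:R).
  rewrite expRM_natl lerXn2r ?nnegrE ?expR_ge0 ?(ltW h0) // /h natrX -[sb%:R]mulr1 expRM_natl.
  rewrite lerXn2r ?nnegrE ?expR_ge0 //.
  by have := expR_ge1Dx (1 : R); lra.
have H2 : expR (k%:R * (4 / (25 * m%:R))) <= expR (m%:R * (32%:R * sb%:R)) :> R.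
  apply: (@le_trans _ _ ((h ^+ 32) ^+ m)); last first.
    by rewrite [leRHS]expRM_natl lerXn2r ?nnegrE ?expR_ge0 ?exprn_ge0 ?(ltW h0).
  have hm : 0 < (h ^+ 22) ^+ m by rewrite !exprn_gt0.
  have : 1 <= (h ^+ 32) ^+ m * step_rate ^+ k.
    rewrite -(ler_pM2l (x := (h ^- 22) ^+ m)) ?exprn_gt0 ?invr_gt0 ?exprn_gt0 // mulr1.
    apply: le_trans H _; rewrite mulrA -exprMn (exprD h 22 10) mulKf // gt_eqF // exprn_gt0 //.
  rewrite /step_rate -expRM_natl mulrN expRN ler_pdivlMr ?expR_gt0 // mul1r; exact.
move: H2; rewrite ler_expR mulrA ler_pdivrMr ?mulr_gt0 // => H2.
rewrite -(ltr_nat R) !natrM.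
have : k%:R <= 200%:R * (m%:R * m%:R * sb%:R) :> R by lra.
have : 0 < m%:R * m%:R * sb%:R :> R by rewrite !mulr_gt0 // ltr0n.
lra.
Qed.

End EllipsoidIteration.

Definition Alpha : rexp :=
  RAdd (RNat (INat 1)) (RDiv (RNat (INat 1)) (RNat (IMul (INat 25) (IMul (IV 1) (IV 1))))).
Definition Xi : rexp := RDiv (RNat (INat 1)) (RNat (IMul (INat 5) (IV 1))).
Definition Sigma : rexp := RSub (RNat (INat 1)) Xi.

(** The new shape is formed as [al B + (sg - al) (B w) w^T], with [O(m^2)] arithmetic operations and
    no matrix product. The scalar square root is a 1 x 1 matrix instruction on matrix 7. *)
Definition Update : cmd :=
  Seq (For 2 (IV 1) (Seq (SetVec 14 2 (RNat (INat 0)))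
        (For 3 (IV 1) (SetVec 14 2 (RAdd (RVec 14 2) (RMul (RMat 4 3 2) (RVec 13 3)))))))
  (Seq (SetV 9 (RNat (INat 0)))
  (Seq (For 2 (IV 1) (SetV 9 (RAdd (RV 9) (RMul (RVec 14 2) (RVec 14 2)))))
  (Seq (RSet (INat 7) (INat 0) (INat 0) (RV 9))
  (Seq (MSqrt (INat 7) (INat 7) (INat 1))
  (Seq (For 2 (IV 1) (SetVec 14 2 (RDiv (RVec 14 2) (RLoad (INat 7) (INat 0) (INat 0)))))
  (Seq (For 2 (IV 1) (Seq (SetVec 15 2 (RNat (INat 0)))
        (For 3 (IV 1) (SetVec 15 2 (RAdd (RVec 15 2) (RMul (RMat 4 2 3) (RVec 14 3)))))))
  (Seq (For 2 (IV 1) (SetVec 11 2 (RSub (RVec 11 2) (RMul Xi (RVec 15 2)))))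
       (For 2 (IV 1) (For 3 (IV 1) (SetMat 4 2 3
          (RAdd (RMul Alpha (RMat 4 2 3)) (RMul (RSub Sigma Alpha) (RMul (RVec 15 2) (RVec 14 3)))))))
  ))))))).

Definition colvec {R : realType} m (x : nat -> R) : 'cV[R]_m := \col_i x i.

Lemma wp_sqrt1 (R : realType) (kap : nat -> R) (eig : @spectral_oracle R) (s : @store R) x :
  0 <= x -> mats s 7 0%N 0%N = x ->
  wp kap eig (MSqrt (INat 7) (INat 7) (INat 1)) s (4%:R + kap 1%N)
    (fun s' => frame [::] [::] [:: 7] s s' /\ mats s' 7 0%N 0%N = Num.sqrt x).
Proof.
move=> x0 sx; pose N : 'M[R]_1 := (Num.sqrt x)%:M.
exists (4%:R + kap 1%N), (set_block s 7 N); split; [|exact: lexx|].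
  apply: (@ExecMSqrt R kap eig s (INat 7) (INat 7) (INat 1) N).
    split; first by apply/symmxP => i j; rewrite (ord1 i) (ord1 j).
    move=> v; rewrite /N mul_mx_scalar -scalemxAl mxE mulr_ge0 ?sqrtr_ge0 //.
    by rewrite dot_trmul dot_ge0.
  rewrite /N -scalar_mxM -expr2 sqr_sqrtr //; apply/matrixP => i j.
  by rewrite !mxE (ord1 i) (ord1 j) /= sx.
split; first by rewrite /set_block; frm.
rewrite /= /upd /=; have := @put_in R 1 1 N (mats s 7) 0 0; rewrite /= => ->.
by rewrite mxE.
Qed.

Lemma wp_update : exists K : nat, forall (R : realType) (kap : nat -> R) (eig : @spectral_oracle R)
  (m : nat) (m0 : (0 < m)%N) (s : @store R),
  let c := colvec m (mats s 2 11%N) in let g := colvec m (mats s 2 13%N) in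
  let B := block m (mats s 4) in
  ints s 1 = m ->
  wp kap eig Update s (K%:R * (m * m)%:R + kap 1%N)
   (fun s' => [/\ frame [:: 2; 3] [:: 9; 11; 14; 15] [:: 4; 7] s s',
      colvec m (mats s' 2 11%N) = next_center c B g & block m (mats s' 4) = next_shape B g]).
Proof.
eexists => R kap eig m m0 s c g B s1.
have eM (Rs Qs : seq nat) t t' : frame [:: 2; 3] Rs Qs t t' -> ints t 1 = m -> ieval t' (IV 1) = m.
  by move=> [fI _ _] e; rewrite /= fI.
have eM' (Rs Qs : seq nat) t t' : frame [:: 2] Rs Qs t t' -> ints t 1 = m -> ieval t' (IV 1) = m.
  by move=> [fI _ _] e; rewrite /= fI.
pose u := B^T *m g; pose w := cut_direction B g.
have uE j (jm : (j < m)%N) : \sum_(i < m) mats s 4 i j * mats s 2 13%N i = u (Ordinal jm) 0.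
  by rewrite mxE; apply: eq_bigr => i _; rewrite !mxE.
apply: wp_cost.
  apply: wp_bind (wp_matvec kap eig (N := m) (N' := m)
     (F := fun j i => mats s 4 i j * mats s 2 13%N i) _ _ _ _) _ => //.
    by move=> s' fr; exact: eM fr s1.
    by move=> s' fr; exact: eM fr s1.
    by move=> s' j i jm im [fI fR fQ] xj yi; rewrite /= xj yi fQ // fR.
  move=> s2 [fr2 u2]; have [fI2 fR2 fQ2] := fr2.
  have s21 : ints s2 1 = m by rewrite fI2.
  apply: wp_seq; apply: wp_run => //; set s3 := run _ s2.
  have fr3 : frame [::] [:: 9] [::] s2 s3 by rewrite /s3; frm.
  have z3 : mats s3 2 9%N 0%N = 0 by rewrite /s3 /= /upd /=.
  clearbody s3; have [fI3 fR3 fQ3] := fr3.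
  have s31 : ints s3 1 = m by rewrite fI3.
  apply: wp_bind (wp_accum kap eig (N := m)
    (F := fun j => mats s2 2 14%N j * mats s2 2 14%N j) _ _) _.
    by move=> s' fr; exact: eM' fr s31.
    by move=> s' j jm [fI fR fQ] xj; rewrite /= xj fR // fR3.
  move=> s4 [fr4 n4]; have [fI4 fR4 fQ4] := fr4.
  have nE : mats s4 2 9%N 0%N = dot u u.
    rewrite n4 z3 add0r; apply: eq_bigr => j _.
    by rewrite u2 // uE; congr (u _ 0 * u _ 0); exact: val_inj.
  apply: wp_seq; apply: wp_run => //; set s5 := run _ s4.
  have fr5 : frame [::] [::] [:: 7] s4 s5 by rewrite /s5; frm.
  have n5 : mats s5 7 0%N 0%N = dot u u by rewrite /s5 /= /upd /= nE.
  clearbody s5; have [fI5 fR5 fQ5] := fr5.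
  apply: wp_bind (wp_sqrt1 kap eig (dot_ge0 u) n5) _ => s6 [fr6 n6].
  have [fI6 fR6 fQ6] := fr6.
  have s61 : ints s6 1 = m by rewrite fI6 // fI5 // fI4.
  apply: wp_bind (wp_vec kap eig (N := m)
    (F := fun j => mats s2 2 14%N j / Num.sqrt (dot u u)) _ _) _.
    by move=> s' fr; exact: eM' fr s61.
    move=> s' j jm [fI fR fQ] xj cell; rewrite /= xj cell fQ // n6 fR6 // fR5 // fR4 // fR3 //.
  move=> s7 [fr7 w7]; have [fI7 fR7 fQ7] := fr7.
  have s71 : ints s7 1 = m by rewrite fI7.
  have wE (j : 'I_m) : mats s7 2 14%N j = w j 0.
    rewrite w7 // u2 // uE (_ : Ordinal _ = j); last exact: val_inj.
    by rewrite mulrC /w /cut_direction [RHS]mxE.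
  have s74 : mats s7 4 = mats s 4 by rewrite fQ7 // fQ6 // fQ5 // fQ4 // fQ3 // fQ2.
  have s7c : mats s7 2 11%N = mats s 2 11%N by rewrite fR7 // fR6 // fR5 // fR4 // fR3 // fR2.
  apply: wp_bind (wp_matvec kap eig (N := m) (N' := m)
     (F := fun i j => mats s 4 i j * mats s7 2 14%N j) _ _ _ _) _ => //.
    by move=> s' fr; exact: eM fr s71.
    by move=> s' fr; exact: eM fr s71.
    by move=> s' i j im jm [fI fR fQ] xi yj; rewrite /= xi yj fQ // s74 fR.
  move=> s8 [fr8 v8]; have [fI8 fR8 fQ8] := fr8.
  have s81 : ints s8 1 = m by rewrite fI8.
  have vE (i : 'I_m) : mats s8 2 15%N i = (B *m w) i 0.
    by rewrite v8 // !mxE; apply: eq_bigr => j _; rewrite wE !mxE.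
  apply: wp_bind (wp_vec kap eig (N := m)
    (F := fun i => mats s 2 11%N i - step_xi m * mats s8 2 15%N i) _ _) _.
    by move=> s' fr; exact: eM' fr s81.
    move=> s' i im [fI fR fQ] xi cell; rewrite /= xi cell (fR 15%N) // fI // s81 natrM fR8 // s7c.
    by [].
  move=> s9 [fr9 c9]; have [fI9 fR9 fQ9] := fr9.
  have s91 : ints s9 1 = m by rewrite fI9.
  apply: wp_le (wp_mat kap eig (N1 := m) (N2 := m)
    (F := fun i j => step_alpha m * mats s 4 i j +
        (step_sigma m - step_alpha m) * (mats s8 2 15%N i * mats s7 2 14%N j)) _ _ _ _ _) (lexx _) _ => //.
    by move=> s' fr; exact: eM fr s91.
    by move=> s' fr; exact: eM fr s91.
    move=> s' i j im jm [fI fR fQ] xi yj cell; rewrite /= xi yj cell (fR 15%N) // (fR 14%N) // fI // s91.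
    rewrite (fR9 15%N) // (fR9 14%N) // (fR8 14%N) // fQ9 // fQ8 // s74.
    have -> : 1%:R + 1%:R / (25 * (m * m))%N%:R = step_alpha m :> R.
      rewrite /step_alpha /step_xi expr_div_n expr1n !natrM expr2; congr (_ + _ / _); ring.
    by rewrite natrM.
  move=> s10 [fr10 B10]; have [fI10 fR10 fQ10] := fr10; split.
  - have f1 : frame [:: 2; 3] [:: 9; 14] [::] s s3 by apply: (frame_comp fr2 fr3).
    have f2 : frame [:: 2; 3] [:: 9; 14] [::] s s4 by apply: (frame_comp f1 fr4).
    have f3 : frame [:: 2; 3] [:: 9; 14] [:: 7] s s5 by apply: (frame_comp f2 fr5).
    have f4 : frame [:: 2; 3] [:: 9; 14] [:: 7] s s6 by apply: (frame_comp f3 fr6).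
    have f5 : frame [:: 2; 3] [:: 9; 14] [:: 7] s s7 by apply: (frame_comp f4 fr7).
    have f6 : frame [:: 2; 3] [:: 9; 14; 15] [:: 7] s s8 by apply: (frame_comp f5 fr8).
    have f7 : frame [:: 2; 3] [:: 9; 11; 14; 15] [:: 7] s s9 by apply: (frame_comp f6 fr9).
    by apply: (frame_comp f7 fr10).
  - apply/matrixP => i j; rewrite (ord1 j) mxE fR10 // c9 // !mxE vE !mxE.
    by [].
  - apply/matrixP => i j; rewrite mxE B10 // /next_shape /shrink mulmxDr -scalemxAr mul_mx_scalar.
    rewrite mulmxA !mxE big_ord1 vE wE !mxE; congr (_ + _ * (_ * _)).
pose U : R := (m * m)%:R.
have R2 : forall k : nat, (0 < k)%N -> 1 <= k%:R :> R by move=> k k0; rewrite ler1n.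
have U1 : 1 <= U by rewrite R2 // muln_gt0 m0.
have mU : m%:R <= U by rewrite ler_nat leq_pmulr.
have loop c' k' : m.+1%:R * (c'%:R + k'%:R) <= (2 * (c' + k'))%:R * U :> R.
  exact: cost_loop.
apply: le_trans.
  apply: (@cost_adde _ _ _ _ _ U).
    apply: cost_e0; apply: (@cost_for _ _ _ _ _ m%:R) => //; [exact: R2| |by rewrite -natrM].
    apply: cost_add; first by apply: cost_const; exact: R2.
    exact: cost_loop.
  apply: cost_adde; first by apply/cost_e0/cost_const.
  apply: cost_adde; first by apply/cost_e0/loop.
  apply: cost_adde; first by apply/cost_e0/cost_const.
  apply: cost_adde; first exact: cost_instr.
  apply: cost_adde; first by apply/cost_e0/loop.
  apply: cost_adde.
    apply: cost_e0; apply: (@cost_for _ _ _ _ _ m%:R) => //; [exact: R2| |by rewrite -natrM].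
    apply: cost_add; first by apply: cost_const; exact: R2.
    exact: cost_loop.
  apply: cost_adde; first by apply/cost_e0/loop.
  apply: cost_e0; apply: (@cost_for _ _ _ _ _ m%:R) => //; [exact: R2| |by rewrite -natrM].
  exact: cost_loop.
rewrite -/U; apply: lerD; [exact: lexx|lra].
Qed.

Definition NormSquare (r : nat) : cmd :=
  Seq (SetV 9 (RNat (INat 0))) (For 2 (IV 1) (SetV 9 (RAdd (RV 9) (RMul (RVec r 2) (RVec r 2))))).

Definition Output : cmd :=
  For 3 (IV 0) (For 4 (IV 0)
    (SetMat 0 3 4 (RMul (RLoad (INat 2) (INat 0) (INat 1)) (RMat 6 3 4)))).

Definition CheckStop : cmd :=
  Seq (NormSquare 13)
    (If (TRLe (RV 9) (RDiv (RNat (INat 1)) (HPow 26))) (Seq (SetI 9 (INat 1)) Output) Skip).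

(** A center outside the ball of radius [h^10] serves as its own cut: by Cauchy-Schwarz no point of
    that ball is removed. Gradients are therefore computed only at bounded centers, where no digit
    overflows. *)
Definition ChooseCut : cmd :=
  Seq (NormSquare 11)
    (If (TRLe (RV 9) (HPow 20)) (Seq Gradient CheckStop)
        (For 2 (IV 1) (SetVec 13 2 (RVec 11 2)))).

(** After the flag is raised, [Update] still runs once; it leaves matrix 0, which holds the result,
    alone. *)
Definition MainLoop : cmd := While (TILe (IV 9) (INat 0)) (Seq ChooseCut Update).

Definition Solve : cmd := Seq Preprocess MainLoop.

Lemma wp_norm_square r : exists K : nat, forall (R : realType) (kap : nat -> R) (eig : @spectral_oracle R)
  (m : nat) (s : @store R), (0 < m)%N -> r != 9%N -> ints s 1 = m ->
  wp kap eig (NormSquare r) s (K%:R * m%:R)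
   (fun s' => frame [:: 2] [:: 9] [::] s s' /\
      mats s' 2 9%N 0%N = dot (colvec m (mats s 2 r)) (colvec m (mats s 2 r))).
Proof.
eexists => R kap eig m s m0 r9 s1; have m1 : 1 <= m%:R :> R by rewrite ler1n.
apply: wp_cost.
  apply: wp_seq; apply: wp_run => //; set s2 := run _ s.
  have fr2 : frame [::] [:: 9] [::] s s2 by rewrite /s2; frm.
  have z2 : mats s2 2 9%N 0%N = 0 by rewrite /s2 /= /upd /=.
  clearbody s2; have [fI2 fR2 fQ2] := fr2.
  have rN : r \notin [:: 9] by rewrite inE.
  apply: wp_le (wp_accum kap eig (N := m) (F := fun j => mats s 2 r j * mats s 2 r j) _ _) (lexx _) _.
    by move=> s' [fI _ _]; rewrite /= fI // fI2.
    by move=> s' j jm [fI fR fQ] xj; rewrite /= xj fR // fR2.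
  move=> s3 [fr3 n3]; split; first by apply: (frame_comp fr2 fr3).
  by rewrite n3 z2 add0r; apply: eq_bigr => j _; rewrite !mxE.
apply: cost_add; first exact: cost_const.
exact: cost_loop.
Qed.

Section StoppingCondition.
Context {R : realType} (eig : @spectral_oracle R) {m n : nat}.

Definition approx_gradient (C : 'M[R]_n) (A : 'I_m -> 'M[R]_n) (b : 'cV[R]_m) (h : R)
    (ct gt : 'cV[R]_m) :=
  (forall i, `|ct i 0| <= h ^+ 10) /\
  (forall i, `|gt i 0 - dualg eig C A b (h ^- 4) (h ^- 13) ct i 0| <= h ^- 58).

Definition solved (C : 'M[R]_n) (A : 'I_m -> 'M[R]_n) (b : 'cV[R]_m) (h rho : R) (s : @store R) :=
  exists ct gt, [/\ approx_gradient C A b h ct gt, dot gt gt <= h ^- 26 &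
    forall i j : 'I_n, mats s 0 i j = rho * primal eig C A (h ^- 4) ct i j].
End StoppingCondition.

Lemma wp_check_stop : exists K : nat, forall (R : realType) (kap : nat -> R) (eig : @spectral_oracle R)
  (n m sb : nat) (n0 : (0 < n)%N) (m0 : (0 < m)%N) (sb0 : (0 < sb)%N) (a c : R) (s0 s : @store R),
  let h : R := (2 ^ sb)%:R in
  let g := colvec m (mats s 2 13%N) in
  setup n m sb a c s0 s ->
  wp kap eig CheckStop s (K%:R * ((n * n + m * m) * sb)%:R)
  (fun s' => frame [:: 3; 4; 2; 9] [:: 9] [:: 0] s s' /\
     ([/\ ints s' 9 = 1%N, dot g g <= h ^- 26 &
        forall i j, (i < n)%N -> (j < n)%N -> mats s' 0 i j = mats s0 2 0%N 1%N * mats s 6 i j] \/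
      [/\ ints s' 9 = ints s 9, mats s' 0 = mats s 0 & h ^- 26 < dot g g])).
Proof.
have [KN wp_norm_square] := wp_norm_square 13.
eexists => R kap eig n m sb n0 m0 sb0 a c s0 s h g S.
have hE k : ((2 ^ sb) ^ k)%:R = h ^+ k :> R by rewrite natrX.
pose U : R := ((n * n + m * m) * sb)%:R.
have U1 : 1 <= U by rewrite ler1n !muln_gt0 addn_gt0 !muln_gt0 n0.
have leU k : (k <= (n * n + m * m) * sb)%N -> k%:R <= U by rewrite ler_nat.
have mU : m%:R <= U by apply: leU; nia.
have nnU : n%:R * n%:R <= U by rewrite -natrM; apply: leU; nia.
have R2 : forall k : nat, (0 < k)%N -> 1 <= k%:R :> R by move=> k k0; rewrite ler1n.
pose kO := (lcost (SetI 9 (INat 1)) + (2 * (2 * (lcost (SetMat 0 3 4 (RMul (RLoad (INat 2) (INat 0) (INat 1)) (RMat 6 3 4))) +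
   (icost (IV 0) + 14)) + (icost (IV 0) + 14))))%N.
apply: wp_cost.
  apply: wp_seq; apply: wp_le (wp_norm_square R kap eig m s m0 isT (setup_m S)) (cost_le (lexx _) mU) _.
  move=> s3 [fr3 n3]; have [fI3 fR3 fQ3] := fr3.
  have S3 : setup n m sb a c s0 s3 by apply: setup_frame fr3 S; apply/allP.
  have [s38 s37] := setup_scaled S3.
  apply: (@wp_if _ _ _ _ _ _ _ (kO%:R * U)); first by rewrite mulr_ge0 // (le_trans _ U1).
  + rewrite /= ieval_ipow /= s37 hE n3 mulr1n div1r => small.
    apply: wp_cost.
      apply: wp_seq; apply: wp_run => //; set s4 := run _ s3.
      have fr4 : frame [:: 9] [::] [::] s3 s4 by rewrite /s4; frm.
      have f4 : ints s4 9 = 1%N by rewrite /s4 /= /upd.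
      clearbody s4; have [fI4 fR4 fQ4] := fr4.
      apply: wp_le (wp_mat kap eig (N1 := n) (N2 := n)
        (F := fun i j => mats s0 2 0%N 1%N * mats s 6 i j) _ _ _ _ _) (lexx _) _ => //.
        by move=> s' [fI _ _]; rewrite /= fI // fI4 // (setup_n S3).
        by move=> s' [fI _ _]; rewrite /= fI // fI4 // (setup_n S3).
        move=> s' i j im jm [fI fR fQ] xi yj cell.
        by rewrite /= xi yj (fQ 6%N) // (fQ4 6%N) // (fQ3 6%N) // fR // fR4 // (setup_rho S3).
      move=> s5 [fr5 O5]; have [fI5 fR5 fQ5] := fr5; split.
        have f04 : frame [:: 2; 9] [:: 9] [::] s s4 by apply: (frame_comp fr3 fr4).
        by apply: (frame_comp f04 fr5).
      by left; split=> //; rewrite fI5.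
    apply: cost_add; first exact: cost_const.
    apply: (@cost_for _ _ _ _ _ n%:R) => //; [exact: R2|].
    exact: cost_loop.
  rewrite /= ieval_ipow /= s37 hE n3 mulr1n div1r -ltNge => big.
  apply: wp_le (wp_run kap eig (c := Skip) (s := s3) (Q := fun s' => s' = s3) isT erefl) _ _.
    by rewrite -[leLHS]mulr1 ler_pM // ler_nat.
  move=> _ ->; split; first by apply: (frame_comp fr3 (frame_refl [::] [::] [::] s3)).
  by right; split; [rewrite fI3|rewrite fQ3|].
apply: cost_add; first exact: lexx.
by apply: cost_add; [exact: cost_const|exact: lexx].
Qed.

Lemma wp_choose_cut : exists K : nat, forall (R : realType) (kap : nat -> R) (eig : @spectral_oracle R)
  (eigP : spectral_oracle_spec eig)
  (n m sb : nat) (n0 : (0 < n)%N) (m0 : (0 < m)%N) (sb0 : (0 < sb)%N) (a c : R) (s0 s : @store R),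
  let h : R := (2 ^ sb)%:R in
  let C := normalized_C n c (mats s0) in
  let A := @rounded_A R m n sb a (mats s0) in
  let b := normalized_b m a (mats s0) in
  let x := colvec m (mats s 2 11%N) in
  100 <= h -> m%:R <= h -> n%:R <= h -> 0 <= kap n ->
  (forall i p q, (i < m)%N -> (p < n)%N -> (q < n)%N -> `|mats s0 (i + 3) p q / a| <= 1) ->
  (forall i j, `|C i j| <= 1) -> C \is symmetricmx -> (forall i, A i \is symmetricmx) ->
  (forall i p q, `|A i p q| <= 1) ->
  setup n m sb a c s0 s -> ints s 9 = 0%N ->
  wp kap eig ChooseCut s (K%:R * ((n * n + m * m) * sb)%:R + 2 * kap n)
  (fun s' => let g := colvec m (mats s' 2 13%N) in
    [/\ frame [:: 2; 3; 4; 5; 6; 9] [:: 3; 4; 9; 10; 12; 13] [:: 0; 3; 5; 6] s s' &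
     [\/ ints s' 9 = 1%N /\ solved eig C A b h (mats s0 2 0%N 1%N) s',
         [/\ ints s' 9 = 0%N, mats s' 0 = mats s 0, h ^+ 20 < dot x x & g = x] |
         [/\ ints s' 9 = 0%N, mats s' 0 = mats s 0, h ^- 26 < dot g g &
             exists2 ct, approx_gradient eig C A b h ct g & forall i, `|ct i 0 - x i 0| <= h ^- 60]]]).
Proof.
have [KN wp_norm_square] := wp_norm_square 11; have [KG wp_gradient] := wp_gradient.
have [KS wp_check_stop] := wp_check_stop.
pose kC := (2 * (lcost (SetVec 13 2 (RVec 11 2)) + (icost (IV 1) + 14)))%N.
eexists => R kap eig eigP n m sb n0 m0 sb0 a c s0 s h C A b x h100 mh nh kap0 A1 C1 sC sA Ah1 S s9.
have h2 : 2 <= h := pow_ge2 sb0.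
have hX k : 0 < h ^+ k by rewrite exprn_gt0 // (lt_le_trans _ h2).
have hE k : ((2 ^ sb) ^ k)%:R = h ^+ k :> R by rewrite natrX.
pose U : R := ((n * n + m * m) * sb)%:R.
have U1 : 1 <= U by rewrite ler1n !muln_gt0 addn_gt0 !muln_gt0 n0.
have U0 : 0 <= U by rewrite (le_trans _ U1).
have leU k : (k <= (n * n + m * m) * sb)%N -> k%:R <= U by rewrite ler_nat.
have mU : m%:R <= U by apply: leU; nia.
have R2 : forall k : nat, (0 < k)%N -> 1 <= k%:R :> R by move=> k k0; rewrite ler1n.
apply: wp_cost.
  apply: wp_seq; apply: wp_le (wp_norm_square R kap eig m s m0 isT (setup_m S)) (cost_le (lexx _) mU) _.
  move=> s1 [fr1 n1]; have [fI1 fR1 fQ1] := fr1.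
  have S1 : setup n m sb a c s0 s1 by apply: setup_frame fr1 S; apply/allP.
  have [s18 s17] := setup_scaled S1.
  have x1 : mats s1 2 11%N = mats s 2 11%N by rewrite fR1.
  apply: (@wp_if _ _ _ _ _ _ _ ((KG%:R * U + 2 * kap n) + (KS%:R * U + kC%:R * U))).
  - by rewrite !addr_ge0 // ?mulr_ge0.
  - rewrite /= ieval_ipow /= s17 hE n1 => xx.
    have cb i : (i < m)%N -> `|mats s1 2 11%N i| <= h ^+ 10.
      move=> im; have := le_trans (dot_entry x (Ordinal im)) xx; rewrite mxE x1 /=.
      by rewrite -(real_normK (num_real _)) (exprM h 10 2) ler_pXn2r ?nnegrE ?(ltW (hX _)).
    set ct := rounded_center m sb (mats s1 2 11%N).
    have ctP i : `|ct i 0| <= h ^+ 10 /\ `|ct i 0 - x i 0| <= h ^- 60.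
      have [/andP[r1 r2] r3 _] := @round_scaledP R sb sb0 10 _ (cb i (ltn_ord i)).
      rewrite !mxE -x1; split.
        by rewrite normrM normfV (gtr0_norm (hX 60)) ler_pdivrMr // -exprD.
      rewrite distrC; move: r1 r2; set v := mats s1 _ _ _; set w := round_scaled _ _ _ => r1 r2.
      have -> : v - w / h ^+ 60 = (v * h ^+ 60 - w) * h ^- 60.
        by field; rewrite pnatr_eq0 -lt0n expn_gt0.
      by rewrite normrM normfV (gtr0_norm (hX 60)) ger0_norm // -[leRHS]mul1r ler_pM2r ?invr_gt0.
    have pb i j : `|primal eig C A (h ^- 4) ct i j| <= h ^+ 17.
      have := primal_entry eigP sC sA C1 Ah1 h100 mh nh i j (fun k => (ctP k).1).
      have := @lt_powS R sb sb0 16; rewrite -/h; lra.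
    apply: wp_cost.
      apply: wp_bind (wp_gradient R kap eig eigP n m sb n0 m0 sb0 a c s0 s1 h100 mh nh A1 C1 sC sA pb S1 cb) _.
      move=> s2 [fr2 X2 g2]; have [fI2 fR2 fQ2] := fr2.
      have S2 : setup n m sb a c s0 s2 by apply: setup_frame fr2 S1; apply/allP.
      have f02 : frame [:: 2; 3; 4; 5; 6] [:: 3; 4; 9; 10; 12; 13] [:: 3; 5; 6] s s2 by apply: (frame_comp fr1 fr2).
      have [fI02 fR02 fQ02] := f02.
      have ag : approx_gradient eig C A b h ct (colvec m (mats s2 2 13%N)).
        split=> i; first exact: (ctP i).1.
        by rewrite mxE.
      apply: wp_le (wp_check_stop R kap eig n m sb n0 m0 sb0 a c s0 s2 S2) (lexx _) _.
      move=> s3 [fr3 res]; have [fI3 fR3 fQ3] := fr3.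
      split; first by apply: (frame_comp f02 fr3).
      have g3 : mats s3 2 13%N = mats s2 2 13%N by rewrite fR3.
      case: res => [[e9 small O3]|[e9 e0 big]].
        apply: Or31; split=> //; exists ct, (colvec m (mats s2 2 13%N)); split=> // i j.
        by rewrite O3 // X2.
      apply: Or33; split; [by rewrite e9 fI02|by rewrite e0 fQ02|by rewrite g3|].
      exists ct; first by rewrite g3.
      by move=> i; exact: (ctP i).2.
    by rewrite lerD2l lerDl mulr_ge0.
  - rewrite /= ieval_ipow /= s17 hE n1 -ltNge => xx.
    apply: wp_cost.
      apply: wp_le (wp_vec kap eig (N := m) (F := fun j => mats s 2 11%N j) _ _) (lexx _) _.
        by move=> s' [fI _ _]; rewrite /= fI // (setup_m S1).
        by move=> s' j jm [fI fR fQ] xj cell; rewrite /= xj fR // x1.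
      move=> s2 [fr2 g2]; have f02 : frame [:: 2] [:: 9; 13] [::] s s2 by apply: (frame_comp fr1 fr2).
      have [fI02 fR02 fQ02] := f02.
      split; first by apply: (frame_comp f02 (frame_refl [::] [::] [::] s2)).
      apply: Or32; split; [by rewrite fI02|by rewrite fQ02|by []|].
      by apply/matrixP => i j; rewrite !mxE g2.
    have K0 : 0 <= KG%:R * U + 2 * kap n + KS%:R * U by rewrite !addr_ge0 // mulr_ge0.
    apply: le_trans (_ : kC%:R * U <= _); last by lra.
    exact: cost_loop.
apply: le_trans.
  apply: (@cost_adde _ _ _ _ _ U); first exact/cost_e0/lexx.
  apply: cost_adde; first by apply/cost_e0/cost_const.
  apply: cost_adde; first exact: lexx.
  by apply: cost_adde; apply/cost_e0/lexx.
rewrite -/U; apply: lerD; [exact: lexx|lra].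
Qed.

Lemma wp_main_loop : exists K : nat, forall (R : realType) (kap : nat -> R) (eig : @spectral_oracle R)
  (eigP : spectral_oracle_spec eig)
  (n m sb : nat) (n0 : (0 < n)%N) (m0 : (0 < m)%N) (sb0 : (0 < sb)%N) (a c : R) (s0 s : @store R)
  (Z : 'M[R]_n),
  let h : R := (2 ^ sb)%:R in
  let C := normalized_C n c (mats s0) in
  let A := @rounded_A R m n sb a (mats s0) in
  let b := normalized_b m a (mats s0) in
  100 <= h -> m%:R <= h -> n%:R <= h -> 0 <= kap n -> 0 <= kap 1%N ->
  (forall i p q, (i < m)%N -> (p < n)%N -> (q < n)%N -> `|mats s0 (i + 3) p q / a| <= 1) ->
  (forall i j, `|C i j| <= 1) -> C \is symmetricmx -> (forall i, A i \is symmetricmx) ->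
  (forall i p q, `|A i p q| <= 1) ->
  psdmx Z -> (forall i j, `|Z i j| <= 1) -> (forall i, `|mxdot (A i) Z - b i 0| <= h ^- 58) ->
  setup n m sb a c s0 s -> ints s 9 = 0%N ->
  (forall j, (j < m)%N -> mats s 2 11%N j = 0) ->
  (forall i j, (i < m)%N -> (j < m)%N -> mats s 4 i j = h ^+ 10 * (i == j)%:R) ->
  wp kap eig MainLoop s ((300 * (m * m * sb)).+1%:R *
      (K%:R * ((n * n + m * m) * sb)%:R + 2 * kap n + kap 1%N))
   (solved eig C A b h (mats s0 2 0%N 1%N)).
Proof.
have [KC wp_choose_cut] := wp_choose_cut; have [KU wp_update] := wp_update.
exists (KC + KU + 10)%N => R kap eig eigP n m sb n0 m0 sb0 a c s0 s Z h C A b h100 mh nh kap0 kap10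
  A1 C1 sC sA Ah1 pZ Z1 Zb S s9 x0 B0.
have h2 : 2 <= h := pow_ge2 sb0.
have hX k : 0 < h ^+ k by rewrite exprn_gt0 // (lt_le_trans _ h2).
pose U : R := ((n * n + m * m) * sb)%:R.
have U1 : 1 <= U by rewrite ler1n !muln_gt0 addn_gt0 !muln_gt0 n0.
have U0 : 0 <= U by rewrite (le_trans _ U1).
have mmU : (m * m)%:R <= U by rewrite ler_nat; nia.
have [yh [yhP yhB]] := near_min_exists eigP sC sA C1 h100 mh nh pZ Z1 Zb.
have BE : block m (mats s 4) = (h ^+ 10)%:M.
  by apply/matrixP => i j; rewrite !mxE B0 // -[RHS]mulr_natr.
pose Ball (y : 'cV[R]_m) := dot (y - yh) (y - yh) <= (h ^- 22) ^+ 2.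
pose E k s' := ellipsoid_bound Ball ((h ^+ 10) ^+ m * step_rate m ^+ k)
   (colvec m (mats s' 2 11%N)) (block m (mats s' 4)).
(* Either the result is ready, and nothing is claimed about the ellipsoid any more, or the ellipsoid
   still contains the ball around [yh], a point that occurs only in the analysis. *)
pose I k s' := (ints s' 9 = 1%N /\ solved eig C A b h (mats s0 2 0%N 1%N) s') \/
   [/\ ints s' 9 = 0%N, setup n m sb a c s0 s' & E k s'].
have fl k s' : I k s' -> teval s' (TILe (IV 9) (INat 0)) -> [/\ ints s' 9 = 0%N, setup n m sb a c s0 s' & E k s'].
  by move=> [[e9 _]|//] /=; rewrite e9.
pose T := KC%:R * U + 2 * kap n + (KU%:R * (m * m)%:R + kap 1%N).
apply: wp_le (wp_while (N := (300 * (m * m * sb))%N) (T := T) (I := I) _ _ _) _ _.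
- by rewrite /T !addr_ge0 // mulr_ge0.
- right; split=> //; split.
  + move=> y /yhB yy; exists (h ^- 10 *: y).
      rewrite dotZl dotZr mulrA -invfM -exprD mulrC ler_pdivrMr // mul1r; exact: yy.
    have -> : colvec m (mats s 2 11%N) = 0 by apply/matrixP => i j; rewrite !mxE x0.
    rewrite BE.
    by rewrite add0r mul_scalar_mx scalerA divff ?scale1r // gt_eqF.
  + by rewrite BE det_scalar exprn_gt0.
  by rewrite BE det_scalar expr0 mulr1.
- move=> k s' Ik tb; have [e9 S' E'] := fl _ _ Ik tb; split.
    exact: (ellipsoid_iteration_bound eigP m0 sb0 E').
  apply: wp_bind (wp_choose_cut R kap eig eigP n m sb n0 m0 sb0 a c s0 s' h100 mh nh kap0 A1 C1 sC sA Ah1 S' e9) _.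
  move=> s1 [fr1 res]; have [fI1 fR1 fQ1] := fr1.
  have m1 : ints s1 1 = m by rewrite fI1 // (setup_m S').
  apply: wp_le (wp_update R kap eig m m0 s1 m1) (lexx _) _ => s2 [fr2 c2 B2].
  have [fI2 fR2 fQ2] := fr2.
  set x := colvec m (mats s' 2 11%N) in res; set g := colvec m (mats s1 2 13%N) in res c2 B2.
  have x1 : colvec m (mats s1 2 11%N) = x by rewrite /x -fR1.
  have next : ints s1 9 = 0%N -> mats s1 0 = mats s' 0 -> 0 < dot g g ->
      (forall y, Ball y -> dot g (y - x) <= 0) -> I k.+1 s2.
    move=> z9 C0 g0 cut; right; split; first by rewrite fI2.
      have f1 : frame [:: 2; 3; 4; 5; 6; 9] [:: 3; 4; 9; 10; 12; 13] [:: 3; 5; 6] s' s1.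
        split=> // q q2 qN; have [->//|q0] := eqVneq q 0%N.
        by apply: fQ1 => //; rewrite inE negb_or q0.
      have f2 : frame [:: 2; 3; 4; 5; 6; 9] [:: 3; 4; 9; 10; 11; 12; 13; 14; 15] [:: 3; 4; 5; 6; 7] s' s2.
        by apply: (frame_comp f1 fr2).
      by apply: setup_frame f2 S'; apply/allP.
    rewrite /E c2 B2 x1 (exprSr (step_rate m)) mulrA; apply: ellipsoid_iterate => //.
    by rewrite fQ1 //; exact: E'.
  case: res => [[z9 sol]|[z9 C0 xx gx]|[z9 C0 gg [ct [ctR gtE] ctx]]].
  + left; split; first by rewrite fI2.
    have [ct [gt [h1 h3 h4]]] := sol; exists ct, gt; split=> // i j.
    by rewrite fQ2.
  + apply: next => //; first by rewrite gx (lt_trans _ xx).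
    move=> y /yhB yy; rewrite gx dotBr subr_le0.
    have xp : 0 < dot x x by rewrite (lt_trans _ xx).
    have H := dot_CS x y; have H1 : dot x y ^+ 2 <= dot x x ^+ 2.
      apply: le_trans H _; rewrite expr2 ler_pM2l //; exact: le_trans yy (ltW xx).
    by move: H1; rewrite -(real_normK (num_real (dot x y))) ler_pXn2r ?nnegrE ?(ltW xp) // => /(le_trans (ler_norm _)).
  + apply: next => //; first by rewrite (lt_trans _ gg) // invr_gt0.
    move=> y By.
    exact: (inexact_cut eigP sC sA C1 Ah1 h100 mh nh Z1 Zb ctR gtE yhP yhB ctx gg By).
- rewrite ler_wpM2l // /T; have H : KU%:R * (m * m)%:R <= KU%:R * U by rewrite ler_wpM2l.
  have tc : (tcost (TILe (IV 9) (INat 0)))%:R <= 10 * U :> R.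
    by apply: le_trans (_ : 10 <= _); [rewrite ler_nat|rewrite -[leLHS]mulr1 ler_wpM2l].
  rewrite !natrD !mulrDl; move: tc H; rewrite -/U; set t := (tcost _)%:R; lra.
move=> s' [ft [k Ik]]; case: Ik => [[_ sol] //|[e9 _ _]].
by move: ft; rewrite /= e9.
Qed.

(** * Norms and the exponent of matrix multiplication *)

Section NormBounds.
Context {R : realType} (eig : @spectral_oracle R) (eigP : spectral_oracle_spec eig).

Lemma euclidean_normE n (v : 'cV[R]_n) : euclidean_norm v = Num.sqrt (dot v v).
Proof. by rewrite /euclidean_norm; congr Num.sqrt; apply: eq_bigr => i _; rewrite expr2. Qed.

Lemma dot_mulmx_le n (A : 'M[R]_n) (v : 'cV[R]_n) :
  dot (A *m v) (A *m v) <= mxdot A A * dot v v.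
Proof.
rewrite /dot /mxdot mulr_suml; apply: ler_sum => i _; rewrite mxE -expr2.
apply: le_trans (CauchySchwarz_sum (fun j => A i j) (fun j => v j 0)) _.
by rewrite le_eqVlt; apply/orP; left; apply/eqP; congr (_ * _); apply: eq_bigr => j _; rewrite expr2.
Qed.

(** The supremum is tested on a basis vector; that its set is bounded follows from the Frobenius
    norm. *)
Lemma le_spectral_norm n (A : 'M[R]_n) i j : `|A i j| <= spectral_norm A.
Proof.
pose v : 'cV[R]_n := delta_mx j 0.
have vv : dot v v = 1.
  rewrite /dot (bigD1 j) //= !mxE !eqxx mulr1 big1 ?addr0 // => k /negPf kj.
  by rewrite !mxE kj mul0r.
have Av : (A *m v) i 0 = A i j.
  rewrite mxE (bigD1 j) //= mxE !eqxx mulr1 big1 ?addr0 // => k /negPf kj.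
  by rewrite mxE kj mulr0.
apply: (@le_trans _ _ (euclidean_norm (A *m v))).
  rewrite euclidean_normE -sqrtr_sqr; apply: ler_wsqrtr.
  by rewrite -Av; exact: dot_entry.
apply: ub_le_sup; last first.
  by exists v => //=; rewrite euclidean_normE vv sqrtr1.
exists (Num.sqrt (mxdot A A)) => _ [w /= w1 <-]; rewrite euclidean_normE; apply: ler_wsqrtr.
have w1' : dot w w <= 1.
  by move: w1; rewrite euclidean_normE -[X in _ <= X]sqrtr1 ler_sqrt.
by apply: le_trans (dot_mulmx_le A w) _; rewrite -[leRHS]mulr1 ler_wpM2l // mxdot_ge0.
Qed.

Lemma char_poly_conj n (U : 'M[R]_n) (d : 'rV[R]_n) : U *m U^T = 1%:M ->
  char_poly (U *m diag_mx d *m U^T) = \prod_(i < n) ('X - (d 0 i)%:P).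
Proof.
move=> UU; have -> : \prod_(i < n) ('X - (d 0 i)%:P) = char_poly (diag_mx d).
  by rewrite char_poly_trig ?diag_mx_is_trig //; apply: eq_bigr => i _; rewrite mxE eqxx.
rewrite /char_poly; pose V := map_mx (@polyC R) U.
have VV : V *m (map_mx (@polyC R) U^T) = 1%:M by rewrite -map_mxM UU map_mx1.
have -> : char_poly_mx (U *m diag_mx d *m U^T) =
    V *m char_poly_mx (diag_mx d) *m map_mx (@polyC R) U^T.
  rewrite /char_poly_mx mulmxBr mulmxBl !map_mxM /=; congr (_ - _).
  by rewrite mul_mx_scalar -scalemxAl VV scale_scalar_mx mulr1.
by rewrite !det_mulmx mulrAC -det_mulmx VV det1 mul1r.
Qed.

(** The absolute values of the eigenvalues qualify, so the choice in [singular_values] does not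
    return its default. *)
Lemma singular_valuesP n (A : 'M[R]_n) : A \is symmetricmx ->
  (forall i, 0 <= singular_values A 0 i) /\
  char_poly (A^T *m A) = \prod_(i < n) ('X - (singular_values A 0 i ^+ 2)%:P).
Proof.
move=> sA; apply: (xgetPex 0
  (P := [set s : 'rV[R]_n | (forall i, 0 <= s 0 i) /\
    char_poly (A^T *m A) = \prod_(i < n) ('X - (s 0 i ^+ 2)%:P)])).
have [U [d [UU UU' defA]]] := spectral_decomposition eigP sA.
exists (map_mx Num.norm d); split=> /= [i|]; first by rewrite mxE.
rewrite (symmx_tr sA) defA (spectral_mul _ _ UU') char_poly_conj //.
by apply: eq_bigr => i _; rewrite !mxE real_normK ?num_real // expr2.
Qed.

(** [A_ij^2 <= <A,A>], which is the sum of the [s_k^2] and hence at most the square of the sum of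
    the [s_k]. The singular values being given through a characteristic polynomial, the equality is
    read off its coefficient of degree [n - 1]. *)
Lemma le_schatten1_norm n (A : 'M[R]_n) i j : A \is symmetricmx -> `|A i j| <= schatten1_norm A.
Proof.
move=> sA; have [s0 cp] := singular_valuesP sA.
set s := singular_values A in s0 cp.
have n0 : (0 < n)%N by exact: leq_ltn_trans (ltn_ord i).
have tr : mxdot A A = \sum_k s 0 k ^+ 2.
  have := char_poly_trace (A^T *m A) n0; rewrite cp -mxdot_tr.
  rewrite -(big_map (fun k => s 0 k ^+ 2) xpredT (fun x => 'X - x%:P)).
  set ps := map _ _; have sz : size ps = n.
    rewrite size_map; transitivity (size (enum 'I_n)); last exact: size_enum_ord.
    apply: perm_size; apply: uniq_perm => [||x].
    - exact: index_enum_uniq.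
    - exact: enum_uniq.
    - by rewrite mem_index_enum mem_enum.
  rewrite -{1}sz coefPn_prod_XsubC ?sz -?lt0n // big_map => /eqP.
  by rewrite eqr_opp => /eqP <-.
have S0 : 0 <= schatten1_norm A by apply: sumr_ge0 => k _; exact: s0.
have le1 k : s 0 k <= schatten1_norm A.
  by rewrite /schatten1_norm (bigD1 k) //= lerDl sumr_ge0 // => l _; exact: s0.
have : A i j ^+ 2 <= schatten1_norm A ^+ 2.
  apply: le_trans (mxdot_entry A i j) _; rewrite tr.
  rewrite expr2 {1}/schatten1_norm mulr_suml; apply: ler_sum => k _.
  by rewrite expr2 ler_wpM2l.
by rewrite -(real_normK (num_real (A i j))) ler_pXn2r ?nnegrE.
Qed.

Lemma schatten1_norm_ge0 n (A : 'M[R]_n) : A \is symmetricmx -> 0 <= schatten1_norm A.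
Proof. by move=> sA; apply: sumr_ge0 => i _; exact: (singular_valuesP sA).1. Qed.

End NormBounds.

Section Exponent.
Context {R : realType}.

Definition nonzero_entries (s : @store R) (q k : nat) : {set 'I_k * 'I_k} :=
  [set x : 'I_k * 'I_k | mats s q x.1 x.2 != 0].

(** Of the instructions in an arithmetic program only [RSet] changes a matrix: one entry, in at
    least unit time. *)
Lemma exec_nonzero_entries (kap : nat -> R) (eig : @spectral_oracle R) (c : cmd) (s : @store R) (t : R) (s' : @store R) (q k : nat) :
  exec kap eig c s t s' -> Defs.arithmetic c -> 0 <= t /\
  #|nonzero_entries s' q k|%:R <= #|nonzero_entries s q k|%:R + t.
Proof.
elim=> //= {c s t s'}.
- by move=> s _; rewrite lerDl.
- by move=> s a e _; rewrite lerDl.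
- move=> s q' i j e _; split=> //; set s1 := set_mat _ _ _.
  apply: (@le_trans _ _ (#|nonzero_entries s q k|%:R + 1)); last by rewrite lerD2l ler1n.
  pose X : {set 'I_k * 'I_k} :=
      finset (fun x => (val x.1 == ieval s i) && (val x.2 == ieval s j)).
  have X1 : (#|X| <= 1)%N.
    apply/card_le1_eqP => -[x1 x2] [y1 y2]; rewrite !inE /= => /andP[/eqP h1 /eqP h2] /andP[/eqP h3 /eqP h4].
    by congr pair; apply: val_inj; rewrite /= ?h1 ?h3 ?h2 ?h4.
  have sub : nonzero_entries s1 q k \subset nonzero_entries s q k :|: X.
    apply/fintype.subsetP => -[x1 x2]; rewrite !inE /s1 /= /upd /=.
    case: ifP => [/eqP ->|_]; last by move=> ->.
    case: ifP => [/eqP E|_]; last by move=> ->.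
    by rewrite -E; case: ifP => [_|_ ->]; rewrite ?eqxx ?orbT.
  rewrite natr1 ler_nat -addn1; apply: leq_trans (subset_leq_card sub) _.
  by apply: leq_trans (leq_card_setU _ _) _; rewrite leq_add2l.
- move=> c1 c2 s1 s2 s3 t1 t2 _ IH1 _ IH2 /andP[/IH1[t10 H1] /IH2[t20 H2]].
  by split; [rewrite addr_ge0|apply: le_trans H2 _; rewrite addrA lerD2r].
- move=> b c1 c2 s s' t _ IH /andP[a1 a2].
  have [|t0 H] := IH; first by case: ifP.
  by split; [rewrite addr_ge0|apply: le_trans H _; rewrite lerD2l lerDr].
- by move=> b c s _ _; split=> //; rewrite lerDl.
move=> b c s1 s2 s3 t1 t2 _ _ IH1 _ IH2 ac; have [t10 H1] := IH1 ac; have [t20 H2] := IH2 ac.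
split; first by rewrite !addr_ge0.
have : 0 <= (tcost b)%:R :> R by []. lra.
Qed.

(* The product of two all-ones matrices has k^2 nonzero entries, and writing each of
   them takes unit time. *)
Lemma matmul_exponent_ge2 (omega : R) : matmul_exponent omega -> 2 <= omega.
Proof.
move=> mmE; rewrite leNgt; apply/negP => om2.
(* Half of the gap, so that the exponent [omega + delta] is [2 - delta] and [k^2 <= K k^(2 - delta)]
   would bound [k^delta] for all [k]. *)
pose delta := (2 - omega) / 2.
have d0 : 0 < delta by rewrite divr_gt0 // subr_gt0.
have [c [K [ac H]]] := mmE delta d0.
have dom : omega + delta = 2 - delta by rewrite /delta; field.
have bound k : (0 < k)%N -> k%:R `^ delta <= K.
  move=> k0; pose J : 'M[R]_k := const_mx 1.
  have [t [s [E tK sE]]] := H (fun=> 0) (fun n _ => (0, 0)) k J J k0.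
  have [t0 cnt] := exec_nonzero_entries 2 k E ac.
  have full : #|nonzero_entries s 2 k| = (k * k)%N.
    rewrite -[in RHS](card_ord k) -card_prod; apply: eq_card => -[x1 x2]; rewrite !inE /=.
    have := congr1 (fun M : 'M[R]_k => M x1 x2) sE; rewrite !mxE => ->.
    under eq_bigr do rewrite !mxE mulr1.
    by rewrite sumr_const card_ord pnatr_eq0 -lt0n.
  have empty : #|nonzero_entries (mm_input J J) 2 k| = 0%N.
    by apply: eq_card0 => -[x1 x2]; rewrite !inE /= eqxx.
  rewrite full empty add0r in cnt.
  have kp : 0 < k%:R :> R by rewrite ltr0n.
  have : k%:R ^+ 2 <= K * (k%:R `^ 2 * k%:R `^ (- delta)).
    rewrite -powRD ?(gt_eqF kp) ?implybT // -dom; apply: le_trans tK; apply: le_trans cnt.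
    by rewrite natrM expr2.
  rewrite powR_mulrn ?ler0n // powRN mulrCA -[leLHS]mulr1 ler_pM2l ?exprn_gt0 //.
  by rewrite ler_pdivlMr ?powR_gt0 // mul1r.
have K0 : 0 <= K by apply: le_trans (bound 1%N isT); exact: powR_ge0.
pose k := (Num.truncn ((K + 1) `^ (delta^-1))).+1.
have := bound k isT; apply/negP; rewrite -ltNge.
apply: (@lt_le_trans _ _ (K + 1)); first by rewrite ltrDl.
have K1 : 0 <= K + 1 by rewrite addr_ge0.
have -> : K + 1 = ((K + 1) `^ (delta^-1)) `^ delta.
  by rewrite -powRrM mulVf ?gt_eqF // powRr1.
apply: ge0_ler_powR; rewrite ?(ltW d0) ?nnegrE ?powR_ge0 //.
by have /andP[_ /ltW] := truncn_itv (powR_ge0 (K + 1) (delta^-1)).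
Qed.

Lemma expR1_le4 : expR 1 <= 4 :> R.
Proof.
have H : expR (1 / 2) <= 2 :> R.
  have := expR_ge1Dx (- (1 / 2) : R); rewrite expRN => H.
  have : (expR (1 / 2))^-1 >= 2^-1 :> R by lra.
  by rewrite lef_pV2 ?posrE ?expR_gt0.
have -> : 1 = 1 / 2 + 1 / 2 :> R by lra.
rewrite expRD; apply: (@le_trans _ _ (2 * 2)); last lra.
by rewrite ler_pM ?expR_ge0.
Qed.

(** Minimality gives [2^(sb - 1) < x], hence [(sb - 1) / 2 <= ln x] because [ln 2 >= 1/2]; the
    missing 1 is at most [ln x]. *)
Lemma bit_size_exists (x : R) : 10000 <= x -> exists sb : nat,
  [/\ (0 < sb)%N, x <= (2 ^ sb)%:R, forall k, (k < sb)%N -> (2 ^ k)%:R < x &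
      sb%:R <= 3 * ln x].
Proof.
move=> x100; have x0 : 0 < x by lra.
have ex : exists k, x <= (2 ^ k)%:R.
  exists (Num.truncn x).+1; have /andP[_ /ltW H] := truncn_itv (ltW x0); apply: le_trans H _.
  by rewrite ler_nat ltnW // ltn_expl.
pose sb := ex_minn ex; exists sb; rewrite /sb; case: ex_minnP => k kx kmin.
have k0 : (0 < k)%N.
  by rewrite lt0n; apply/eqP => E; move: kx; rewrite E expn0; lra.
have lt j : (j < k)%N -> (2 ^ j)%:R < x.
  by move=> jk; rewrite ltNge; apply/negP => /kmin; rewrite leqNgt jk.
split=> //.
have L1 : 1 <= ln x.
  by rewrite -[leLHS](expRK 1) ler_ln ?posrE ?expR_gt0 //; have := expR1_le4; lra.
have : (2 ^ k.-1)%:R < x by apply: lt; rewrite prednK.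
move=> /ltW; rewrite natrX -ler_ln ?posrE ?exprn_gt0 // lnXn //.
have l2 : 1 / 2 <= ln 2 :> R.
  rewrite -[leLHS](expRK (1 / 2)) ler_ln ?posrE ?expR_gt0 //.
  have := expR_ge1Dx (- (1 / 2) : R); rewrite expRN => H.
  have : (expR (1 / 2))^-1 >= 2^-1 :> R by lra.
  by rewrite lef_pV2 ?posrE ?expR_gt0.
have kE : k%:R = (k.-1)%:R + 1 :> R by rewrite natr1 prednK.
rewrite -(mulr_natl (ln _)) kE => H.
have : (k.-1)%:R * (1 / 2) <= (k.-1)%:R * ln 2 :> R by rewrite ler_wpM2l.
by lra.
Qed.

End Exponent.

(** * Scaled instances and running time *)

(** Since division by 0 yields 0, this includes [v = 0]: instances with [C = 0], with all [A_i = 0]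
    or with bound [rho = 0] are normalized like the others. *)
Lemma ler_norm_ratio (R : realFieldType) (x v : R) : `|x| <= v -> `|x / v| <= 1 /\ v * (x / v) = x.
Proof.
move=> xv; have [v0|v0] := eqVneq v 0.
  by move: xv; rewrite v0 normr_le0 => /eqP ->; rewrite !mul0r normr0.
split; last by rewrite mulrC divfK.
have vp : 0 < v by rewrite lt_neqAle eq_sym v0 (le_trans _ xv).
by rewrite normrM normfV (gtr0_norm vp) ler_pdivrMr // mul1r.
Qed.

Section Instance.
Context {R : realType} (eig : @spectral_oracle R) (eigP : spectral_oracle_spec eig).
Context {m n sb : nat} (n0 : (0 < n)%N) (m0 : (0 < m)%N).
Context (C : 'M[R]_n) (A : 'I_m -> 'M[R]_n) (b : 'cV[R]_m) (rho eps : R) (Xopt : 'M[R]_n).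
Hypotheses (sC : C \is symmetricmx) (sA : forall i, A i \is symmetricmx).
Hypotheses (bounded : forall X, sdp_feasible A b X -> spectral_norm X <= rho)
  (opt : sdp_optimal C A b Xopt) (eps01 : 0 < eps <= 1 / 100).
Notation h := ((2 ^ sb)%:R : R).
Hypothesis (hP : (100 * (n * m))%:R / eps <= h).
Let M := mats (sdp_input C A b rho eps).
Context (a c : R).
Hypotheses
  (cP : is_max 0 (fun y => exists p q, [/\ (p < n)%N, (q < n)%N & y = M 0%N p q]) c)
  (aP : is_max 0 (entries_of m n M) a).
Notation Cn := (normalized_C n c M).
Notation An := (@rounded_A R m n sb a M).
Notation bn := (normalized_b m a M).
Notation Z := (rho^-1 *: Xopt).
Let As i : 'M[R]_n := a^-1 *: A i.

Lemma input_C (p q : 'I_n) : M 0%N p q = C p q.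
Proof. exact: put_in. Qed.

Lemma input_A (i : 'I_m) (p q : 'I_n) : M (i + 3)%N p q = A i p q.
Proof. by rewrite /M addn3 /= valK put_in. Qed.

Lemma input_b (i : 'I_m) : M 1%N i 0%N = b i 0.
Proof. by rewrite /M /= (put_in b _ i 0). Qed.

Lemma eps_gt0 : 0 < eps. Proof. by case/andP: eps01. Qed.

Lemma h_bounds : [/\ 100 <= h, m%:R <= h, n%:R <= h & h^-1 <= eps / (100 * n%:R)].
Proof.
have [e0 e1] := andP eps01; have e1' : eps <= 1 by lra.
have nm : 1 <= (n * m)%:R :> R by rewrite ler1n muln_gt0 n0.
have H : 100 * (n * m)%:R <= h * eps by rewrite -natrM -ler_pdivrMr.
have hn : h * eps <= h by rewrite -[leRHS]mulr1 ler_wpM2l.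
have n1 : 1 <= n%:R :> R by rewrite ler1n.
have m1 : 1 <= m%:R :> R by rewrite ler1n.
move: H nm; rewrite natrM => H nm.
have nn : n%:R <= n%:R * m%:R :> R by rewrite ler_peMr // ler0n.
have mm : m%:R <= n%:R * m%:R :> R by rewrite ler_peMl // ler0n.
split; try lra.
have h0 : 0 < h by lra.
rewrite ler_pdivlMr ?mulr_gt0 ?ltr0n // mulrC ler_pdivrMr // mulrC.
lra.
Qed.

Lemma cnorm (p q : 'I_n) : `|C p q| <= c.
Proof. by case: cP => _ H _; apply: H; exists p, q; rewrite input_C. Qed.

Lemma anorm i (p q : 'I_n) : `|A i p q| <= a.
Proof. by case: aP => _ H _; apply: H; exists i, p, q; rewrite input_A. Qed.

Lemma max_C_le : 0 <= c <= spectral_norm C.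
Proof.
case: cP => c0 _ H; rewrite c0 H // => [|x].
  by apply: le_trans (le_spectral_norm C (Ordinal n0) (Ordinal n0)).
by move=> [p [q [pn qn ->]]]; rewrite (input_C (Ordinal pn) (Ordinal qn)) le_spectral_norm.
Qed.

Lemma max_A_le : 0 <= a <= \sum_(i < m) schatten1_norm (A i).
Proof.
case: aP => a0 _ H; rewrite a0 H // => [|x].
  by apply: sumr_ge0 => i _; exact: schatten1_norm_ge0 eigP _ _ (sA i).
move=> [i [p [q [im pn qn ->]]]]; rewrite (input_A (Ordinal im) (Ordinal pn) (Ordinal qn)).
apply: le_trans (le_schatten1_norm eigP _ _ (sA _)) _.
rewrite (bigD1 (Ordinal im)) //= lerDl sumr_ge0 // => k _.
exact: schatten1_norm_ge0 eigP _ _ (sA k).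
Qed.

Lemma opt_entry p q : `|Xopt p q| <= rho.
Proof. by apply: le_trans (le_spectral_norm Xopt p q) (bounded _); case: opt. Qed.

Lemma rho_ge0 : 0 <= rho.
Proof. exact: le_trans (normr_ge0 _) (opt_entry (Ordinal n0) (Ordinal n0)). Qed.

Lemma Z_psd : psdmx Z.
Proof. by apply: psdmxZ; rewrite ?invr_ge0 ?rho_ge0 //; case: opt => -[]. Qed.

Lemma Z_entry i j : `|Z i j| <= 1.
Proof. by rewrite mxE mulrC; exact: (ler_norm_ratio (opt_entry i j)).1. Qed.

Lemma scaled_Z : Xopt = rho *: Z.
Proof. by apply/matrixP => i j; rewrite !mxE [rho^-1 * _]mulrC (ler_norm_ratio (opt_entry i j)).2. Qed.

Lemma Cn_entry i j : `|Cn i j| <= 1.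
Proof. by rewrite mxE input_C; exact: (ler_norm_ratio (cnorm i j)).1. Qed.

Lemma scaled_Cn : C = c *: Cn.
Proof. by apply/matrixP => i j; rewrite !mxE input_C (ler_norm_ratio (cnorm i j)).2. Qed.

Lemma Cn_sym : Cn \is symmetricmx.
Proof. by apply/symmxP => i j; rewrite !mxE !input_C (symmxP _ sC). Qed.

Lemma As_entry i p q : `|As i p q| <= 1.
Proof. by rewrite mxE mulrC; exact: (ler_norm_ratio (anorm i p q)).1. Qed.

Lemma scaled_As i : A i = a *: As i.
Proof. by apply/matrixP => p q; rewrite !mxE [a^-1 * _]mulrC (ler_norm_ratio (anorm i p q)).2. Qed.

Lemma AnE i p q : An i p q = round_scaled sb 0 (As i p q) / h ^+ 60.
Proof.
rewrite mxE scaled_entryE [As i p q]mxE [a^-1 * _]mulrC; congr (round_scaled _ _ (_ / _) / _).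
by rewrite divnMDl // divn_small // addn0 modnMDl modn_small // input_A.
Qed.

Lemma An_sym i : An i \is symmetricmx.
Proof. by apply/symmxP => p q; rewrite !AnE !mxE (symmxP _ (sA i)). Qed.

Lemma An_near (sb0 : (0 < sb)%N) i p q : `|An i p q| <= 1 /\ `|(An i - As i) p q| <= h ^- 60.
Proof.
have h0 : 0 < h ^+ 60 by rewrite exprn_gt0 // ltr0n expn_gt0.
have := As_entry i p q; set x := As i p q => x1.
have [/andP[r1 r2] r3 _] := round_scaledP sb0 (k := 0) x1.
have -> : (An i - As i) p q = An i p q - x by rewrite mxE [X in _ + X]mxE.
rewrite AnE; split.
  by rewrite normrM normfV (gtr0_norm h0) ler_pdivrMr // mul1r.
set r := round_scaled _ _ _ in r1 r2 r3 *.
have -> : r / h ^+ 60 - x = - ((x * h ^+ 60 - r) / h ^+ 60).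
  by rewrite [in RHS]mulrBl mulfK ?(gt_eqF h0) // opprB.
by rewrite normrN normrM normfV (gtr0_norm h0) ger0_norm // ler_pdivrMr // mulVf ?gt_eqF.
Qed.

Lemma bnE i : mxdot (As i) Z = bn i 0.
Proof.
rewrite mxE mxdotZl mxdotZr input_b /M /= invfM mulrA mulrC; congr (_ * _).
by case: opt => -[_ ->].
Qed.

Lemma An_residual (sb0 : (0 < sb)%N) i : `|mxdot (An i) Z - bn i 0| <= h ^- 58.
Proof.
have [h100 _ nh _] := h_bounds; have h0 : 0 < h by lra.
rewrite -bnE -mxdotBl.
apply: le_trans (ler_mxdot (fun p q => (An_near sb0 i p q).2) Z_entry) _.
rewrite mulr1 [X in _ <= X](_ : _ = h ^+ 2 * h ^- 60); last first.
  have hN k : h ^+ k != 0 by rewrite gt_eqF ?exprn_gt0.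
  by rewrite -[LHS]mul1r; apply/eqP; rewrite (eqr_div _ _ (hN _) (hN _)) mul1r -exprD.
by rewrite ler_pM2r ?invr_gt0 ?exprn_gt0 // lerXn2r ?nnegrE ?ler0n ?(ltW h0).
Qed.

(** Undoing the normalization multiplies the objective gap [h^-1] by [c rho] and the residuals by
    [a rho]. The entries [c] and [a] are at most the norms in the guarantee, and [h^-1 <= eps]. *)
Lemma solved_sdp (sb0 : (0 < sb)%N) (s : @store R) (X := sdp_output n s) :
  solved eig Cn An bn h rho s ->
  [/\ psdmx X, mxdot C Xopt - eps * spectral_norm C * rho <= mxdot C X &
      \sum_(i < m) `|mxdot (A i) X - b i 0| <=
        4 * n%:R * eps * (rho * (\sum_(i < m) schatten1_norm (A i)) + l1_norm b)].
Proof.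
have [h100 mh nh heps] := h_bounds; have h0 : 0 < h by lra.
have hX k : 0 < h ^+ k by rewrite exprn_gt0.
have e0 := eps_gt0; have r0 := rho_ge0.
have [/andP[c0 cS] /andP[a0 aS]] := (max_C_le, max_A_le).
have n1 : 1 <= n%:R :> R by rewrite ler1n.
move=> [ct [gt [[ctR gtE] gt_small sE]]].
set P := primal eig Cn An (h ^- 4) ct.
have XE : X = rho *: P by apply/matrixP => i j; rewrite [LHS]mxE sE [RHS]mxE.
have hP1 : h^-1 <= eps.
  apply: le_trans heps _; rewrite ler_pdivrMr ?mulr_gt0 ?ltr0n // ler_peMr ?(ltW e0) //; lra.
split.
- rewrite XE; apply: psdmxZ => //; rewrite /P.
  have mu0 : 0 < h ^- 4 by rewrite invr_gt0.
  exact: (primal_psd eigP Cn_sym An_sym mu0).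
- have H : mxdot Cn Z - mxdot Cn P <= h^-1.
    exact: (small_gradient_objective eigP Cn_sym An_sym h100 mh nh Z_psd Z_entry (An_residual sb0) ctR gtE gt_small).
  rewrite XE {1}scaled_Z lerBlDr -lerBlDl -mxdotBr -scalerBr scaled_Cn mxdotZl mxdotZr mxdotBr -scaled_Cn.
  apply: (@le_trans _ _ (c * (rho * eps))); first by rewrite !ler_wpM2l // (le_trans H).
  by rewrite (mulrC eps) -mulrA (mulrC eps) ler_wpM2r ?mulr_ge0 // ltW.
(* [2 h^-3] comes from the small gradient for the rounded matrices, and [h^-3] from replacing these
   by the exact [A_i / a]. *)
have res i : `|mxdot (A i) X - b i 0| <= a * rho * (3 * h ^- 3).
  have -> : b i 0 = a * rho * bn i 0.
    rewrite -bnE; case: opt => -[_ <-] _; rewrite {1}scaled_As {1}scaled_Z.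
    by rewrite mxdotZl mxdotZr mulrA.
  rewrite XE {1}scaled_As mxdotZl mxdotZr mulrA -mulrBr normrM (ger0_norm (mulr_ge0 a0 r0)).
  rewrite ler_wpM2l ?mulr_ge0 //.
  have -> : mxdot (As i) P - bn i 0 = (mxdot (An i) P - bn i 0) - mxdot (An i - As i) P.
    by rewrite mxdotBl; ring.
  apply: le_trans (ler_normB _ _) _.
  have H1 := small_gradient_residual h100 ctR gtE gt_small i.
  have C1 := Cn_entry; have A1 k p q := (An_near sb0 k p q).1.
  have H2 := ler_mxdot (fun p q => (An_near sb0 i p q).2)
    (fun p q => primal_entry eigP Cn_sym An_sym C1 A1 h100 mh nh p q ctR).
  have H3 : n%:R ^+ 2 * (h ^- 60 * (2 * h ^+ 16)) <= h ^- 3.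
    apply: (@le_trans _ _ (h ^+ 2 * (h ^- 60 * (h * h ^+ 16)))).
      apply: ler_pM; rewrite ?sqr_ge0 ?mulr_ge0 ?invr_ge0 ?(ltW (hX _)) //.
        by rewrite lerXn2r ?nnegrE ?ler0n ?(ltW h0).
      by rewrite ler_pM2l ?invr_gt0 // ler_pM2r //; lra.
    rewrite mulrCA -exprS -exprD mulrC ler_pdivrMr // mulrC ler_pdivlMr // -exprD.
    by rewrite ler_weXn2l //; lra.
  by have := le_trans H2 H3; rewrite -/P in H1 *; lra.
apply: (@le_trans _ _ (m%:R * (a * rho * (3 * h ^- 3)))).
  apply: le_trans (ler_sum _ (fun i _ => res i)) _.
  by rewrite sumr_const card_ord -[_ *+ m]mulr_natl.
have L0 : 0 <= l1_norm b by apply: sumr_ge0.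
set S := \sum_(i < m) _ in aS *.
have H : m%:R * (3 * h ^- 3) <= 4 * n%:R * eps.
  apply: (@le_trans _ _ (h * (3 * h ^- 3))); first by rewrite ler_wpM2r // mulr_ge0 ?invr_ge0 ?(ltW (hX _)).
  have -> : h * (3 * h ^- 3) = 3 * h^-1 * h^-1 by field; rewrite gt_eqF.
  have : h^-1 <= 1 by rewrite invf_le1 //; lra.
  have hi : 0 < h^-1 by rewrite invr_gt0.
  move=> h1; apply: (@le_trans _ _ (3 * eps * 1)); first by apply: ler_pM => //; lra.
  rewrite mulr1 -mulrA; have : eps <= n%:R * eps by rewrite ler_peMl // ltW.
  lra.
have -> : m%:R * (a * rho * (3 * h ^- 3)) = m%:R * (3 * h ^- 3) * (rho * a) by ring.
apply: ler_pM => //; rewrite ?mulr_ge0 ?ler0n ?invr_ge0 ?(ltW (hX _)) //.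
by apply: ler_wpDr => //; rewrite ler_wpM2l.
Qed.

End Instance.

Section RunningTime.
Context {R : realType}.

Lemma expr_powR_ge1 (x r : R) : 1 <= x -> 0 <= r -> 1 <= x `^ r.
Proof. by move=> x1 r0; rewrite -[leLHS](powRr0 x) ler_powR. Qed.

Lemma ln_ge1 (x : R) : 100 <= x -> 1 <= ln x.
Proof.
by move=> x100; rewrite -[leLHS]expRK ler_ln ?posrE ?expR_gt0 //; have := @expR1_le4 R; lra.
Qed.

Lemma ln_hundredM_le (y : R) : 100 <= y -> ln (100 * y) <= 2 * ln y.
Proof.
move=> y100; have y0 : 0 < y by lra.
rewrite lnM ?posrE // [leRHS]mulr_natl mulr2n lerD2r ler_ln ?posrE //.
Qed.

(** The exponent [e] enters twice, through the hidden factor and through the cost of an [n x n]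
    instruction, and may be negative; both occurrences are bounded through [|e|]. *)
Lemma matrix_cost_le (omega K x l k e : R) (p : nat) : 0 <= omega -> 1 <= x -> 1 <= l ->
  k <= K * x `^ e * l ^+ p * x `^ (omega + e) ->
  k <= `|K| * l ^+ p * x `^ (2 * `|e|) * x `^ omega.
Proof.
move=> om0 x1 l1 kK; apply: le_trans kK _.
have x0 : x != 0 by rewrite gt_eqF // (lt_le_trans _ x1).
have x0' d : 0 <= x `^ d by exact: powR_ge0.
have xe : x `^ e <= x `^ `|e| by rewrite ler_powR // ler_norm.
rewrite [x `^ (omega + e)]powRD ?x0 ?implybT //.
have -> : 2 * `|e| = `|e| + `|e| by ring.
rewrite [x `^ (`|e| + `|e|)]powRD ?x0 ?implybT //.
have -> : K * x `^ e * l ^+ p * (x `^ omega * x `^ e) = K * (l ^+ p * x `^ omega * (x `^ e * x `^ e)) by ring.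
have -> : `|K| * l ^+ p * (x `^ `|e| * x `^ `|e|) * x `^ omega =
  `|K| * (l ^+ p * x `^ omega * (x `^ `|e| * x `^ `|e|)) by ring.
have l0 : 0 <= l ^+ p by rewrite exprn_ge0 // (le_trans _ l1).
apply: le_trans (_ : `|K| * (l ^+ p * x `^ omega * (x `^ e * x `^ e)) <= _).
  by rewrite ler_wpM2r ?ler_norm // !mulr_ge0.
by rewrite ler_wpM2l // ler_wpM2l ?mulr_ge0 // ler_pM.
Qed.

(** Everything is compared with [W = m^2 n^omega + m^4], where [n^2 <= n^omega] uses [2 <= omega].
    The constants are [10836 = 301 * 6^2] and [5418 = 3 * 301 * 6]: 301 from [300 N + 1 <= 301 N], 6
    from [sb <= 6 l], and 3 from two [n x n] instructions and one [1 x 1] instruction per step. *)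
Lemma running_time (omega Kc : R) (K1 K2 m n sb pc : nat) (e l k1 kn t : R) :
  2 <= omega -> (0 < m)%N -> (0 < n)%N -> (0 < sb)%N -> 1 <= l -> sb%:R <= 6 * l ->
  kn <= `|Kc| * l ^+ pc * n%:R `^ e * n%:R `^ omega ->
  k1 <= `|Kc| * l ^+ pc * n%:R `^ e -> 0 <= e ->
  t <= K1%:R * ((m * m + m * (n * n)) * sb)%:R +
    (300 * (m * m * sb)).+1%:R * (K2%:R * ((n * n + m * m) * sb)%:R + 2 * kn + k1) ->
  t <= (6 * K1%:R + 10836 * K2%:R + 5418 * `|Kc|) * n%:R `^ e * l ^+ (pc + 2) *
    (m%:R ^+ 2 * n%:R `^ omega + m%:R ^+ 4).
Proof.
move=> om2 m0 n0 sb0 l1 sbl knP k1P e0 tP; apply: le_trans tP _.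
have n1 : 1 <= n%:R :> R by rewrite ler1n.
have m1 : 1 <= m%:R :> R by rewrite ler1n.
have sb1 : 1 <= sb%:R :> R by rewrite ler1n.
set x := n%:R in n1 knP k1P *; set y := m%:R in m1 *; set s := sb%:R in sb1 sbl.
set E := x `^ e in knP k1P *; set O := x `^ omega in knP *.
have E1 : 1 <= E by exact: expr_powR_ge1.
have xO : x ^+ 2 <= O by rewrite -powR_mulrn ?(le_trans _ n1) // ler_powR.
have x21 : 1 <= x ^+ 2 by rewrite exprn_ege1.
have y21 : 1 <= y ^+ 2 by rewrite exprn_ege1.
have yy : y <= y ^+ 2 by rewrite expr2 ler_peMr // (le_trans _ m1).
set W := y ^+ 2 * O + y ^+ 4.
have y4 : y ^+ 4 = y ^+ 2 * y ^+ 2 by rewrite -exprD.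
have y24 : y ^+ 2 <= y ^+ 4 by rewrite y4 ler_peMr // (le_trans _ y21).
have W1 : y ^+ 2 + y * x ^+ 2 <= W.
  rewrite [leLHS]addrC lerD // ler_pM ?mulr_ge0 ?exprn_ge0 ?(le_trans _ n1) ?(le_trans _ m1) //.
have W2 : y ^+ 2 * (x ^+ 2 + y ^+ 2) <= W.
  by rewrite mulrDr -y4 lerD2r ler_wpM2l // (le_trans _ y21).
have y2O : y ^+ 2 * O <= W by rewrite lerDl exprn_ge0 // (le_trans _ m1).
have y2W : y ^+ 2 <= W by apply: le_trans W1; rewrite lerDl mulr_ge0 ?exprn_ge0 ?(le_trans _ n1) ?(le_trans _ m1).
have W0 : 1 <= W by exact: le_trans y2W.
have Lp k : 1 <= l ^+ k by rewrite exprn_ege1.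
set D := `|Kc| * l ^+ pc * E in knP k1P.
have D0 : 0 <= D by rewrite !mulr_ge0 // ?(le_trans _ (Lp _)) ?(le_trans _ E1).
have T1 : K1%:R * ((m * m + m * (n * n)) * sb)%:R <= K1%:R * (W * (6 * l)).
  rewrite ler_wpM2l ?ler0n // natrM natrD !natrM -/x -/y -/s -!expr2.
  by rewrite ler_pM ?addr_ge0 ?mulr_ge0 ?exprn_ge0 ?(le_trans _ n1) ?(le_trans _ m1) ?(le_trans _ sb1).
have T2 : (300 * (m * m * sb)).+1%:R <= 301 * (y ^+ 2 * s).
  rewrite -natr1 !natrM -/y -/s -expr2; have : 1 <= y ^+ 2 * s by rewrite -[leLHS]mulr1 ler_pM.
  lra.
have s0 : 0 <= s by lra.
have T3 : K2%:R * ((n * n + m * m) * sb)%:R + 2 * kn + k1 <=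
    K2%:R * ((x ^+ 2 + y ^+ 2) * s) + 2 * (D * O) + D.
  by rewrite natrM natrD !natrM -/x -/y -/s -!expr2; lra.
have T30 : 0 <= K2%:R * ((x ^+ 2 + y ^+ 2) * s) + 2 * (D * O) + D.
  have xy0 : 0 <= x ^+ 2 + y ^+ 2 by rewrite addr_ge0 ?sqr_ge0.
  have O0 : 0 <= O by exact: powR_ge0.
  have := mulr_ge0 D0 O0; have := mulr_ge0 (ler0n R K2) (mulr_ge0 xy0 s0); lra.
have N0 := ler0n R (300 * (m * m * sb)).+1.
set N := _.+1%:R in T2 N0 *.
have T4 : N * (K2%:R * ((n * n + m * m) * sb)%:R + 2 * kn + k1) <=
    301 * (y ^+ 2 * s) * (K2%:R * ((x ^+ 2 + y ^+ 2) * s) + 2 * (D * O) + D).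
  exact: le_trans (ler_wpM2l N0 T3) (ler_wpM2r T30 T2).
have l0 : 0 <= l by exact: le_trans l1.
have T5 : 301 * (y ^+ 2 * s) * (K2%:R * ((x ^+ 2 + y ^+ 2) * s) + 2 * (D * O) + D) <=
    301 * K2%:R * (W * (6 * l) ^+ 2) + 903 * (D * (W * (6 * l))).
  have -> : 301 * (y ^+ 2 * s) * (K2%:R * ((x ^+ 2 + y ^+ 2) * s) + 2 * (D * O) + D) =
    301 * K2%:R * (y ^+ 2 * (x ^+ 2 + y ^+ 2) * s ^+ 2) + 301 * (D * ((2 * (y ^+ 2 * O) + y ^+ 2) * s)).
    by ring.
  apply: lerD.
    have s6 : s ^+ 2 <= (6 * l) ^+ 2 by rewrite lerXn2r ?nnegrE // mulr_ge0.
    have yx0 : 0 <= y ^+ 2 * (x ^+ 2 + y ^+ 2) by rewrite mulr_ge0 ?addr_ge0 ?sqr_ge0.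
    by apply: ler_wpM2l; [exact: mulr_ge0 (ler0n _ _) (ler0n _ _)|exact: ler_pM yx0 (sqr_ge0 _) W2 s6].
  have : (2 * (y ^+ 2 * O) + y ^+ 2) * s <= (3 * W) * (6 * l).
    by rewrite ler_pM ?addr_ge0 ?mulr_ge0 ?sqr_ge0 ?powR_ge0 //; lra.
  by move=> /(ler_wpM2l D0); lra.
apply: le_trans (lerD T1 (le_trans T4 T5)) _.
have lW : l * W <= E * l ^+ (pc + 2) * W.
  rewrite ler_wpM2r ?(le_trans _ W0) // -[leLHS]mul1r ler_pM //.
  by rewrite -{1}(expr1 l) ler_weXn2l // addn2.
have l2W : l ^+ 2 * W <= E * l ^+ (pc + 2) * W.
  by rewrite ler_wpM2r ?(le_trans _ W0) // -[leLHS]mul1r ler_pM ?exprn_ge0 // ler_weXn2l // leq_addl.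
have DlW : D * (l * W) <= `|Kc| * (E * l ^+ (pc + 2) * W).
  have -> : D * (l * W) = `|Kc| * (E * l ^+ pc.+1 * W) by rewrite exprS /D; ring.
  rewrite ler_wpM2l // ler_wpM2r ?(le_trans _ W0) // ler_wpM2l ?(le_trans _ E1) //.
  by rewrite ler_weXn2l // addn2.
have K10 : 0 <= K1%:R :> R by []; have K20 : 0 <= K2%:R :> R by [].
have := ler_wpM2l K10 lW; have := ler_wpM2l K20 l2W.
rewrite exprMn; set V := E * l ^+ (pc + 2) * W in DlW *.
have -> : (6 * K1%:R + 10836 * K2%:R + 5418 * `|Kc|) * E * l ^+ (pc + 2) * W =
  6 * (K1%:R * V) + 10836 * (K2%:R * V) + 5418 * (`|Kc| * V) by rewrite /V; ring.
lra.
Qed.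

End RunningTime.

Theorem theorem12p12 (R : realType) (omega : R)
    (kappa : nat -> nat -> R -> nat -> R) :
  matmul_exponent omega -> matrix_op_cost omega kappa ->
  exists (c : cmd) (K : R) (p : nat) (e : nat -> R), e @ \oo --> (0 : R) /\
  forall eig : spectral_oracle, spectral_oracle_spec eig ->
  forall (m n : nat) (C : 'M[R]_n) (A : 'I_m -> 'M[R]_n) (b : 'cV[R]_m)
    (rho eps : R) (Xopt : 'M[R]_n),
    (0 < m)%N -> (0 < n)%N ->
    C \is symmetricmx -> (forall i, A i \is symmetricmx) ->
    no_redundant_constraints A ->
    (forall X, sdp_feasible A b X -> spectral_norm X <= rho) ->
    sdp_optimal C A b Xopt ->
    0 < eps <= 1 / 100 ->
  exists (t : R) (s : store),
    let X := sdp_output n s in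
    [/\ exec (kappa m n eps) eig c (sdp_input C A b rho eps) t s,
        t <= Ostar_factor K p e m n eps *
             ((m * n)%:R `^ (1 / 4) *
              (m%:R ^+ 2 * n%:R `^ omega + m%:R ^+ 4) * ln (1 / eps)),
        psdmx X,
        mxdot C Xopt - eps * spectral_norm C * rho <= mxdot C X &
        \sum_(i < m) `|mxdot (A i) X - b i 0| <=
          4 * n%:R * eps *
          (rho * (\sum_(i < m) schatten1_norm (A i)) + l1_norm b)].
Proof.
move=> mmE [Kc [pc [ec [ec0 kapP]]]]; have om2 := matmul_exponent_ge2 mmE.
have [K1 preprocessP] := wp_preprocess; have [K2 main_loopP] := wp_main_loop.
(* Two logarithms are added to the [pc] of a matrix instruction: one from the number of steps and
   one from the bits of a digit. The exponent is the [2 |e|] of [matrix_cost_le]. *)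
exists Solve, (6 * K1%:R + 10836 * K2%:R + 5418 * `|Kc|), (pc + 2)%N, (fun n => 2 * `|ec n|).
split.
  have e2 : (fun n => 2 * `|ec n|) @ \oo --> 2 * `|0 : R|.
    by apply: cvgM; [exact: cvg_cst|exact: cvg_norm ec0].
  by rewrite normr0 mulr0 in e2.
move=> eig eigP m n C A b rho eps Xopt m0 n0 sC sA _ bounded opt eps01.
have [e0 e1] := andP eps01.
have mn1 : 1 <= (m * n)%:R :> R by rewrite ler1n muln_gt0 m0.
have mne : 100 <= (m * n)%:R / eps.
  by rewrite ler_pdivlMr //; lra.
have xE : (100 * (n * m))%:R / eps = 100 * ((m * n)%:R / eps) 
  by rewrite (mulnC n) natrM mulrA.
have x_ge : 10000 <= (100 * (n * m))%:R / eps by rewrite xE; lra.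
have [sb [sb0 xsb sbmin sbl]] := bit_size_exists x_ge.
set s0 := sdp_input C A b rho eps; set kap := kappa m n eps.
have kapn : 0 <= kap n <= Ostar_factor Kc pc ec m n eps * n%:R `^ (omega + ec n) by exact: kapP.
have kap1 : 0 <= kap 1%N <= Ostar_factor Kc pc ec m n eps * 1%:R `^ (omega + ec 1%N) by exact: kapP.
have [/andP[kapn0 kapnP] /andP[kap10 kap1P]] := (kapn, kap1).
have [h100 mh nh _] := h_bounds n0 m0 eps01 xsb.
have [t [s [E tT [XP Xobj Xres]]]] : wp kap eig Solve s0
    (K1%:R * ((m * m + m * (n * n)) * sb)%:R +
     (300 * (m * m * sb)).+1%:R * (K2%:R * ((n * n + m * m) * sb)%:R + 2 * kap n + kap 1%N))
    (fun s => let X := sdp_output n s in [/\ psdmx X,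
       mxdot C Xopt - eps * spectral_norm C * rho <= mxdot C X &
       \sum_(i < m) `|mxdot (A i) X - b i 0| <=
         4 * n%:R * eps * (rho * (\sum_(i < m) schatten1_norm (A i)) + l1_norm b)]).
  apply: wp_bind (preprocessP R kap eig n m sb n0 m0 sb0 s0 _ _ xsb sbmin) _ => //.
  move=> s [a [c [cP aP [S s9] x0 B0]]].
  have A1 i p q : (i < m)%N -> (p < n)%N -> (q < n)%N -> `|mats s0 (i + 3) p q / a| <= 1.
    move=> im pn qn; case: aP => _ H _; apply: (ler_norm_ratio _).1.
    by apply: H; exists i, p, q.
  apply: wp_le (main_loopP R kap eig eigP n m sb n0 m0 sb0 a c s0 s (rho^-1 *: Xopt)
    h100 mh nh kapn0 kap10 A1 _ _ _ _ _ _ _ S s9 x0 B0) (lexx _) _.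
  - exact: (Cn_entry cP).
  - exact: Cn_sym.
  - exact: An_sym.
  - by move=> i p q; exact: (An_near n0 aP sb0 i p q).1.
  - exact: (Z_psd n0 bounded opt).
  - exact: (Z_entry bounded opt).
  - exact: (An_residual n0 m0 bounded opt eps01 xsb aP sb0).
  - by move=> s'; exact: (solved_sdp eigP n0 m0 sC sA bounded opt eps01 xsb cP aP sb0).
exists t, s; split; [exact: E| |exact: XP|exact: Xobj|exact: Xres]; rewrite /Ostar_factor.
set l := ln _; have l1 : 1 <= l by exact: ln_ge1.
have n1 : 1 <= n%:R :> R by rewrite ler1n.
have sb6 : sb%:R <= 6 * l.
  apply: le_trans sbl _; have -> : 6 * l = 3 * (2 * l) by rewrite mulrA -natrM.
  by rewrite ler_pM2l // xE; exact: ln_hundredM_le.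
have W0 : 0 <= m%:R ^+ 2 * n%:R `^ omega + m%:R ^+ 4 :> R.
  by rewrite addr_ge0 ?mulr_ge0 ?exprn_ge0 ?powR_ge0.
have l0 : 0 <= l by exact: le_trans l1.
have knP := matrix_cost_le (le_trans (ler0n R 2) om2) n1 l1 kapnP.
have k1P : kap 1%N <= `|Kc| * l ^+ pc * n%:R `^ (2 * `|ec n|).
  apply: le_trans kap1P _; rewrite powR1 mulr1 /Ostar_factor -/l mulrAC.
  apply: (@le_trans _ _ (`|Kc| * l ^+ pc * n%:R `^ ec n)).
    by rewrite ler_wpM2r ?powR_ge0 // ler_wpM2r ?exprn_ge0 // ler_norm.
  rewrite ler_wpM2l ?mulr_ge0 ?exprn_ge0 // ler_powR //.
  by apply: le_trans (ler_norm _) _; rewrite ler_peMl // ler1n.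
have ee : 0 <= 2 * `|ec n| by rewrite mulr_ge0.
apply: le_trans (running_time om2 m0 n0 sb0 l1 sb6 knP k1P ee tT) _.
apply: ler_wpM2l.
  apply: mulr_ge0; last exact: exprn_ge0.
  apply: mulr_ge0; last exact: powR_ge0.
  apply: addr_ge0; last exact: mulr_ge0 (ler0n _ _) (normr_ge0 _).
  by apply: addr_ge0; exact: mulr_ge0 (ler0n _ _) (ler0n _ _).
(* The remaining factors of the claimed bound are at least 1; for the logarithm this is because
   [1 / eps >= 100]. *)
have ln1 : 1 <= ln (1 / eps).
  by apply: ln_ge1; rewrite ler_pdivlMr // mulrC -ler_pdivlMr // div1r -[_^-1]div1r.
have q1 : 1 <= (m * n)%:R `^ (1 / 4) :> R by apply: expr_powR_ge1 => //; lra.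
rewrite -[leLHS]mulr1 ler_pM //.
by rewrite -[leLHS]mul1r ler_pM.
Qed.
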